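(* The following classification holds for second order PDE with a nondegenerate parametrization. (1) An equation $F(x,y,z,p,q,r,t)=0$ ($F$ independent of $s$) is hyperbolic when $i_F^*(F_rF_t)<0$. In that case it is of type 6-6 if and only if its locus is the zero-locus of a function affine in $r,t$ (i.e. of the form $ar+bt+c$ with $a,b,c$ functions of $x,y,z,p,q$), and of type 7-7 otherwise. (2) An equation $G(x,y,z,p,q,r,s)=0$ ($G$ independent of $t$) is hyperbolic when $i_G^*(G_s)\neq0$. In that case it is of type 6-6 if and only if its locus is the zero-locus of a function affine in $r,s$ (i.e. of the form $ar+bs+c$ with $a,b,c$ functions of $x,y,z,p,q$), and of type 6-7 otherwise. (3) An equation $rt=f(x,y,z,p,q,s)$ is hyperbolic when $4f<f_s^2$. In that case, assuming $rt\ne0$, it is of type 6-6 if and only if $f_{ss}=2$, and of type 7-7 if and only if $f_{ss}\neq2$.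
   Context: All considerations are local and in the smooth category. $J^2(\mathbb{R}^2,\mathbb{R})$ has coordinates $(x,y,z,p,q,r,s,t)$ ($p=z_x,q=z_y,r=z_{xx},s=z_{xy},t=z_{yy}$). For a second order PDE $F(x,y,z,p,q,r,s,t)=0$, a nondegenerate parametrization is a smooth map $i_F:\Sigma_7\to J^2(\mathbb{R}^2,\mathbb{R})$ from an open set $\Sigma_7\subset\mathbb{R}^7$, of maximal rank $7$, whose image is the locus $\{F=0\}$ and is everywhere transverse to the fibres of $J^2(\mathbb{R}^2,\mathbb{R})\to J^1(\mathbb{R}^2,\mathbb{R})$. $I_F$ is the Pfaffian system on $\Sigma_7$ generated by the pullbacks $\omega^1,\omega^2,\omega^3$ of $dz-p\,dx-q\,dy$, $dp-r\,dx-s\,dy$, $dq-s\,dx-t\,dy$. Up to scale, define $\langle\varphi,\psi\rangle_7\,\mathrm{Vol}=d\varphi\wedge d\psi\wedge\omega^1\wedge\omega^2\wedge\omega^3$ on $I_F$. The equation is hyperbolic if $i_F^*(F_rF_t-\frac14F_s^2)<0$; then $I_F$ contains exactly two rank-two maximally isotropic subsystems $M_1,M_2$. $\mathrm{class}(I)$ is the rank of the annihilator of $\{X: X\in I^\perp,\ X\lrcorner dI\subset I\}$; one has $\mathrm{class}(M_i)\in\{6,7\}$. A hyperbolic equation is of type 6-6 (Monge--Ampère) if $\mathrm{class}(M_1)=\mathrm{class}(M_2)=6$, of type 6-7 (Goursat) if $\{\mathrm{class}(M_1),\mathrm{class}(M_2)\}=\{6,7\}$, and of type 7-7 (generic) if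 $\mathrm{class}(M_1)=\mathrm{class}(M_2)=7$.
   Formalization: In (1) and (2) the ''otherwise'' clause assumes that the classes of M_1, M_2 are constant, since e.g. r = t + t^3 has classes 6,6 at t = 0 and 7,7 elsewhere; ''zero-locus of an affine function'' is read locally near each point of the locus. *)

(* Defs.v *)
From mathcomp Require Import all_boot all_order all_algebra.
From mathcomp Require Import all_classical all_reals all_analysis.

Set Implicit Arguments.
Unset Strict Implicit.
Unset Printing Implicit Defensive.

Import Order.TTheory GRing.Theory Num.Theory.
Import numFieldNormedType.Exports.
Local Open Scope classical_set_scope.
Local Open Scope ring_scope.

(* Conventions.  Points, tangent vectors and covectors of R^n are row vectors
   'rV[R]_n; a 1-form is its row of coefficients, as a function of the point;
   a 2-form W is an antisymmetric matrix, with W(X, Y) = X *m W *m Y^T and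
   X _| W = X *m W.  A linear map acts on tangent vectors by X |-> X *m J, as
   for mathcomp-analysis' [jacobian], and pulls a covector w back to
   w *m J^T. *)

Definition partial (R : realType) n (k : 'I_n) (f : 'rV[R]_n -> R) :
    'rV[R]_n -> R :=
  'D_(delta_mx 0 k) f.

(* C^oo on U: every iterated partial derivative is (Frechet) differentiable
   at every point of U.  Meant for open U. *)
Definition smooth_on (R : realType) n (U : set 'rV[R]_n) (f : 'rV[R]_n -> R) :=
  forall (s : seq 'I_n) (u : 'rV[R]_n), U u ->
    differentiable (foldr (@partial R n) f s) u.

Definition ext_deriv (R : realType) n (w : 'rV[R]_n -> 'rV[R]_n)
    (u : 'rV[R]_n) : 'M[R]_n :=
  \matrix_(j, k) (partial j (fun v => w v 0 k) u
                  - partial k (fun v => w v 0 j) u).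

(* A Pfaffian system of rank k on U, given by k generators (the rows). *)
Definition pfaffian_system (R : realType) n k (U : set 'rV[R]_n)
    (M : 'rV[R]_n -> 'M[R]_(k, n)) :=
  (forall a b, smooth_on U (fun u => M u a b)) /\
  (forall u, U u -> row_free (M u)).

Definition subsystem (R : realType) n k1 k2 (U : set 'rV[R]_n)
    (M1 : 'rV[R]_n -> 'M[R]_(k1, n)) (M2 : 'rV[R]_n -> 'M[R]_(k2, n)) :=
  forall u, U u -> (M1 u <= M2 u)%MS.

Definition generator (R : realType) n k (M : 'rV[R]_n -> 'M[R]_(k, n))
    (a : 'I_k) : 'rV[R]_n -> 'rV[R]_n :=
  fun u => row a (M u).

(* The vectors X at u such that X is in M^perp and X _| dM is contained in M.
   It suffices to test generators of M: if w vanishes on X then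
   X _| d(g w) = X(g) w + g (X _| dw). *)
Definition cauchy_space (R : realType) n k (M : 'rV[R]_n -> 'M[R]_(k, n))
    (u : 'rV[R]_n) : 'M[R]_n :=
  (kermx (M u)^T
   :&: \bigcap_(a < k)
         kermx (ext_deriv (generator M a) u *m cokermx (M u)))%MS.

Definition class_at (R : realType) n k (M : 'rV[R]_n -> 'M[R]_(k, n))
    (u : 'rV[R]_n) : nat :=
  \rank (kermx (cauchy_space M u)^T).

(* The coefficient of dphi /\ dpsi /\ w1 /\ w2 /\ w3 on dx1 /\ ... /\ dx7,
   where w1, w2, w3 are the rows of I: expand dphi and dpsi on the 2-forms
   dxi /\ dxj (i < j) and use that a1 /\ ... /\ a7 = det(a1, ..., a7) Vol. *)
Definition pairing7 (R : realType) (I : 'rV[R]_7 -> 'M[R]_(3, 7))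
    (phi psi : 'rV[R]_7 -> 'rV[R]_7) (u : 'rV[R]_7) : R :=
  let e (i : 'I_7) : 'rV[R]_7 := delta_mx 0 i in
  \sum_(i < 7) \sum_(j < 7 | (i < j)%N) \sum_(k < 7) \sum_(l < 7 | (k < l)%N)
    ext_deriv phi u i j * ext_deriv psi u k l *
    \det (col_mx (e i) (col_mx (e j) (col_mx (e k) (col_mx (e l) (I u))))
          : 'M[R]_7).

Definition isotropic (R : realType) k (I : 'rV[R]_7 -> 'M[R]_(3, 7))
    (U : set 'rV[R]_7) (M : 'rV[R]_7 -> 'M[R]_(k, 7)) :=
  forall u, U u -> forall a b,
    pairing7 I (generator M a) (generator M b) u = 0.

Definition isotropic_subsystem (R : realType) k
    (I : 'rV[R]_7 -> 'M[R]_(3, 7)) (U : set 'rV[R]_7)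
    (M : 'rV[R]_7 -> 'M[R]_(k, 7)) :=
  [/\ pfaffian_system U M, subsystem U M I & isotropic I U M].

Definition maximally_isotropic (R : realType) k
    (I : 'rV[R]_7 -> 'M[R]_(3, 7)) (U : set 'rV[R]_7)
    (M : 'rV[R]_7 -> 'M[R]_(k, 7)) :=
  isotropic_subsystem I U M /\
  forall k' (M' : 'rV[R]_7 -> 'M[R]_(k', 7)),
    isotropic_subsystem I U M' -> subsystem U M M' -> subsystem U M' M.

(* The coordinates (x, y, z, p, q, r, s, t) of J^2(R^2, R) = R^8. *)
Definition cx : 'I_8 := @Ordinal 8 0 isT.
Definition cy : 'I_8 := @Ordinal 8 1 isT.
Definition cz : 'I_8 := @Ordinal 8 2 isT.
Definition cp : 'I_8 := @Ordinal 8 3 isT.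
Definition cq : 'I_8 := @Ordinal 8 4 isT.
Definition cr : 'I_8 := @Ordinal 8 5 isT.
Definition cs : 'I_8 := @Ordinal 8 6 isT.
Definition ct : 'I_8 := @Ordinal 8 7 isT.

(* The projection J^2 -> J^1 = R^5. *)
Definition J1proj (R : realType) (m : 'rV[R]_8) : 'rV[R]_5 :=
  lsubmx (m : 'rV[R]_(5 + 3)).

Definition J1fibre (R : realType) : 'M[R]_(3, 8) :=
  col_mx (delta_mx 0 cr : 'rV[R]_8)
    (col_mx (delta_mx 0 cs : 'rV[R]_8) (delta_mx 0 ct : 'rV[R]_8)).

(* dz - p dx - q dy, dp - r dx - s dy, dq - s dx - t dy *)
Definition contact_forms (R : realType) (m : 'rV[R]_8) : 'M[R]_(3, 8) :=
  let d (c : 'I_8) : 'rV[R]_8 := delta_mx 0 c in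
  let v (c : 'I_8) : R := m 0 c in
  col_mx (d cz - v cp *: d cx - v cq *: d cy)
    (col_mx (d cp - v cr *: d cx - v cs *: d cy)
            (d cq - v cs *: d cx - v ct *: d cy)).

Definition contact_system (R : realType) (iF : 'rV[R]_7 -> 'rV[R]_8)
    (u : 'rV[R]_7) : 'M[R]_(3, 7) :=
  contact_forms (iF u) *m (jacobian iF u)^T.

(* The equation is F = 0, for F defined on the open set D of J^2.  The last
   clause is the transversality T(image) + T(fibre) = T J^2. *)
Definition nondegenerate_parametrization (R : realType) (D : set 'rV[R]_8)
    (F : 'rV[R]_8 -> R) (S : set 'rV[R]_7) (iF : 'rV[R]_7 -> 'rV[R]_8) :=
  [/\ open S,
      forall c, smooth_on S (fun u => iF u 0 c),
      forall u, S u -> \rank (jacobian iF u) = 7,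
      iF @` S = [set m | D m /\ F m = 0]
    & forall u, S u -> row_full (jacobian iF u + J1fibre R)%MS].

Definition hyperbolic (R : realType) (F : 'rV[R]_8 -> R) (S : set 'rV[R]_7)
    (iF : 'rV[R]_7 -> 'rV[R]_8) :=
  forall u, S u ->
    partial cr F (iF u) * partial ct F (iF u)
    - 4^-1 * (partial cs F (iF u)) ^+ 2 < 0.

(* Type c1-c2: near each point of S, the two maximally isotropic rank-two
   subsystems M1, M2 of the contact system have class c1 and c2.  As M1 and M2
   are existentially quantified, c1 and c2 are not ordered. *)
Definition has_type (R : realType) (S : set 'rV[R]_7)
    (iF : 'rV[R]_7 -> 'rV[R]_8) (c1 c2 : nat) :=
  forall u, S u -> exists U : set 'rV[R]_7, [/\ open U, U u, U `<=` S &
    exists M1 M2 : 'rV[R]_7 -> 'M[R]_(2, 7),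
      [/\ maximally_isotropic (contact_system iF) U M1,
          maximally_isotropic (contact_system iF) U M2,
          forall v, U v -> ~~ (M1 v == M2 v)%MS
        & forall v, U v -> class_at M1 v = c1 /\ class_at M2 v = c2]].

(* Class is a number only when it is constant; e.g. r = t + t^3 has class 6 at
   t = 0 and class 7 elsewhere, hence has no type. *)
Definition constant_classes (R : realType) (S : set 'rV[R]_7)
    (iF : 'rV[R]_7 -> 'rV[R]_8) :=
  exists c1 c2, has_type S iF c1 c2.

Definition independent_of (R : realType) (C : {set 'I_8}) (D : set 'rV[R]_8)
    (F : 'rV[R]_8 -> R) :=
  forall m m', D m -> D m' ->
    (forall c, c \notin C -> m 0 c = m' 0 c) -> F m = F m'.

(* Locally, {F = 0} = {a v_c1 + b v_c2 + g = 0} with a, b, g functions on J^1.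
   [J1proj @` V] is open, J1proj being an open map. *)
Definition locus_affine_in (R : realType) (c1 c2 : 'I_8) (D : set 'rV[R]_8)
    (F : 'rV[R]_8 -> R) :=
  forall m0, D m0 -> F m0 = 0 ->
    exists (V : set 'rV[R]_8) (a b g : 'rV[R]_5 -> R),
      [/\ open V, V m0, V `<=` D,
          [/\ smooth_on (@J1proj R @` V) a, smooth_on (@J1proj R @` V) b
            & smooth_on (@J1proj R @` V) g]
        & forall m, V m ->
            (F m = 0 <->
             a (J1proj m) * m 0 c1 + b (J1proj m) * m 0 c2
             + g (J1proj m) = 0)].

(* Main.v *)
(* Let w1, w2, w3 be the contact forms.  The pairing vanishes on w1, and on a w2 + b w3 it is a
   nonzero multiple of F_t a^2 - F_s a b + F_r b^2.  So the two maximally isotropic systems are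
   spanned by w1 and a w2 + b w3, for the two null directions [a : b].  The only possible Cauchy
   direction of such a system is the vertical vector X = b^2 d/dr - a b d/ds + a^2 d/dt, and X is
   one exactly when [a : b] is stationary along X; the class is then 6, and otherwise 7.
   Differentiating the null equation along X turns this condition into the vanishing of the second
   derivative of F along X in the fibres of J^2 -> J^1.
   If F does not depend on s, both null directions give the condition that the curve cut out by F
   in the (r, t)-plane has curvature 0, that is, once F = 0 is solved for r, that r is an affine
   function of t.  If F does not depend on t, the direction b = 0 always has class 6, and the other
   one gives the same condition in the (r, s)-plane.  For F = r t - f the second derivative is
   a^2 b^2 (2 - f_ss), and r t <> 0 forces a b <> 0. *)

(* The class is computed from derivatives of generators, while the systems [M1], [M2] of a type are
   given by arbitrary smooth matrices. So Cauchy spaces are first shown to depend only on the span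
   of the generators; an isotropic system can then be rewritten with a differentiable null
   direction, and its class becomes [class_value], which sees only derivatives of [F] at one point.
   What remains is algebra at a point: the Hessian of [F] along the vertical vector, times the
   square of a nonzero first derivative, is a nonzero multiple of the curvature. Hyperbolicity
   enters twice. The null directions are simple, so the derivative of the null form at [a : b] does
   not vanish and the rotation of [a : b] can be traded for the Hessian. And F_r, F_s, F_t cannot be
   proportional to the coefficients of a perfect square, which forces Cauchy vectors to be vertical.
   A type also asserts that the systems exist; this takes a smooth square root of the discriminant.
   Only types with equal classes are built: 6-7 is read off from the constant classes that are
   assumed. The coefficients of an affine locus must be smooth on J^1; they come from a smooth
   implicit function and its slope. *)
Require Import Defs.
From HB Require Import structures.
From mathcomp Require Import all_boot all_order all_algebra.
From mathcomp Require Import all_classical all_reals all_analysis.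
From mathcomp Require Import ring lra zify.
Import Order.TTheory GRing.Theory Num.Theory.
Import numFieldNormedType.Exports.
Local Open Scope classical_set_scope.
Local Open Scope ring_scope.
Set Implicit Arguments.
Unset Strict Implicit.
Unset Printing Implicit Defensive.

(** * Differential calculus on row vectors *)

Section Calculus.
Variables (R : realType).

Lemma coord_le_norm n (m : 'rV[R]_n) k : `|m 0 k| <= `|m|.
Proof.
by rewrite [leRHS]/Num.Def.normr /= mx_normrE (le_bigmax _ _ (0, k)).
Qed.

Lemma norm_lt_coord n (m : 'rV[R]_n) e :
  0 < e -> (forall k, `|m 0 k| < e) -> `|m| < e.
Proof.
move=> e0 H; rewrite [ltLHS]/Num.Def.normr /= mx_normrE.
by apply/bigmax_ltP; split => // -[i j] _ /=; rewrite (ord1 i).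
Qed.

Lemma norm_le_coord n (m : 'rV[R]_n) e :
  0 <= e -> (forall k, `|m 0 k| <= e) -> `|m| <= e.
Proof.
move=> e0 H; rewrite [leLHS]/Num.Def.normr /= mx_normrE.
by apply/bigmax_leP; split => // -[i j] _ /=; rewrite (ord1 i).
Qed.

Lemma differentiable_near_eq n (f g : 'rV[R]_n -> R) u :
  (\forall v \near u, f v = g v) -> differentiable f u -> differentiable g u.
Proof.
move=> fg df.
have [cdf /eqaddoP H] := (diff_locallyP _ _).1 df.
have fgu : f u = g u by apply: nbhs_singleton fg.
have K : g \o shift u = cst (g u) + 'd f u +o_ 0 id.
  apply/eqaddoP => e e0.
  have fg0 : \forall z \near (0 : 'rV[R]_n), f (z + u) = g (z + u).
    by have := fg; rewrite (near_shift (0 : 'rV[R]_n)) subr0; exact.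
  apply: filterS2 fg0 (H e e0).
  by move=> h /= fgh; rewrite !fctE /= -fgh -fgu.
have E : 'd g u = 'd f u :> (_ -> _) by exact: (diff_unique cdf K).
by apply/diff_locallyP; rewrite E.
Qed.

Lemma partial_near_eq n k (f g : 'rV[R]_n -> R) u :
  (\forall v \near u, f v = g v) -> partial k f u = partial k g u.
Proof. exact: near_eq_derive. Qed.

Lemma differentiable_eps n (f : 'rV[R]_n -> R) u : differentiable f u ->
  forall e, 0 < e -> exists2 d, 0 < d &
    forall h, `|h| < d -> `|f (h + u) - f u - 'd f u h| <= e * `|h|.
Proof.
move=> df e e0.
have [cdf /eqaddoP /(_ e e0)] := (diff_locallyP _ _).1 df.
move=> /nbhs_ballP [d /= d0 H]; exists d => // h hd.
have := H h; rewrite /= -ball_normE /= sub0r normrN => /(_ hd).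
by rewrite !fctE /= opprD addrA.
Qed.

Definition grad n (f : 'rV[R]_n -> R) u : 'rV[R]_n := \row_k partial k f u.

Definition rdot n (v w : 'rV[R]_n) : R := \sum_k v 0 k * w 0 k.

Lemma rdot_linear n (w : 'rV[R]_n) : linear (fun v => rdot v w).
Proof.
move=> a u v; rewrite /rdot scaler_sumr -big_split /=; apply: eq_bigr => k _.
by rewrite !mxE mulrDl -mulrA.
Qed.

Lemma diff_rdot n (f : 'rV[R]_n -> R) u v : differentiable f u ->
  'd f u v = rdot v (grad f u).
Proof.
move=> df; rewrite {1}(row_sum_delta v) linear_sum /rdot /=.
by apply: eq_bigr => k _; rewrite linearZ /= mxE /partial deriveE.
Qed.

Lemma derive_rdot n (f : 'rV[R]_n -> R) u v : differentiable f u ->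
  'D_v f u = rdot v (grad f u).
Proof. by move=> df; rewrite deriveE // diff_rdot. Qed.

Lemma rdot_norm n (v w : 'rV[R]_n) : `|rdot v w| <= `|v| * \sum_k `|w 0 k|.
Proof.
rewrite mulr_sumr; apply: le_trans (ler_norm_sum _ _ _) _.
by apply: ler_sum => k _; rewrite normrM ler_wpM2r // coord_le_norm.
Qed.

Lemma differentiable_from_linear (V W : normedModType R) (f : V -> W)
    (L : {linear V -> W}) u : continuous L ->
  (forall e, 0 < e -> exists2 d, 0 < d &
    forall h, `|h| < d -> `|f (h + u) - f u - L h| <= e * `|h|) ->
  differentiable f u /\ 'd f u = L :> (_ -> _).
Proof.
move=> cL H.
have K : f \o shift u = cst (f u) + L +o_ 0 id.
  apply/eqaddoP => e e0; have [d d0 Hd] := H e e0.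
  apply/nbhs_ballP; exists d => //= h; rewrite -ball_normE /= sub0r normrN => /Hd.
  by rewrite !fctE /= opprD addrA.
have E : 'd f u = L :> (_ -> _) by exact: (diff_unique cL K).
by split=> //; apply/diff_locallyP; rewrite E.
Qed.

Lemma rdot_delta n (w : 'rV[R]_n) k : rdot (delta_mx 0 k) w = w 0 k.
Proof.
rewrite /rdot (bigD1 k) //= big1 ?addr0; last first.
  by move=> j jk; rewrite !mxE (negPf jk) andbF mul0r.
by rewrite !mxE !eqxx mul1r.
Qed.

Lemma continuous_rdot n (w : 'rV[R]_n) : continuous (fun v => rdot v w).
Proof.
move=> v; apply: differentiable_continuous.
have -> : (fun v => rdot v w) = \sum_k (fun v : 'rV[R]_n => v 0 k * w 0 k).
  by apply/funext => z; rewrite fct_sumE.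
apply: differentiable_sum => k; apply: differentiableM => //.
exact: differentiable_coord.
Qed.

Lemma rdot_linearE n (w : 'rV[R]_n) :
  exists L : {linear 'rV[R]_n -> R}, forall v, L v = rdot v w.
Proof.
pose lM := GRing.isLinear.Build _ _ _ _ (fun v => rdot v w) (rdot_linear w).
pose L : {linear 'rV[R]_n -> R} := HB.pack (fun v => rdot v w) lM.
by exists L.
Qed.

(** Converse of [differentiable_eps]: a guessed covector that satisfies the first order estimate is
    the gradient. The implicit root, whose gradient is known in advance, is shown to be
    differentiable in this way. *)
Lemma differentiable_from_eps n (f : 'rV[R]_n -> R) u (w : 'rV[R]_n) :
  (forall e, 0 < e -> exists2 d, 0 < d &
    forall h, `|h| < d -> `|f (h + u) - f u - rdot h w| <= e * `|h|) ->
  differentiable f u /\ grad f u = w.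
Proof.
move=> H; have [L LE] := rdot_linearE w.
have cL : continuous L.
  by rewrite (_ : (L : _ -> _) = fun v => rdot v w) ?funeqE //;
    exact: continuous_rdot.
have [|df E] := @differentiable_from_linear _ R f L u cL.
  move=> e /H [d d0 Hd]; exists d => // h /Hd; by rewrite LE.
split=> //; apply/rowP => k; rewrite mxE /partial deriveE // E LE.
exact: rdot_delta.
Qed.

Lemma differentiable_rV p (V : normedModType R) (f : V -> 'rV[R]_p) u :
  (forall j, differentiable (fun v => f v 0 j : R) u) -> differentiable f u.
Proof.
move=> H.
have -> : f = \sum_j (fun v => f v 0 j *: (delta_mx 0 j : 'rV[R]_p)).
  apply/funext => v; rewrite fct_sumE {1}(row_sum_delta (f v)); exact: eq_bigr.
by apply: differentiable_sum => j; apply: differentiableZl.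
Qed.

Lemma derive_coord n p (f : 'rV[R]_n -> 'rV[R]_p) u v j :
  differentiable f u -> 'D_v f u 0 j = 'D_v (fun v => f v 0 j) u.
Proof.
move=> df; rewrite derive_mx; last exact: diff_derivable.
by rewrite mxE.
Qed.

Lemma derive_comp n p (G : 'rV[R]_p -> R) (f : 'rV[R]_n -> 'rV[R]_p) u v :
  differentiable f u -> differentiable G (f u) ->
  'D_v (G \o f) u = 'D_('D_v f u) G (f u).
Proof.
move=> df dG; have dGf := differentiable_comp df dG.
by rewrite (deriveE _ dGf) (deriveE _ df) (deriveE _ dG) diff_comp.
Qed.

Lemma partial_comp n p (G : 'rV[R]_p -> R) (f : 'rV[R]_n -> 'rV[R]_p) u k :
  (forall j, differentiable (fun v => f v 0 j : R) u) ->
  differentiable G (f u) ->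
  partial k (fun v => G (f v)) u =
    \sum_j partial k (fun v => f v 0 j) u * partial j G (f u).
Proof.
move=> /differentiable_rV df dG; rewrite /partial derive_comp // derive_rdot //.
by apply: eq_bigr => j _; rewrite mxE derive_coord.
Qed.

Lemma jacobianE n p (f : 'rV[R]_n -> 'rV[R]_p) u i j :
  (forall j, differentiable (fun v => f v 0 j : R) u) ->
  jacobian f u i j = partial i (fun v => f v 0 j) u.
Proof.
move=> /differentiable_rV df.
by rewrite /jacobian mxE -deriveE // derive_coord.
Qed.

Lemma partialD n (f g : 'rV[R]_n -> R) k u : differentiable f u ->
  differentiable g u ->
  partial k (fun v => f v + g v) u = partial k f u + partial k g u.
Proof. by move=> df dg; apply: deriveD; exact: diff_derivable. Qed.

Lemma partialB n (f g : 'rV[R]_n -> R) k u : differentiable f u ->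
  differentiable g u ->
  partial k (fun v => f v - g v) u = partial k f u - partial k g u.
Proof. by move=> df dg; apply: deriveB; exact: diff_derivable. Qed.

Lemma partialM n (f g : 'rV[R]_n -> R) k u : differentiable f u ->
  differentiable g u ->
  partial k (fun v => f v * g v) u =
  partial k f u * g u + f u * partial k g u.
Proof.
move=> df dg; rewrite /partial [LHS]deriveM; try exact: diff_derivable.
by rewrite addrC /GRing.scale /= mulrC.
Qed.

Lemma partial_cst n (c : R) k (u : 'rV[R]_n) : partial k (fun=> c) u = 0.
Proof. exact: derive_cst. Qed.

Lemma partial_coord n j k (u : 'rV[R]_n) :
  partial k (fun v => v 0 j) u = (j == k)%:R.
Proof.
rewrite /partial deriveE; last exact: differentiable_coord.
have @L : {linear 'rV[R]_n -> R}.
  by exists (fun N : 'rV[R]_n => N 0 j); do 2![eexists]; do ?[constructor];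
     rewrite ?mxE// => ? *; rewrite ?mxE//; move=> ?; rewrite !mxE.
rewrite (_ : (fun _ => _) = L) // diff_lin; last exact: coord_continuous.
by rewrite /= mxE eqxx.
Qed.

End Calculus.

(** * Smooth functions and their closure properties *)

Section Smooth.
Variables (R : realType).

Lemma smooth_on_differentiable n (U : set 'rV[R]_n) f u :
  smooth_on U f -> U u -> differentiable f u.
Proof. by move=> /(_ [::]); apply. Qed.

Lemma smooth_on_partial n (U : set 'rV[R]_n) f k :
  smooth_on U f -> smooth_on U (partial k f).
Proof. by move=> H s; have := H (rcons s k); rewrite foldr_rcons. Qed.

Lemma smooth_on_sub n (U V : set 'rV[R]_n) f :
  U `<=` V -> smooth_on V f -> smooth_on U f.
Proof. by move=> UV H s u /UV; exact: H. Qed.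

(** Coinduction: by induction on the list of indices, each iterated partial derivative agrees on [U]
    with a member of [P]. Agreement on [U] suffices because [U] is open, and no more can be asked,
    since formulas such as the derivative of an inverse hold only there. *)
Lemma smooth_coind n (U : set 'rV[R]_n) (P : ('rV[R]_n -> R) -> Prop) :
  open U ->
  (forall f, P f -> forall u, U u -> differentiable f u) ->
  (forall f k, P f ->
     exists2 g, P g & forall u, U u -> partial k f u = g u) ->
  forall f, P f -> smooth_on U f.
Proof.
move=> oU dP pP f Pf s.
suff [g Pg fg] : exists2 g, P g & forall u, U u -> foldr (@partial R n) f s u = g u.
  move=> u Uu; apply: (@differentiable_near_eq _ _ g); last exact: dP.
  by apply: filterS (open_nbhs_nbhs (conj oU Uu)) => v /fg.
elim: s => [|k s [g Pg fg]]; first by exists f.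
have [h Ph gh] := pP g k Pg; exists h => // u Uu /=; rewrite -gh //.
by apply: partial_near_eq; apply: filterS (open_nbhs_nbhs (conj oU Uu)) => v /fg.
Qed.

Lemma smooth_on_eq n (U : set 'rV[R]_n) f g : open U ->
  (forall u, U u -> f u = g u) -> smooth_on U f -> smooth_on U g.
Proof.
move=> oU fg sf.
apply: (@smooth_coind _ U (fun h => exists2 f, smooth_on U f &
   forall u, U u -> f u = h u)) => //; last by exists f.
- move=> h [e se eh] u Uu; apply: (@differentiable_near_eq _ _ e).
    by apply: filterS (open_nbhs_nbhs (conj oU Uu)) => v /eh.
  exact: smooth_on_differentiable Uu.
- move=> h k [e se eh]; exists (partial k e) => [|u Uu].
    by exists (partial k e) => //; exact: smooth_on_partial.
  apply: partial_near_eq.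
  by apply: filterS (open_nbhs_nbhs (conj oU Uu)) => v /eh.
Qed.

(** Polynomial expressions in the functions of [B]. The sum and product rules keep derivatives
    inside, so that only generators have to be differentiated. *)
Inductive alg n (B : ('rV[R]_n -> R) -> Prop) : ('rV[R]_n -> R) -> Prop :=
| AlgGen f of B f : alg B f
| AlgCst c : alg B (fun=> c)
| AlgAdd f g of alg B f & alg B g : alg B (fun u => f u + g u)
| AlgMul f g of alg B f & alg B g : alg B (fun u => f u * g u).

(** The derivative of a generator may be any polynomial in the generators, itself included. This
    fits inverses and square roots, whose derivatives are again expressed through themselves. *)
Lemma smooth_alg n (U : set 'rV[R]_n) B : open U ->
  (forall f, B f -> forall u, U u -> differentiable f u) ->
  (forall f k, B f ->
     exists2 g, alg B g & forall u, U u -> partial k f u = g u) ->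
  forall f, alg B f -> smooth_on U f.
Proof.
move=> oU dB pB.
have dP f : alg B f -> forall u, U u -> differentiable f u.
  elim=> {f} [f /dB //|c u _|f g _ df _ dg u Uu|f g _ df _ dg u Uu].
  - exact: differentiable_cst.
  - by apply: differentiableD; [exact: df|exact: dg].
  - by apply: differentiableM; [exact: df|exact: dg].
apply: smooth_coind => // f k.
elim=> {f} [f Bf|c|f g Af [f' Af' ff'] Ag [g' Ag' gg']|
            f g Af [f' Af' ff'] Ag [g' Ag' gg']].
- exact: pB.
- by exists (fun=> 0); [exact: AlgCst|move=> u _; exact: partial_cst].
- exists (fun u => f' u + g' u); first exact: AlgAdd.
  by move=> u Uu; rewrite partialD ?ff' ?gg' //; [exact: dP Uu..].
- exists (fun u => f' u * g u + f u * g' u).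
    by apply: AlgAdd; exact: AlgMul.
  by move=> u Uu; rewrite partialM ?ff' ?gg' //; [exact: dP Uu..].
Qed.

Lemma smooth_on_alg n (U : set 'rV[R]_n) f : open U ->
  alg (smooth_on U) f -> smooth_on U f.
Proof.
move=> oU; apply: smooth_alg => // {}f; first by move=> sf u; exact: smooth_on_differentiable.
by move=> k sf; exists (partial k f) => //; apply: AlgGen; exact: smooth_on_partial.
Qed.

Lemma smooth_on_cst n (U : set 'rV[R]_n) c : open U -> smooth_on U (fun=> c).
Proof. by move=> oU; apply: smooth_on_alg => //; exact: AlgCst. Qed.

Lemma smooth_onD n (U : set 'rV[R]_n) f g : open U ->
  smooth_on U f -> smooth_on U g -> smooth_on U (fun u => f u + g u).
Proof. by move=> oU sf sg; apply: smooth_on_alg => //; apply: AlgAdd; exact: AlgGen. Qed.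

Lemma smooth_onM n (U : set 'rV[R]_n) f g : open U ->
  smooth_on U f -> smooth_on U g -> smooth_on U (fun u => f u * g u).
Proof. by move=> oU sf sg; apply: smooth_on_alg => //; apply: AlgMul; exact: AlgGen. Qed.

Lemma smooth_onN n (U : set 'rV[R]_n) f : open U ->
  smooth_on U f -> smooth_on U (fun u => - f u).
Proof.
move=> oU sf; have := smooth_onM oU (smooth_on_cst (-1) oU) sf.
by apply: smooth_on_eq => // u _; rewrite mulN1r.
Qed.

Lemma smooth_onB n (U : set 'rV[R]_n) f g : open U ->
  smooth_on U f -> smooth_on U g -> smooth_on U (fun u => f u - g u).
Proof. by move=> oU sf sg; apply: smooth_onD => //; exact: smooth_onN. Qed.

Lemma smooth_on_coord n (U : set 'rV[R]_n) j : open U ->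
  smooth_on U (fun u => u 0 j).
Proof.
move=> oU; apply: (@smooth_alg _ _ (fun f => f = fun u => u 0 j)) => //.
- by move=> f -> u _; exact: differentiable_coord.
- move=> f k ->; exists (fun=> (j == k)%:R); first exact: AlgCst.
  by move=> u _; exact: partial_coord.
- exact: AlgGen.
Qed.

Lemma smooth_on_comp n p (U : set 'rV[R]_n) (D : set 'rV[R]_p) G
    (f : 'rV[R]_n -> 'rV[R]_p) : open U ->
  (forall j, smooth_on U (fun u => f u 0 j)) -> (forall u, U u -> D (f u)) ->
  smooth_on D G -> smooth_on U (fun u => G (f u)).
Proof.
move=> oU sf fD sG.
(* The chain rule yields products of derivatives of the coordinates of [f] with [partial j G]
   composed with [f], hence two kinds of generators, the second for every smooth [G]. *)
pose B h := (smooth_on U h) \/ (exists2 G, smooth_on D G & h = fun u => G (f u)).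
have df j u : U u -> differentiable (fun u => f u 0 j) u.
  by move=> Uu; exact: smooth_on_differentiable Uu.
apply: (@smooth_alg _ _ B) => //.
- move=> h [sh|[H sH ->]] u Uu; first exact: smooth_on_differentiable Uu.
  apply: differentiable_comp; first by apply: differentiable_rV => j; exact: df.
  by apply: smooth_on_differentiable sH _; exact: fD.
- move=> h k [sh|[H sH ->]].
    by exists (partial k h) => //; apply: AlgGen; left; exact: smooth_on_partial.
  exists (fun u => \sum_j partial k (fun v => f v 0 j) u * partial j H (f u)).
    rewrite (_ : (fun u => _) =
        \sum_j (fun u => partial k (fun v => f v 0 j) u * partial j H (f u))).
      elim/big_ind : _ => [|g1 g2 ? ?|j _]; first exact: AlgCst.
        exact: AlgAdd.
      apply: AlgMul; apply: AlgGen; first by left; exact: smooth_on_partial.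
      by right; exists (partial j H) => //; exact: smooth_on_partial.
    by apply/funext => u; rewrite fct_sumE.
  move=> u Uu; apply: partial_comp => [j|]; first exact: df.
  by apply: smooth_on_differentiable sH _; exact: fD.
- by apply: AlgGen; right; exists G.
Qed.

Lemma partialV n (f : 'rV[R]_n -> R) k u : differentiable f u -> f u != 0 ->
  partial k (fun v => (f v)^-1) u = - (f u)^-1 * (f u)^-1 * partial k f u.
Proof.
move=> df f0; rewrite /partial [LHS](@deriveV _ _ f) //; last exact: diff_derivable.
by rewrite expr2 invfM !mulNr [_ *: _]mulNr.
Qed.

Lemma smooth_onV n (U : set 'rV[R]_n) f : open U -> smooth_on U f ->
  (forall u, U u -> f u != 0) -> smooth_on U (fun u => (f u)^-1).
Proof.
move=> oU sf f0.
apply: (@smooth_alg _ _ (fun h => smooth_on U h \/ h = fun u => (f u)^-1)) => //.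
- move=> h [sh|->] u Uu; first exact: smooth_on_differentiable Uu.
  by apply: differentiableV; [exact: smooth_on_differentiable Uu|exact: f0].
- move=> h k [sh|->].
    by exists (partial k h) => //; apply: AlgGen; left; exact: smooth_on_partial.
  exists (fun u => (-1 * (f u)^-1) * (f u)^-1 * partial k f u).
    by repeat apply: AlgMul; try exact: AlgCst; apply: AlgGen;
       [right|right|left; exact: smooth_on_partial].
  move=> u Uu; rewrite partialV ?mulN1r //; last exact: f0.
  exact: smooth_on_differentiable Uu.
- by apply: AlgGen; right.
Qed.

Lemma smooth_on_sqrt n (U : set 'rV[R]_n) f : open U -> smooth_on U f ->
  (forall u, U u -> 0 < f u) -> smooth_on U (fun u => Num.sqrt (f u)).
Proof.
move=> oU sf f0.
have sV : smooth_on U (fun u => (2 * f u)^-1).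
  apply: smooth_onV => //; first by apply: smooth_onM => //; exact: smooth_on_cst.
  by move=> u /f0 fu; rewrite mulf_neq0 ?pnatr_eq0 // gt_eqF.
have dsqrt u : U u -> differentiable Num.sqrt (f u).
  move=> Uu; apply/derivable1_diffP.
  by have [] := is_derive1_sqrt (f0 u Uu).
apply: (@smooth_alg _ _ (fun h => smooth_on U h \/ h = fun u => Num.sqrt (f u))) => //.
- move=> h [sh|->] u Uu; first exact: smooth_on_differentiable Uu.
  apply: differentiable_comp; first exact: smooth_on_differentiable Uu.
  exact: dsqrt.
- move=> h k [sh|->].
    by exists (partial k h) => //; apply: AlgGen; left; exact: smooth_on_partial.
  (* The derivative of the root is written as f' / (2 f) times the root: the inverse of the root is
     not a generator, whereas that of 2 f is smooth. *)
  exists (fun u => (partial k f u * (2 * f u)^-1) * Num.sqrt (f u)).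
    apply: AlgMul; apply: AlgGen; last by right.
    by left; apply: smooth_onM => //; exact: smooth_on_partial.
  move=> u Uu; have fu := f0 u Uu.
  have df : differentiable f u by exact: smooth_on_differentiable Uu.
  have ds := dsqrt u Uu.
  have dc := differentiable_comp df ds.
  rewrite /partial (deriveE _ dc) diff_comp //= -(deriveE _ df).
  set y := 'D__ f u.
  rewrite -[y]mulr1 -[y * 1]/(y *: (1 : R)) linearZ /= -(deriveE _ ds).
  rewrite derive_sqrt // /GRing.scale /= mulr1 -mulrA; congr (_ * _).
  have : Num.sqrt (f u) != 0 by rewrite gt_eqF // sqrtr_gt0.
  have : Num.sqrt (f u) ^+ 2 = f u by rewrite sqr_sqrtr // ltW.
  by move: (Num.sqrt (f u)) => s <- s0; field.
- by apply: AlgGen; right.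
Qed.

End Smooth.

(** * Symmetry of second partial derivatives *)

Section Schwarz.
Variables (R : realType).

Lemma is_derive_line n (f : 'rV[R]_n -> R) (v e : 'rV[R]_n) (s : R) :
  differentiable f (s *: e + v) ->
  is_derive s 1 (fun t : R => f (t *: e + v)) ('D_e f (s *: e + v)).
Proof.
move=> df.
have E h : ((h *: (1 : R) + s) *: e + v) = h *: e + (s *: e + v).
  by rewrite scalerDl addrA /GRing.scale /= mulr1.
apply: DeriveDef.
- have := @diff_derivable _ _ _ f _ e df; rewrite /derivable.
  by under eq_fun do rewrite /= -E.
- by rewrite /derive; under eq_fun do rewrite /= E.
Qed.

Lemma norm_delta n (k : 'I_n) : `|delta_mx 0 k : 'rV[R]_n| <= 1.
Proof.
apply: norm_le_coord => // j; rewrite mxE eqxx /=.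
by case: eqP => _; rewrite ?normr1 ?normr0.
Qed.

Lemma line_mvt n (f : 'rV[R]_n -> R) (v e : 'rV[R]_n) (a b : R) : a < b ->
  (forall s, a <= s <= b -> differentiable f (s *: e + v)) ->
  exists2 c, a < c < b &
    f (b *: e + v) - f (a *: e + v) = 'D_e f (c *: e + v) * (b - a).
Proof.
move=> ab df.
have [] := @MVT R (fun t => f (t *: e + v)) (fun s => 'D_e f (s *: e + v)) a b ab.
- move=> s; rewrite in_itv /= => /andP[s1 s2]; apply: is_derive_line.
  by apply: df; rewrite !ltW.
- apply: derivable_within_continuous => s; rewrite in_itv /= => s1.
  by have [] := is_derive_line (df s s1).
- by move=> c; rewrite in_itv /= => cab E; exists c.
Qed.

(** The mean value theorem is applied once, in direction [i], to the difference of [f] along two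
    parallel segments. The resulting increment of [partial i f] is then estimated by its
    differentiability at [u] alone. *)
Lemma second_difference n (f : 'rV[R]_n -> R) u i j :
  (\forall v \near u, differentiable f v) -> differentiable (partial i f) u ->
  forall e, 0 < e -> exists2 d, 0 < d & forall h, 0 < h < d ->
   `|f (h *: delta_mx 0 i + (h *: delta_mx 0 j + u)) - f (h *: delta_mx 0 i + u)
     - (f (h *: delta_mx 0 j + u) - f u) - h ^+ 2 * partial j (partial i f) u|
     <= e * h ^+ 2.
Proof.
move=> /nbhs_ballP [r /= r0 Hr] dif e e0.
have [d d0 Hd] := differentiable_eps dif (divr_gt0 e0 (ltr0Sn R 2)).
exists (Num.min (d / 2) (r / 2)); first by rewrite lt_min !divr_gt0.
move=> h /andP[h0]; rewrite lt_min => /andP[hd hr].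
set ei := delta_mx 0 i; set ej := delta_mx 0 j.
have nei (c : R) : 0 <= c -> `|c *: ei| <= c.
  by move=> c0; rewrite normrZ ger0_norm // ler_piMr // norm_delta.
have nej : `|h *: ej| <= h.
  by rewrite normrZ gtr0_norm // ler_piMr ?norm_delta // ltW.
have inr k : `|k| <= 2 * h -> differentiable f (k + u).
  move=> kh; apply: Hr; rewrite -ball_normE /= opprD addrC subrK normrN.
  by apply: le_lt_trans kh _; lra.
pose g (s : R) := f (s *: ei + (h *: ej + u)) - f (s *: ei + u).
have dg s : 0 <= s <= h -> is_derive s 1 g
   (partial i f (s *: ei + (h *: ej + u)) - partial i f (s *: ei + u)).
  move=> /andP[s0 sh]; apply: is_deriveB; apply: is_derive_line.
    rewrite addrA; apply: inr; apply: le_trans (ler_normD _ _) _.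
    by have := nei s s0; lra.
  by apply: inr; have := nei s s0; lra.
have [] := @MVT R g (fun s => partial i f (s *: ei + (h *: ej + u)) - partial i f (s *: ei + u)) 0 h h0.
- by move=> s; rewrite in_itv /= => /andP[s1 s2]; apply: dg; rewrite !ltW.
- apply: derivable_within_continuous => s; rewrite in_itv /= => s1.
  by have [] := dg s s1.
move=> c; rewrite in_itv /= => /andP[c0 ch] E.
have -> : f (h *: ei + (h *: ej + u)) - f (h *: ei + u) -
     (f (h *: ej + u) - f u) = g h - g 0 by rewrite /g !scale0r !add0r.
rewrite E subr0.
have cn := nei c (ltW c0).
have k1n : `|c *: ei + h *: ej| <= 2 * h by apply: le_trans (ler_normD _ _) _; lra.
have H1 := Hd (c *: ei + h *: ej).
have H2 := Hd (c *: ei).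
have {}H1 := H1 (le_lt_trans k1n _).
have {}H2 := H2 (le_lt_trans cn _).
have {}H1 := H1 ltac:(lra).
have {}H2 := H2 ltac:(lra).
rewrite linearD /= in H1.
have DE : 'd (partial i f) u (h *: ej) = h * partial j (partial i f) u.
  by rewrite linearZ /= [partial j _ _]deriveE.
rewrite DE in H1.
move: H1 H2; rewrite -[_ + h *: ej + u]addrA.
set X := partial i f (c *: ei + (h *: ej + u)).
set Y := partial i f (c *: ei + u).
set Z := partial i f u.
set P := 'd _ _ _; set Q := partial j _ _.
move=> H1 H2.
have H3 : `|X - Y - h * Q| <= e * h.
  have -> : X - Y - h * Q = (X - Z - (P + h * Q)) - (Y - Z - P) by ring.
  apply: le_trans (ler_normB _ _) _.
  apply: le_trans (lerD H1 H2) _.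
  have : e / 3 * `|c *: ei + h *: ej| <= e / 3 * (2 * h).
    by apply: ler_wpM2l => //; apply: divr_ge0 => //; exact: ltW.
  have : e / 3 * `|c *: ei| <= e / 3 * h.
    by apply: ler_wpM2l; [apply: divr_ge0 => //; exact: ltW|lra].
  by lra.
have -> : (X - Y) * h - h ^+ 2 * Q = h * (X - Y - h * Q) by ring.
rewrite normrM gtr0_norm //.
have -> : e * h ^+ 2 = h * (e * h) by ring.
by apply: ler_wpM2l => //; exact: ltW.
Qed.

(** The second difference is symmetric in [i] and [j], so after division by [h ^+ 2] both mixed
    derivatives are its limit. *)
Lemma schwarz n (U : set 'rV[R]_n) f u i j : open U -> smooth_on U f -> U u ->
  partial i (partial j f) u = partial j (partial i f) u.
Proof.
move=> oU sf Uu.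
have ndf : \forall v \near u, differentiable f v.
  by apply: filterS (open_nbhs_nbhs (conj oU Uu)) => v; exact: smooth_on_differentiable.
have dp k : differentiable (partial k f) u.
  by apply: smooth_on_differentiable Uu; exact: smooth_on_partial.
apply/eqP; rewrite -subr_eq0 -normr_le0; apply/ler_addgt0Pl => e e0; rewrite addr0 ltW //.
have e3 : 0 < e / 3 by rewrite divr_gt0.
have [d1 d10 H1] := @second_difference _ f u i j ndf (dp i) _ e3.
have [d2 d20 H2] := @second_difference _ f u j i ndf (dp j) _ e3.
pose h := Num.min (d1 / 2) (d2 / 2).
have h0 : 0 < h by rewrite lt_min !divr_gt0.
have h1 : h < d1.
  have : h <= d1 / 2 by rewrite ge_min lexx.
  lra.
have h2 : h < d2.
  have : h <= d2 / 2 by rewrite ge_min lexx orbT.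
  lra.
have := H1 h; have := H2 h; rewrite h0 h1 h2 => /(_ isT) K2 /(_ isT) K1.
move: K1 K2.
set A := partial j (partial i f) u; set B := partial i (partial j f) u.
rewrite [h *: delta_mx 0 j + (h *: delta_mx 0 i + u)]addrCA.
set X := f (_ + (_ + _)); set Y := f (_ *: delta_mx 0 i + u).
set Z := f (_ *: delta_mx 0 j + u); set W := f u => K1 K2.
have hh : 0 < h ^+ 2 by rewrite exprn_gt0.
rewrite -(ltr_pM2l hh).
have -> : h ^+ 2 * `|B - A| = `|h ^+ 2 * (B - A)|.
  by rewrite normrM (gtr0_norm hh).
have -> : h ^+ 2 * (B - A) = (X - Y - (Z - W) - h ^+ 2 * A) - (X - Z - (Y - W) - h ^+ 2 * B) by ring.
apply: le_lt_trans (ler_normB _ _) _.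
apply: le_lt_trans (lerD K1 K2) _.
have := mulr_gt0 e0 hh; rewrite [h ^+ 2 * e]mulrC.
have -> : e / 3 * h ^+ 2 + e / 3 * h ^+ 2 = 2 / 3 * (e * h ^+ 2) by field.
by move: (e * h ^+ 2) => y y0; rewrite mulrC; clear - y y0; lra.
Qed.

End Schwarz.

(** * The scalar implicit function theorem *)

Section ImplicitFunction.
Variables (R : realType).

Definition upd n (m : 'rV[R]_n) (c : 'I_n) (t : R) : 'rV[R]_n :=
  \row_k (if k == c then t else m 0 k).

Lemma updE n (m : 'rV[R]_n) c t : upd m c t = t *: delta_mx 0 c + upd m c 0.
Proof.
apply/rowP => k; rewrite !mxE eqxx /=.
by case: eqP => _; rewrite ?mulr1 ?mulr0 ?addr0 ?add0r.
Qed.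

Lemma upd_same n (m : 'rV[R]_n) c t : upd m c t 0 c = t.
Proof. by rewrite mxE eqxx. Qed.

Lemma upd_other n (m : 'rV[R]_n) c t k : k != c -> upd m c t 0 k = m 0 k.
Proof. by rewrite mxE => /negPf ->. Qed.

Lemma upd_id n (m : 'rV[R]_n) c : upd m c (m 0 c) = m.
Proof. by apply/rowP => k; rewrite mxE; case: eqP => [->|]. Qed.

Lemma updK n (m : 'rV[R]_n) c s t : upd (upd m c s) c t = upd m c t.
Proof. by apply/rowP => k; rewrite !mxE; case: eqP. Qed.

Lemma differentiable_upd_coord n (rho : 'rV[R]_n -> R) c m j :
  differentiable rho m -> differentiable (fun v => upd v c (rho v) 0 j) m.
Proof.
move=> dr; have [->|jc] := eqVneq j c; first by under eq_fun do rewrite upd_same.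
by under eq_fun do rewrite upd_other //; exact: differentiable_coord.
Qed.

Lemma differentiable_upd n (rho : 'rV[R]_n -> R) c m : differentiable rho m ->
  differentiable (fun v => upd v c (rho v)) m.
Proof.
by move=> dr; apply: differentiable_rV => j; exact: differentiable_upd_coord.
Qed.

Lemma partial_comp_upd n (G rho : 'rV[R]_n -> R) c k m :
  differentiable rho m -> differentiable G (upd m c (rho m)) ->
  partial k (fun v => G (upd v c (rho v))) m =
  (if k == c then 0 else partial k G (upd m c (rho m)))
  + partial k rho m * partial c G (upd m c (rho m)).
Proof.
move=> dr dG; rewrite partial_comp //; last first.
  by move=> j; exact: differentiable_upd_coord.
rewrite (bigD1 c) //= addrC; congr (_ + _); last first.
  by under eq_fun do rewrite upd_same.
have other j : j != c -> partial k (fun v => upd v c (rho v) 0 j) m = (j == k)%:R.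
  by move=> jc; under eq_fun do rewrite upd_other //; exact: partial_coord.
have [kc|kc] := eqVneq k c.
  by rewrite big1 // => j jc; rewrite other // kc (negPf jc) mul0r.
rewrite (bigD1 k) //= other // eqxx mul1r.
by rewrite big1 ?addr0 // => j /andP[jc jk]; rewrite other // (negPf jk) mul0r.
Qed.

(** Each coordinate has its own radius: in the implicit function theorem the solved coordinate and
    the free ones obey different bounds. *)
Definition box n (m0 : 'rV[R]_n) (r : 'I_n -> R) : set 'rV[R]_n :=
  [set m | forall k, `|m 0 k - m0 0 k| < r k].

Lemma nbhs_box n (m0 m : 'rV[R]_n) r : box m0 r m -> nbhs m (box m0 r).
Proof.
move=> mb; rewrite /box.
have FF : Filter (nbhs m) by exact: nbhs_filter.
apply: (@filter_forall _ _ (fun k (v : 'rV[R]_n) => `|v 0 k - m0 0 k| < r k) _ FF).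
move=> k.
have cv : (fun v : 'rV[R]_n => `|v 0 k - m0 0 k|) @ m --> `|m 0 k - m0 0 k|.
  by apply: cvg_norm; apply: cvgB; [exact: coord_continuous|exact: cvg_cst].
exact: cvgr_lt cv _ (mb k).
Qed.

Lemma open_box n (m0 : 'rV[R]_n) r : open (box m0 r).
Proof. by rewrite openE => m; exact: nbhs_box. Qed.

Lemma nbhs_coord n (m0 : 'rV[R]_n) (P : set 'rV[R]_n) : nbhs m0 P ->
  exists2 d, 0 < d & forall m : 'rV[R]_n, (forall k, `|m 0 k - m0 0 k| < d) -> P m.
Proof.
move=> /nbhs_ballP [d /= d0 H]; exists d => // m md; apply: H.
by rewrite -ball_normE /=; apply: norm_lt_coord => // k; rewrite !mxE distrC.
Qed.

Section Positive.
Variables (n : nat) (c : 'I_n) (F : 'rV[R]_n -> R) (D : set 'rV[R]_n).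
Variables (m0 : 'rV[R]_n).
Hypothesis oD : open D.
Hypothesis sF : smooth_on D F.
Hypothesis Dm0 : D m0.
Hypothesis Fm0 : F m0 = 0.
Hypothesis Fc0 : 0 < partial c F m0.

Let Fdiff m : D m -> differentiable F m.
Proof. exact: smooth_on_differentiable. Qed.

Lemma implicit_cube : exists2 d, 0 < d &
  forall m : 'rV[R]_n, (forall k, `|m 0 k - m0 0 k| < d) -> D m /\ 0 < partial c F m.
Proof.
have cF : {for m0, continuous (partial c F)}.
  apply: differentiable_continuous; apply: smooth_on_differentiable Dm0.
  exact: smooth_on_partial.
have n1 : \forall m \near m0, 0 < partial c F m by exact: cvgr_gt cF _ Fc0.
have n2 : \forall m \near m0, D m by exact: open_nbhs_nbhs.
have [d d0 H] := nbhs_coord (filterI n2 n1).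
by exists d => // m /H.
Qed.

Variables (d : R).
Hypothesis d0 : 0 < d.
Hypothesis Hd : forall m : 'rV[R]_n, (forall k, `|m 0 k - m0 0 k| < d) ->
  D m /\ 0 < partial c F m.

Let cube : set 'rV[R]_n := box m0 (fun=> d).

Let upd_cube (m : 'rV[R]_n) t : (forall k, k != c -> `|m 0 k - m0 0 k| < d) ->
  `|t - m0 0 c| < d -> cube (upd m c t).
Proof. by move=> H1 H2 k; rewrite mxE; case: eqP => [->|/eqP] //; exact: H1. Qed.

Lemma implicit_mono (m : 'rV[R]_n) s t : (forall k, k != c -> `|m 0 k - m0 0 k| < d) ->
  `|s - m0 0 c| < d -> `|t - m0 0 c| < d -> s < t ->
  F (upd m c s) < F (upd m c t).
Proof.
move=> md sd td st; rewrite -subr_gt0 !(updE _ _ s) (updE _ _ t).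
have inc x : s <= x <= t -> cube (x *: delta_mx 0 c + upd m c 0).
  move=> /andP[sx xt]; rewrite -updE; apply: upd_cube => //.
  move: sd td; rewrite !ltr_norml => /andP[? ?] /andP[? ?].
  by apply/andP; split; lra.
have [x /inc /Hd [Dx Fx]|x xst ->] := @line_mvt R n F (upd m c 0) (delta_mx 0 c) s t st.
  exact: Fdiff.
rewrite mulr_gt0 ?subr_gt0 //.
by have /andP[x1 x2] := xst; have [|_] := Hd (inc x _) => //; rewrite !ltW.
Qed.

Lemma implicit_mono_inv (m : 'rV[R]_n) s t : (forall k, k != c -> `|m 0 k - m0 0 k| < d) ->
  `|s - m0 0 c| < d -> `|t - m0 0 c| < d ->
  F (upd m c s) < F (upd m c t) -> s < t.
Proof.
move=> md sd td; rewrite !ltNge; apply: contra; rewrite le_eqVlt.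
by move=> /orP[/eqP ->//|ts]; rewrite ltW // implicit_mono.
Qed.

Lemma continuous_upd (t : R) : continuous (fun m : 'rV[R]_n => upd m c t).
Proof.
move=> m; apply: differentiable_continuous.
by apply: (@differentiable_upd _ (fun=> t)); exact: differentiable_cst.
Qed.

(** Monotonicity along [c] gives the two signs over [m0], and continuity spreads them to nearby
    points. *)
Lemma implicit_strip : exists2 e, 0 < e <= d &
  forall m : 'rV[R]_n, (forall k, k != c -> `|m 0 k - m0 0 k| < e) ->
    F (upd m c (m0 0 c - d / 2)) < 0 < F (upd m c (m0 0 c + d / 2)).
Proof.
have d2 : 0 < d / 2 by rewrite divr_gt0.
have dd : d / 2 < d by lra.
have a1 : `|m0 0 c - d / 2 - m0 0 c| < d by rewrite addrAC subrr sub0r normrN gtr0_norm.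
have a2 : `|m0 0 c + d / 2 - m0 0 c| < d by rewrite addrAC subrr add0r gtr0_norm.
have a3 : `|m0 0 c - m0 0 c| < d by rewrite subrr normr0.
have z k : k != c -> `|m0 0 k - m0 0 k| < d by rewrite subrr normr0.
have F1 : F (upd m0 c (m0 0 c - d / 2)) < 0.
  by rewrite -Fm0 -[in ltRHS](upd_id m0 c) implicit_mono //; lra.
have F2 : 0 < F (upd m0 c (m0 0 c + d / 2)).
  by rewrite -Fm0 -[in ltLHS](upd_id m0 c) implicit_mono //; lra.
have cont t : `|t - m0 0 c| < d -> {for m0, continuous (fun m => F (upd m c t))}.
  move=> td; apply: continuous_comp; first exact: continuous_upd.
  apply: differentiable_continuous; apply: Fdiff.
  by have [] := Hd (upd_cube z td).
have n1 : \forall m \near m0, F (upd m c (m0 0 c - d / 2)) < 0.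
  exact: cvgr_lt (cont _ a1) _ F1.
have n2 : \forall m \near m0, 0 < F (upd m c (m0 0 c + d / 2)).
  exact: cvgr_gt (cont _ a2) _ F2.
have [e e0 H] := nbhs_coord (filterI n1 n2).
exists (Num.min e d); first by rewrite lt_min e0 d0 ge_min lexx orbT.
move=> m md.
(* The neighbourhood of [m0] is reached by resetting the coordinate [c] of [m], which the two values
   of [F] ignore. *)
have [] : (fun m => F (upd m c (m0 0 c - d / 2)) < 0 /\
  0 < F (upd m c (m0 0 c + d / 2))) (upd m c (m0 0 c)).
  apply: H => k; rewrite mxE; case: eqP => [->|/eqP kc].
    by rewrite subrr normr0.
  by have := md k kc; rewrite lt_min => /andP[].
by rewrite !updK => -> ->.
Qed.

Variables (e : R).
Hypothesis e0 : 0 < e <= d.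
Hypothesis He : forall m : 'rV[R]_n, (forall k, k != c -> `|m 0 k - m0 0 k| < e) ->
    F (upd m c (m0 0 c - d / 2)) < 0 < F (upd m c (m0 0 c + d / 2)).

Let strip (m : 'rV[R]_n) := forall k, k != c -> `|m 0 k - m0 0 k| < e.

Let strip_d m : strip m -> forall k, k != c -> `|m 0 k - m0 0 k| < d.
Proof.
by move=> H k /H /lt_le_trans; apply; have /andP[] := e0.
Qed.

Lemma implicit_exists m : strip m ->
  exists2 t, `|t - m0 0 c| < d / 2 & F (upd m c t) = 0.
Proof.
move=> ms; have /andP[F1 F2] := He ms.
have d2 : 0 < d / 2 by rewrite divr_gt0.
set a := m0 0 c - d / 2 in F1; set b := m0 0 c + d / 2 in F2.
have ab : a <= b by rewrite /a /b; lra.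
have cF : {within `[a, b], continuous (fun t => F (upd m c t))}.
  apply: derivable_within_continuous => s; rewrite in_itv /= => /andP[as_ sb].
  have Fs : differentiable F (s *: delta_mx 0 c + upd m c 0).
    rewrite -updE; have [|//] := Hd (@upd_cube m s (strip_d ms) _).
      by rewrite ltr_norml; apply/andP; move: as_ sb; rewrite /a /b => ? ?; split; lra.
    by move=> Du _; exact: Fdiff.
  have [] := is_derive_line Fs.
  by under eq_fun do rewrite -updE.
have [|t] := IVT (v := 0) ab cF.
  by rewrite ge_min (ltW F1) /= le_max (ltW F2) orbT.
rewrite in_itv /= => /andP[]; rewrite !le_eqVlt.
move=> /orP[/eqP <- _ E|at_ /orP[/eqP -> E|tb E]].
- by rewrite E ltxx in F1.
- by rewrite E ltxx in F2.
- exists t => //; rewrite ltr_norml; apply/andP; move: at_ tb; rewrite /a /b => ? ?.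
  by split; lra.
Qed.

(** The default 0 is taken only where no root exists, which does not happen over the strip. *)
Definition implicit_root (m : 'rV[R]_n) : R :=
  xget 0 [set t | `|t - m0 0 c| < d / 2 /\ F (upd m c t) = 0].

Lemma implicit_rootP m : strip m ->
  `|implicit_root m - m0 0 c| < d / 2 /\ F (upd m c (implicit_root m)) = 0.
Proof.
move=> /implicit_exists [t td tF]; rewrite /implicit_root.
by case: xgetP => [y -> //|/(_ t)]; case.
Qed.

Lemma implicit_root_upd m t : implicit_root (upd m c t) = implicit_root m.
Proof.
by rewrite /implicit_root; congr xget; apply/seteqP; split => x /=; rewrite updK.
Qed.

Let halfd t : `|t - m0 0 c| < d / 2 -> `|t - m0 0 c| < d.
Proof. by move=> /lt_trans; apply; have := d0; lra. Qed.

Lemma implicit_root_unique m t : strip m -> `|t - m0 0 c| < d / 2 ->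
  F (upd m c t) = 0 -> t = implicit_root m.
Proof.
move=> ms td tF; have [rd rF] := implicit_rootP ms.
have sd := strip_d ms.
have td' := halfd td; have rd' := halfd rd.
have [lt|lt|//] := ltgtP t (implicit_root m).
- by have := implicit_mono sd td' rd' lt; rewrite tF rF ltxx.
- by have := implicit_mono sd rd' td' lt; rewrite tF rF ltxx.
Qed.

Let stripbox := box m0 (fun k => if k == c then d / 2 else e).

Let stripbox_strip m : stripbox m -> strip m.
Proof. by move=> H k kc; have := H k; rewrite (negPf kc). Qed.

Let phi m := upd m c (implicit_root m).

(** The signs of [F] just below and just above the root persist near [m], and monotonicity traps the
    root of a nearby point between these two levels. *)
Lemma implicit_root_cont m : stripbox m ->
  forall eps, 0 < eps -> \forall v \near m, `|implicit_root v - implicit_root m| < eps.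
Proof.
move=> ms eps eps0; have [rd rF] := implicit_rootP (stripbox_strip ms).
set r := implicit_root m in rd rF *.
pose x := Num.min (eps / 2) (d / 2).
have x0 : 0 < x by rewrite lt_min !divr_gt0.
have xe : x < eps.
  have : x <= eps / 2 by rewrite ge_min lexx.
  lra.
have xd : x <= d / 2 by rewrite ge_min lexx orbT.
have r1 : `|r - x - m0 0 c| < d.
  move: rd; rewrite !ltr_norml => /andP[? ?]; apply/andP; split; lra.
have r2 : `|r + x - m0 0 c| < d.
  move: rd; rewrite !ltr_norml => /andP[? ?]; apply/andP; split; lra.
have sd := strip_d (stripbox_strip ms).
have F1 : F (upd m c (r - x)) < 0.
  by rewrite -rF; apply: implicit_mono => //; [exact: halfd|lra].
have F2 : 0 < F (upd m c (r + x)).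
  by rewrite -rF; apply: implicit_mono => //; [exact: halfd|lra].
have cont t : `|t - m0 0 c| < d -> {for m, continuous (fun m => F (upd m c t))}.
  move=> td; apply: continuous_comp; first exact: continuous_upd.
  apply: differentiable_continuous; apply: Fdiff.
  by have [] := Hd (upd_cube sd td).
have n1 : \forall v \near m, F (upd v c (r - x)) < 0.
  exact: cvgr_lt (cont _ r1) _ F1.
have n2 : \forall v \near m, 0 < F (upd v c (r + x)).
  exact: cvgr_gt (cont _ r2) _ F2.
have n3 : \forall v \near m, stripbox v.
  by apply: open_nbhs_nbhs; split=> //; exact: open_box.
near=> v.
have vs : stripbox v by near: v.
have [vd vF] := implicit_rootP (stripbox_strip vs).
have vsd := strip_d (stripbox_strip vs).
have lo : r - x < implicit_root v.
  apply: (implicit_mono_inv vsd r1 (halfd vd)); rewrite vF; near: v; exact: n1.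
have hi : implicit_root v < r + x.
  apply: (implicit_mono_inv vsd (halfd vd) r2); rewrite vF; near: v; exact: n2.
rewrite ltr_norml; apply/andP; split; lra.
Unshelve. all: by end_near.
Qed.

Definition implicit_grad (m : 'rV[R]_n) : 'rV[R]_n :=
  \row_k (if k == c then 0 else - partial k F (upd m c (implicit_root m)) /
                                  partial c F (upd m c (implicit_root m))).

Lemma implicit_root_diff m : stripbox m ->
  differentiable implicit_root m /\ grad implicit_root m = implicit_grad m.
Proof.
move=> ms; apply: differentiable_from_eps => eps eps0.
have sd := strip_d (stripbox_strip ms).
have [rd rF] := implicit_rootP (stripbox_strip ms).
set r := implicit_root m in rd rF *.
set p := upd m c r in rF.
have [Dp Ap] := Hd (upd_cube sd (halfd rd)); rewrite -/p in Dp Ap.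
set A := partial c F p in Ap.
set w := implicit_grad m.
pose K := \sum_k `|w 0 k|.
have K0 : 0 <= K by apply: sumr_ge0.
(* With X = |Del - rdot h w|, the expansion of [F] will give X <= q (|h| + X + K |h|). The bound 1 /
   2 lets X be absorbed on the left, and the other bound makes the remaining 2 q (1 + K) |h| at most
   eps |h|. *)
pose q := Num.min (1 / 2) (eps / (2 * (1 + K))).
have q0 : 0 < q.
  rewrite lt_min divr_gt0 //= divr_gt0 // mulr_gt0 // ltr_wpDr //.
have q1 : q <= 1 / 2 by rewrite ge_min lexx.
have q2 : 2 * q * (1 + K) <= eps.
  have : q <= eps / (2 * (1 + K)) by rewrite ge_min lexx orbT.
  rewrite ler_pdivlMr; first by apply: le_trans; lra.
  by rewrite mulr_gt0 // ltr_wpDr.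
have qA : 0 < q * A by rewrite mulr_gt0.
have [d1 d10 H1] := differentiable_eps (Fdiff Dp) qA.
have n1 := implicit_root_cont ms d10.
have n2 : \forall v \near m, stripbox v.
  by apply: open_nbhs_nbhs; split=> //; exact: open_box.
have [d2 d20 H2] := nbhs_coord (filterI n1 n2).
exists (Num.min d1 d2); first by rewrite lt_min d10.
move=> h; rewrite lt_min => /andP[hd1 hd2].
have [] := H2 (h + m).
  by move=> j; rewrite mxE addrK; exact: le_lt_trans (coord_le_norm h j) hd2.
move=> rc vs; have [vd vF] := implicit_rootP (stripbox_strip vs).
set Del := implicit_root (h + m) - r; rewrite -/r -/Del in rc.
pose k : 'rV[R]_n := upd h c Del.
have kp : k + p = upd (h + m) c (implicit_root (h + m)).
  apply/rowP => j; rewrite !mxE; case: eqP => // _.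
  by rewrite /Del subrK.
have kn : `|k| <= `|h| + `|Del|.
  apply: norm_le_coord; first by rewrite addr_ge0.
  move=> j; rewrite mxE; case: eqP => _.
    by rewrite lerDr.
  by apply: le_trans (coord_le_norm h j) _; rewrite lerDl.
have kd1 : `|k| < d1.
  apply: norm_lt_coord => // j; rewrite mxE; case: eqP => // _.
  exact: le_lt_trans (coord_le_norm h j) hd1.
(* [F] vanishes at both ends of the increment [k], so the linear part of its expansion is itself
   bounded by the error. *)
have := H1 k kd1; rewrite kp vF rF subr0 sub0r normrN diff_rdot; last exact: Fdiff.
have -> : rdot k (grad F p) = A * (Del - rdot h w).
  rewrite mulrBr {2}/rdot mulr_sumr /rdot (bigD1 c) //= [X in _ = _ - X](bigD1 c) //=.
  rewrite !mxE eqxx mulr0 mulr0 add0r [Del * _]mulrC; congr (_ + _).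
  rewrite -sumrN; apply: eq_bigr => j jc; rewrite !mxE (negPf jc) -/A -/p.
  by rewrite -/r -/p -/A; field; rewrite gt_eqF.
rewrite normrM gtr0_norm // [q * A]mulrC -mulrA ler_pM2l // => H3.
have H4 : `|rdot h w| <= `|h| * K := rdot_norm h w.
set X := `|Del - rdot h w| in H3 *.
have H5 : `|Del| <= X + `|h| * K.
  rewrite -[Del](subrK (rdot h w)); apply: le_trans (ler_normD _ _) _.
  by rewrite lerD2l.
have H6 : q * `|k| <= q * (`|h| + (X + `|h| * K)).
  by apply: ler_wpM2l; [exact: ltW|lra].
have H7 : q * X <= 1 / 2 * X by apply: ler_wpM2r => //; exact: normr_ge0.
have H8 : X <= 2 * q * (1 + K) * `|h|.
  have -> : 2 * q * (1 + K) * `|h| = 2 * (q * (`|h| + `|h| * K)) by ring.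
  move: H6; rewrite addrCA mulrDr => H6; lra.
apply: le_trans H8 _; exact: ler_wpM2r.
Qed.

Lemma implicit_root_partial m k : stripbox m -> partial k implicit_root m =
  if k == c then 0 else - partial k F (phi m) / partial c F (phi m).
Proof.
move=> /implicit_root_diff [_ /rowP /(_ k)]; by rewrite !mxE.
Qed.

Let phi_cube m : stripbox m -> cube (phi m).
Proof.
move=> ms; have [rd _] := implicit_rootP (stripbox_strip ms).
by apply: upd_cube; [exact: strip_d (stripbox_strip ms)|exact: halfd].
Qed.

(** Bootstrapping: the functions [G (phi m)] with [G] smooth on the cube are stable under partial
    derivatives, because the gradient of the root is a rational expression in derivatives of [F] at
    [phi m]. The root is the member given by the coordinate [c]. *)
Lemma implicit_root_smooth : smooth_on stripbox implicit_root.
Proof.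
have oc : open cube by exact: open_box.
have cD : cube `<=` D by move=> m /Hd [].
apply: (@smooth_coind _ _ _
  (fun f => exists2 G, smooth_on cube G & f = fun m => G (phi m))).
- exact: open_box.
- move=> f [G sG ->] m ms.
  apply: (differentiable_comp (differentiable_upd c (implicit_root_diff ms).1)).
  by apply: smooth_on_differentiable sG _; exact: phi_cube.
- move=> f k [G sG ->].
  have sF' j : smooth_on cube (partial j F).
    by apply: smooth_on_sub cD _; exact: smooth_on_partial.
  exists (fun m => if k == c then 0 else
      partial k G (phi m) + - partial k F (phi m) * (partial c F (phi m))^-1 *
       partial c G (phi m)).
    exists (fun p => if k == c then 0 else
      partial k G p + - partial k F p * (partial c F p)^-1 * partial c G p) => //.
    case: eqP => _; first exact: smooth_on_cst.
    have sV : smooth_on cube (fun p => (partial c F p)^-1).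
      by apply: smooth_onV => // p /Hd [_ Fp]; rewrite gt_eqF.
    have sN := smooth_onM oc (smooth_onN oc (sF' k)) sV.
    exact: smooth_onD oc (smooth_on_partial k sG) (smooth_onM oc sN (smooth_on_partial c sG)).
  move=> m ms; rewrite partial_comp_upd; last 2 first.
  - exact: (implicit_root_diff ms).1.
  - by apply: smooth_on_differentiable sG _; exact: phi_cube.
  by rewrite implicit_root_partial //; case: eqP => // _; rewrite mul0r addr0.
- exists (fun p => p 0 c); first exact: smooth_on_coord.
  by apply/funext => m; rewrite /phi upd_same.
Qed.

End Positive.

Theorem implicit_function n (c : 'I_n) (F : 'rV[R]_n -> R) D m0 :
  open D -> smooth_on D F -> D m0 -> F m0 = 0 -> partial c F m0 != 0 ->
  exists (a b : R) (rho : 'rV[R]_n -> R), 0 < a /\ 0 < b /\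
   let V := box m0 (fun k => if k == c then a else b) in
   [/\ smooth_on V rho,
       forall m, V m -> D m /\ partial c F m != 0,
       forall m, V m -> V (upd m c (rho m)),
       forall m, V m -> (F m = 0 <-> m 0 c = rho m)
     & (forall m t, rho (upd m c t) = rho m) /\
       forall m k, V m -> partial k rho m = if k == c then 0 else
         - partial k F (upd m c (rho m)) / partial c F (upd m c (rho m))].
Proof.
(* Passing to - F keeps the zeros and the quotients of partial derivatives. *)
move=> oD; wlog Fc : F / 0 < partial c F m0.
  move=> H sF Dm0 Fm0 Fc0.
  have [Fc|] := ltP 0 (partial c F m0); first exact: H.
  rewrite le_eqVlt (negPf Fc0) /= => Fc.
  have pN k m : D m -> partial k (fun m => - F m) m = - partial k F m.
    move=> Dm; apply: deriveN; apply: diff_derivable.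
    exact: smooth_on_differentiable Dm.
  have N1 : 0 < partial c (fun m => - F m) m0 by rewrite pN // oppr_gt0.
  have N2 : - F m0 = 0 by rewrite Fm0 oppr0.
  have [a [b [rho [a0 [b0 [rs VD Vr Vu [ru rp]]]]]]] :=
    H _ N1 (smooth_onN oD sF) Dm0 N2 (lt0r_neq0 N1).
  exists a, b, rho; split; first exact: a0; split; first exact: b0.
  split; [exact: rs| |exact: Vr| |split; first exact: ru].
  - by move=> m /VD [Dm]; rewrite pN // oppr_eq0.
  - by move=> m Vm; rewrite -Vu //; split=> [->|/eqP]; rewrite ?oppr0 // oppr_eq0 => /eqP.
  - move=> m k Vm; rewrite (rp _ _ Vm); case: eqP => _; first by [].
    have [Dm _] := VD _ (Vr _ Vm).
    by rewrite (pN k _ Dm) (pN c _ Dm) invrN mulrN mulNr opprK.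
move=> sF Dm0 Fm0 _.
have [d d0 Hd] := implicit_cube oD sF Dm0 Fc.
have [e e0 He] := implicit_strip sF Fm0 d0 Hd.
have /andP[e00 ed] := e0.
have d2 : 0 < d / 2 by rewrite divr_gt0.
exists (d / 2), e, (implicit_root c F m0 d); do 2!split=> //.
have strip m : box m0 (fun k => if k == c then d / 2 else e) m ->
   forall k, k != c -> `|m 0 k - m0 0 k| < e.
  by move=> H k kc; have := H k; rewrite (negPf kc).
split.
- exact: (implicit_root_smooth sF d0 Hd e0 He).
- move=> m Vm; have [k|Dm Fm] := Hd m; last by rewrite gt_eqF.
  have := Vm k; case: eqP => _ /lt_le_trans; apply => //; lra.
- move=> m Vm k; have [rd _] := implicit_rootP sF d0 Hd e0 He (strip _ Vm).
  rewrite mxE; case: eqP => [->|/eqP kc] //; exact: strip.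
- move=> m Vm; have [rd rF] := implicit_rootP sF d0 Hd e0 He (strip _ Vm).
  split=> [Fm|E]; last by rewrite -(upd_id m c) E.
  apply: (implicit_root_unique sF d0 Hd e0 He (strip _ Vm)); last by rewrite upd_id.
  by have := Vm c; rewrite eqxx.
- split=> [m t|m k Vm]; first exact: implicit_root_upd.
  exact: (implicit_root_partial sF d0 Hd e0 He).
Qed.

End ImplicitFunction.

(** * Loci affine along the fibres *)

Section AffineLocus.
Variables (R : realType).

Lemma is_derive_upd n (f : 'rV[R]_n -> R) m c t :
  differentiable f (upd m c t) ->
  is_derive t 1 (fun s => f (upd m c s)) (partial c f (upd m c t)).
Proof.
rewrite (updE m c t) => /is_derive_line.
by under eq_fun do rewrite -updE.
Qed.

Lemma partial_upd_cst n (f : 'rV[R]_n -> R) m c d k : differentiable f m ->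
  0 < d -> (forall t, `|t - m 0 c| < d -> f (upd m c t) = k) ->
  partial c f m = 0.
Proof.
move=> df d0 H; rewrite -(upd_id m c) in df *.
have [_ <-] := is_derive_upd df.
rewrite -[RHS](@derive_cst _ _ _ k (m 0 c) 1); apply: near_eq_derive.
apply/nbhs_ballP; exists d => //= t; rewrite -ball_normE /= distrC => td.
by rewrite H.
Qed.

Lemma nbhs_upd n (m : 'rV[R]_n) c (P : set 'rV[R]_n) : nbhs m P ->
  exists2 d, 0 < d & forall t, `|t - m 0 c| < d -> P (upd m c t).
Proof.
move=> /nbhs_coord [d d0 H]; exists d => // t td; apply: H => k.
by rewrite mxE; case: eqP => [->|_] //; rewrite subrr normr0.
Qed.

Lemma partial_independent n (C : {set 'I_n}) (D : set 'rV[R]_n) F c m :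
  open D -> smooth_on D F ->
  (forall m m', D m -> D m' -> (forall c, c \notin C -> m 0 c = m' 0 c) -> F m = F m') ->
  c \in C -> D m -> partial c F m = 0.
Proof.
move=> oD sF iF cC Dm.
have [d d0 H] := nbhs_upd c (open_nbhs_nbhs (conj oD Dm)).
apply: (@partial_upd_cst _ _ _ _ d (F m)) => //.
  exact: smooth_on_differentiable Dm.
move=> t td; apply: iF => //; first exact: H.
by move=> k kC; rewrite upd_other //; apply: contraNneq kC => ->.
Qed.

Lemma partial_partial0 n (D : set 'rV[R]_n) F c k m : open D ->
  (forall m, D m -> partial c F m = 0) -> D m -> partial k (partial c F) m = 0.
Proof.
move=> oD H Dm; rewrite -[RHS](@partial_cst R n 0 k m); apply: partial_near_eq.
by apply: filterS (open_nbhs_nbhs (conj oD Dm)) => v /H.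
Qed.

Lemma box_upd_cst n (m0 m : 'rV[R]_n) r f c s t :
  (forall m, box m0 r m -> differentiable f m) ->
  (forall m, box m0 r m -> partial c f m = 0) ->
  box m0 r (upd m c s) -> box m0 r (upd m c t) ->
  f (upd m c s) = f (upd m c t).
Proof.
move=> df f0; wlog st : s t / s < t.
  move=> H bs bt; have [lt|lt|-> //] := ltgtP s t; first exact: H.
  by apply/esym; exact: H.
move=> bs bt.
have inb x : s <= x <= t -> box m0 r (x *: delta_mx 0 c + upd m c 0).
  rewrite -updE => /andP[sx xt] k; have := bs k; have := bt k.
  rewrite !mxE; case: eqP => // _; rewrite !ltr_norml => /andP[? ?] /andP[? ?].
  by apply/andP; split; lra.
have [x xst|x xst] := @line_mvt R n f (upd m c 0) (delta_mx 0 c) s t st.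
  by apply: df; exact: inb.
have -> : 'D_(delta_mx 0 c) f (x *: delta_mx 0 c + upd m c 0) = 0.
  by apply: f0; apply: inb; have /andP[? ?] := xst; rewrite !ltW.
by rewrite -!updE mul0r => /eqP; rewrite subr_eq0 => /eqP.
Qed.

(* If [F = 0] is solved as [m c1 = rho m], this is [- F_c1 ^ 3] times the second derivative
   of [rho] along [c2]. *)
Definition fibre_curvature n (c1 c2 : 'I_n) (F : 'rV[R]_n -> R) m : R :=
  partial c1 F m ^+ 2 * partial c2 (partial c2 F) m
  - partial c1 F m * partial c2 F m *
      (partial c2 (partial c1 F) m + partial c1 (partial c2 F) m)
  + partial c2 F m ^+ 2 * partial c1 (partial c1 F) m.

(** The quotient and chain rules are applied to - F_c2 / F_c1 along the graph; substituting the
    slope of [rho] once more produces the third power. *)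
Lemma implicit_partial2 n (c1 c2 : 'I_n) (F rho : 'rV[R]_n -> R) D V m :
  open V -> smooth_on D F -> smooth_on V rho ->
  (forall v, V v -> D (upd v c1 (rho v)) /\ partial c1 F (upd v c1 (rho v)) != 0) ->
  (forall v, V v -> partial c2 rho v =
     - partial c2 F (upd v c1 (rho v)) / partial c1 F (upd v c1 (rho v))) ->
  c2 != c1 -> V m ->
  partial c2 (partial c2 rho) m =
    - fibre_curvature c1 c2 F (upd m c1 (rho m)) / partial c1 F (upd m c1 (rho m)) ^+ 3.
Proof.
move=> oV sF sr VD pr c21 Vm.
have [Dp F1] := VD m Vm.
have dr : differentiable rho m by exact: smooth_on_differentiable Vm.
have dF j : differentiable (partial j F) (upd m c1 (rho m)).
  by apply: smooth_on_differentiable Dp; exact: smooth_on_partial.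
have dcomp j : differentiable (fun v => partial j F (upd v c1 (rho v))) m.
  exact: (differentiable_comp (differentiable_upd c1 dr)).
rewrite (@partial_near_eq _ _ _ _ (fun v => - partial c2 F (upd v c1 (rho v)) *
   (partial c1 F (upd v c1 (rho v)))^-1)); last first.
  by apply: filterS (open_nbhs_nbhs (conj oV Vm)) => v /pr.
rewrite partialM; last 2 first.
- exact: differentiableN.
- exact: differentiableV.
rewrite partialV // (_ : partial c2 (fun v => - _) m = - partial c2 (fun v => partial c2 F (upd v c1 (rho v))) m); last first.
  by apply: deriveN; exact: diff_derivable.
rewrite !partial_comp_upd // pr // (negPf c21) /fibre_curvature.
move: F1; set p := upd m c1 (rho m).
have [H HE] : exists H : 'I_n -> 'I_n -> R,
  forall c d, partial c (partial d F) p = H c d by eexists.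
have [h hE] : exists h : 'I_n -> R, forall c, partial c F p = h c by eexists.
rewrite !HE !hE => h0; by field.
Qed.

(** A section of [J1proj]: the fibre coordinates are frozen at those of [m0]. Composition with it
    turns a function that is constant along the fibres into a function on J^1. *)
Definition J1lift (m0 : 'rV[R]_8) (j : 'rV[R]_5) : 'rV[R]_8 :=
  row_mx j (rsubmx (m0 : 'rV[R]_(5 + 3))).

Lemma J1liftE m0 j (k : 'I_8) : J1lift m0 j 0 k =
  if insub (nat_of_ord k) is Some i then j 0 i else m0 0 k.
Proof.
rewrite /J1lift mxE; case: splitP => [i ki|i ki].
  rewrite ki; case: insubP => [i' _ E|]; last by rewrite ltn_ord.
  by congr (j 0 _); exact: val_inj.
rewrite ki insubF //= mxE; congr (m0 0 _); apply: val_inj; exact: esym.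
Qed.

Lemma J1projE (m : 'rV[R]_8) (i : 'I_5) :
  J1proj m 0 i = m 0 (widen_ord (isT : (5 <= 8)%N) i).
Proof. by rewrite /J1proj mxE; congr (m 0 _); exact: val_inj. Qed.

Lemma J1proj_upd (m : 'rV[R]_8) (c : 'I_8) t : (5 <= c)%N ->
  J1proj (upd m c t) = J1proj m.
Proof.
move=> c5; apply/rowP => i; rewrite !J1projE upd_other //.
by rewrite -val_eqE /= neq_ltn (leq_trans (ltn_ord i)).
Qed.

Lemma J1lift_proj (m0 m : 'rV[R]_8) :
  J1lift m0 (J1proj m) = upd (upd (upd m cr (m0 0 cr)) cs (m0 0 cs)) ct (m0 0 ct).
Proof.
apply/rowP => k; rewrite J1liftE !mxE.
case: insubP => [i i5 ik|]; rewrite /= ?J1projE -!val_eqE /=.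
  have k5 : (k < 5)%N by [].
  do 3 (rewrite ifF; last by apply/negbTE; rewrite neq_ltn (leq_trans k5)).
  by congr (m 0 _); apply: val_inj; rewrite /= ik.
by case: k => -[|[|[|[|[|[|[|[|]]]]]]]] //= k8 _;
  rewrite ?eqxx /=; congr (m0 0 _); exact: val_inj.
Qed.

Lemma J1proj_lift (m0 : 'rV[R]_8) j : J1proj (J1lift m0 j) = j.
Proof. by rewrite /J1proj /J1lift row_mxKl. Qed.

Lemma smooth_J1lift (U : set 'rV[R]_5) m0 k : open U ->
  smooth_on U (fun j => J1lift m0 j 0 k).
Proof.
move=> oU; under eq_fun do rewrite J1liftE.
by case: insub => [i|]; [exact: smooth_on_coord|exact: smooth_on_cst].
Qed.

Lemma box_upd n (m0 m : 'rV[R]_n) r c : box m0 r m -> 0 < r c ->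
  box m0 r (upd m c (m0 0 c)).
Proof.
by move=> bm rc k; rewrite mxE; case: eqP => [->|_] //; rewrite subrr normr0.
Qed.

Lemma box_J1lift (m0 m : 'rV[R]_8) r : (forall k, 0 < r k) -> box m0 r m ->
  box m0 r (J1lift m0 (J1proj m)).
Proof. by move=> r0 bm; rewrite J1lift_proj; do 3!apply: box_upd => //. Qed.

(** The three fibre coordinates are moved to those of [m0] one at a time; each move stays inside the
    box. *)
Lemma fibre_cst (m0 m : 'rV[R]_8) r f : (forall k, 0 < r k) ->
  smooth_on (box m0 r) f ->
  (forall c : 'I_8, (5 <= c)%N -> forall m, box m0 r m -> partial c f m = 0) ->
  box m0 r m -> f m = f (J1lift m0 (J1proj m)).
Proof.
move=> r0 sf f0 bm.
have step (c : 'I_8) v : (5 <= c)%N -> box m0 r v -> f (upd v c (m0 0 c)) = f v.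
  move=> c5 bv; rewrite -[in RHS](upd_id v c).
  apply: (@box_upd_cst _ m0 _ r); rewrite ?upd_id //; last exact: box_upd.
    by move=> w; exact: smooth_on_differentiable.
  exact: f0.
by rewrite J1lift_proj !step //; do ?apply: box_upd => //.
Qed.

(** The projection of a box is its preimage under the continuous section [J1lift m0]. *)
Lemma open_J1proj_box (m0 : 'rV[R]_8) r : (forall k, 0 < r k) ->
  open (@J1proj R @` box m0 r).
Proof.
move=> r0.
have -> : @J1proj R @` box m0 r = J1lift m0 @^-1` box m0 r.
  apply/seteqP; split=> [_ [m bm <-]|j bj]; first exact: box_J1lift.
  by exists (J1lift m0 j) => //; exact: J1proj_lift.
apply: open_comp; last exact: open_box.
move=> j _; apply: differentiable_continuous; apply: differentiable_rV => k.
by apply: (smooth_on_differentiable (@smooth_J1lift setT m0 k _)) => //; exact: openT.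
Qed.

(** * Affine loci and the curvature of the solved equation *)

Section Graph.
Variables (c1 c2 : 'I_8) (F : 'rV[R]_8 -> R) (D : set 'rV[R]_8).
Hypotheses (c1_fibre : (5 <= c1)%N) (c2_fibre : (5 <= c2)%N) (c21 : c2 != c1).
Hypotheses (oD : open D) (sF : smooth_on D F).
Hypothesis Findep : forall (c : 'I_8) m, (5 <= c)%N -> c != c1 -> c != c2 -> D m ->
  partial c F m = 0.
Hypothesis F1 : forall m, D m -> F m = 0 -> partial c1 F m != 0.

(** Once [F = 0] is solved for the coordinate [c1], zero curvature makes the slope [psi] of the
    solution in direction [c2] constant along the fibres; the intercept is then constant along them
    too. *)
Lemma affine_of_curvature :
  (forall m, D m -> F m = 0 -> fibre_curvature c1 c2 F m = 0) ->
  locus_affine_in c1 c2 D F.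
Proof.
move=> curv m0 Dm0 Fm0.
have [a [b [rho [a0 [b0 [sr VD Vr Vu [ru rp]]]]]]] :=
  implicit_function oD sF Dm0 Fm0 (F1 Dm0 Fm0).
set rad := (fun k => if k == c1 then a else b) in sr VD Vr Vu rp.
have r0 k : 0 < rad k by rewrite /rad; case: eqP.
have oV : open (box m0 rad) by exact: open_box.
have V0 : box m0 rad m0 by move=> k; rewrite subrr normr0.
set V := box m0 rad in sr VD Vr Vu rp oV V0.
have Fphi m : V m -> F (upd m c1 (rho m)) = 0.
  by move=> Vm; apply/(Vu _ (Vr _ Vm)); rewrite upd_same ru.
pose psi := partial c2 rho.
have spsi : smooth_on V psi by exact: smooth_on_partial.
have r_c (c : 'I_8) m : (5 <= c)%N -> c != c2 -> V m -> partial c rho m = 0.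
  move=> c5 cc2 Vm; rewrite rp //; case: eqP => // /eqP cc1.
  by rewrite Findep ?oppr0 ?mul0r //; exact: (VD _ (Vr _ Vm)).1.
have psi_c (c : 'I_8) : (5 <= c)%N -> forall m, V m -> partial c psi m = 0.
  move=> c5 m Vm; have [->|cc2] := eqVneq c c2.
    rewrite (@implicit_partial2 _ c1 c2 F rho D V) //.
    - by rewrite curv ?oppr0 ?mul0r //; [exact: (VD _ (Vr _ Vm)).1|exact: Fphi].
    - by move=> v Vv; exact: VD (Vr _ Vv).
    - by move=> v Vv; rewrite rp // (negPf c21).
  rewrite (@schwarz _ _ V) //.
  by apply: (@partial_partial0 _ V) => // v Vv; exact: r_c.
(* The intercept is taken at the coordinate [m0 0 c2]. It is constant along the fibres because its
   derivative in direction [c2] is psi - psi. *)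
pose h m := rho m - psi m * (m 0 c2 - m0 0 c2).
have sx : smooth_on V (fun m => m 0 c2 - m0 0 c2).
  by apply: smooth_onB => //; [exact: smooth_on_coord|exact: smooth_on_cst].
have sh : smooth_on V h by apply: smooth_onB => //; exact: smooth_onM.
have h_c (c : 'I_8) : (5 <= c)%N -> forall m, V m -> partial c h m = 0.
  move=> c5 m Vm.
  have dx := smooth_on_differentiable sx Vm.
  have dpsi := smooth_on_differentiable spsi Vm.
  rewrite partialB; last 2 first.
  - exact: smooth_on_differentiable Vm.
  - by apply: differentiableM.
  rewrite partialM // psi_c // mul0r add0r partialB; last 2 first.
  - exact: differentiable_coord.
  - exact: differentiable_cst.
  rewrite partial_coord partial_cst subr0.
  have [<-|cc2] := eqVneq c2 c; first by rewrite mulr1 subrr.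
  by rewrite mulr0 subr0 r_c // eq_sym.
exists V, (fun=> 1), (fun j => - psi (J1lift m0 j)),
  (fun j => psi (J1lift m0 j) * m0 0 c2 - h (J1lift m0 j)).
have oJ := @open_J1proj_box m0 _ r0.
have JV j : (@J1proj R @` V) j -> V (J1lift m0 j).
  by move=> [m Vm <-]; exact: box_J1lift.
have scomp f : smooth_on V f -> smooth_on (@J1proj R @` V) (fun j => f (J1lift m0 j)).
  by apply: smooth_on_comp => // k; exact: smooth_J1lift.
split=> //.
- by move=> m /VD [].
- split; first exact: smooth_on_cst.
  + by apply: smooth_onN => //; exact: scomp.
  + apply: smooth_onB => //; last exact: scomp.
    by apply: smooth_onM => //; [exact: scomp|exact: smooth_on_cst].
- move=> m Vm; rewrite Vu // mul1r -!(fibre_cst r0 _ _ Vm) //.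
  rewrite /h; split=> [->|]; first by ring.
  by move=> /eqP; rewrite -subr_eq0 => /eqP E; apply/eqP; rewrite -subr_eq0 -[X in _ == X]E; apply/eqP; ring.
Qed.

(** The [c2]-line through [m0] and the solution above it project to a single point of J^1, so the
    affine equation has constant coefficients there and makes [rho] affine along that line. *)
Lemma curvature_of_affine m0 : D m0 -> F m0 = 0 -> locus_affine_in c1 c2 D F ->
  fibre_curvature c1 c2 F m0 = 0.
Proof.
move=> Dm0 Fm0 /(_ m0 Dm0 Fm0) [W [a [b [g [oW W0 _ _ Waff]]]]].
have [ea [eb [rho [ea0 [eb0 [sr VD Vr Vu [ru rp]]]]]]] :=
  implicit_function oD sF Dm0 Fm0 (F1 Dm0 Fm0).
set rad := (fun k => if k == c1 then ea else eb) in sr VD Vr Vu rp.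
have oV : open (box m0 rad) by exact: open_box.
have V0 : box m0 rad m0 by move=> k; rewrite subrr normr0 /rad; case: eqP.
set V := box m0 rad in sr VD Vr Vu rp oV V0.
have rho0 : rho m0 = m0 0 c1 by apply/esym/Vu.
set A := a (J1proj m0); set B := b (J1proj m0); set G := g (J1proj m0).
have [d d0 Hd] : exists2 d, 0 < d & forall t, `|t - m0 0 c2| < d ->
    V (upd m0 c2 t) /\ A * rho (upd m0 c2 t) + B * t + G = 0.
  have cphi : {for m0, continuous (fun m => upd m c1 (rho m))}.
    apply: differentiable_continuous; apply: differentiable_upd.
    exact: smooth_on_differentiable V0.
  have n1 : \forall m \near m0, W (upd m c1 (rho m)).
    apply: cphi; rewrite /= rho0 upd_id; exact: open_nbhs_nbhs.
  have n2 : \forall m \near m0, V m by exact: open_nbhs_nbhs.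
  have [d d0 H] := nbhs_upd c2 (filterI n1 n2).
  exists d => // t /H [Wt Vt]; split=> //.
  have : F (upd (upd m0 c2 t) c1 (rho (upd m0 c2 t))) = 0.
    by apply/(Vu _ (Vr _ Vt)); rewrite upd_same ru.
  move=> /(Waff _ Wt); rewrite !J1proj_upd // upd_same.
  by rewrite upd_other // upd_same.
(* If A = 0, then B t + G = 0 on an interval forces B = G = 0. The affine equation becomes void and
   [F] vanishes on a [c1]-segment through [m0], against the uniqueness of the root. *)
have A0 : A != 0.
  apply/eqP => A0.
  have BG t : `|t - m0 0 c2| < d -> B * t + G = 0.
    by move=> /Hd [_]; rewrite A0 mul0r add0r.
  have E0 := BG (m0 0 c2); rewrite subrr normr0 in E0; have {}E0 := E0 d0.
  have E1 := BG (m0 0 c2 + d / 2); rewrite addrAC subrr add0r in E1.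
  have d2 : 0 < d / 2 by rewrite divr_gt0.
  rewrite gtr0_norm // in E1; have {}E1 := E1 ltac:(lra).
  have B0 : B = 0.
    have : B * (d / 2) = 0.
      by move: E1; rewrite mulrDr addrAC E0 add0r.
    by move=> /eqP; rewrite mulf_eq0 (gt_eqF d2) orbF => /eqP.
  have G0 : G = 0 by move: E0; rewrite B0 mul0r add0r.
  have n1 : \forall m \near m0, W m by exact: open_nbhs_nbhs.
  have n2 : \forall m \near m0, V m by exact: open_nbhs_nbhs.
  have [e e0 He] := nbhs_upd c1 (filterI n1 n2).
  have e2 : 0 < e / 2 by rewrite divr_gt0.
  have [|Wt Vt] := He (m0 0 c1 + e / 2).
    by rewrite addrAC subrr add0r gtr0_norm //; lra.
  have : F (upd m0 c1 (m0 0 c1 + e / 2)) = 0.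
    by apply/(Waff _ Wt); rewrite !J1proj_upd // -/A -/B -/G A0 B0 G0 !mul0r !addr0.
  move=> /(Vu _ Vt); rewrite upd_same ru rho0; lra.
have rhoE t : `|t - m0 0 c2| < d -> rho (upd m0 c2 t) = - (B / A) * t - G / A.
  by move=> /Hd [_ E]; apply: (mulfI A0); rewrite -[LHS]subr0 -E; field.
have psiE t : `|t - m0 0 c2| < d -> partial c2 rho (upd m0 c2 t) = - (B / A).
  move=> td; have [Vt _] := Hd t td.
  have [_ <-] := is_derive_upd (smooth_on_differentiable sr Vt).
  have -> : 'D_1 (fun s => rho (upd m0 c2 s)) t =
            'D_1 (fun s : R => - (B / A) * s - G / A) t.
    apply: near_eq_derive; near=> s; apply: rhoE.
    near: s.
    have ct : {for t, continuous (fun s : R => `|s - m0 0 c2|)}.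
      by move=> ?; apply: cvg_norm; apply: cvgB; [exact: cvg_id|exact: cvg_cst].
    exact: cvgr_lt ct _ td.
  rewrite deriveB // deriveMl //.
  by rewrite derive_id derive_cst subr0 mulr1.
have : partial c2 (partial c2 rho) m0 = 0.
  apply: (@partial_upd_cst _ _ _ _ d) => //; last exact: psiE.
  by apply: smooth_on_differentiable V0; exact: smooth_on_partial.
rewrite (@implicit_partial2 _ c1 c2 F rho D V) //.
- rewrite rho0 upd_id => /eqP; rewrite mulf_eq0 invr_eq0 expf_eq0 /=.
  by rewrite (negPf (F1 Dm0 Fm0)) orbF oppr_eq0 => /eqP.
- by move=> v Vv; exact: VD (Vr _ Vv).
- by move=> v Vv; rewrite rp // (negPf c21).
Unshelve. all: by end_near.
Qed.

Theorem locus_affineP : locus_affine_in c1 c2 D F <->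
  forall m, D m -> F m = 0 -> fibre_curvature c1 c2 F m = 0.
Proof.
split=> [aff m Dm Fm|]; last exact: affine_of_curvature.
exact: curvature_of_affine.
Qed.

End Graph.

Lemma locus_affine_inC c1 c2 (D : set 'rV[R]_8) F :
  locus_affine_in c1 c2 D F -> locus_affine_in c2 c1 D F.
Proof.
move=> H m Dm Fm; have [V [a [b [g [oV Vm VD [sa sb sg] HV]]]]] := H m Dm Fm.
exists V, b, a, g; split=> // v Vv; rewrite HV //.
by rewrite [b _ * _ + _]addrC.
Qed.

End AffineLocus.

(** * The pairing *)

Section Pairing.
Variables (R : realType).

Definition wedge n (a b : 'rV[R]_n) : 'M[R]_n := a^T *m b - b^T *m a.

Lemma wedgeE n (a b : 'rV[R]_n) i j :
  wedge a b i j = a 0 i * b 0 j - b 0 i * a 0 j.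
Proof. by rewrite !mxE !big_ord1 !mxE. Qed.

Lemma mulmx_tr_rdot n k (X : 'rV[R]_n) (M : 'M[R]_(k, n)) i :
  (X *m M^T) 0 i = rdot X (row i M).
Proof. by rewrite mxE; apply: eq_bigr => j _; rewrite !mxE. Qed.

Lemma mul_wedge n (X a b : 'rV[R]_n) :
  X *m wedge a b = rdot X a *: b - rdot X b *: a.
Proof.
have D (v : 'rV[R]_n) : X *m v^T = (rdot X v)%:M.
  by rewrite [LHS]mx11_scalar mulmx_tr_rdot (_ : row 0 v = v) //; apply/rowP => j; rewrite mxE.
by rewrite /wedge mulmxBr !mulmxA !D !mul_scalar_mx.
Qed.

(** The coefficient of a /\ b /\ c /\ d /\ w1 /\ w2 /\ w3 on the volume form. *)
Definition det4 (I : 'M[R]_(3, 7)) (a b c d : 'rV[R]_7) : R :=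
  \det (col_mx a (col_mx b (col_mx c (col_mx d I))) : 'M[R]_7).

(** The nested blocks are flattened into one indexed family, to which multilinearity and alternation
    of the determinant apply slot by slot. *)
Definition rows7 (I : 'M[R]_(3, 7)) (a b c d : 'rV[R]_7) (i : 'I_7) : 'rV[R]_7 :=
  nth 0 [:: a; b; c; d; row 0 I; row 1 I; row (2%:R) I] i.

Lemma det4E I a b c d : det4 I a b c d = \det (\matrix_i rows7 I a b c d i).
Proof.
congr (\det _); apply/row_matrixP => i; rewrite rowK.
apply/rowP => j; rewrite mxE.
pose I7 := 'I_(1 + (1 + (1 + (1 + 3)))).
have col (A : 'M[R]_(1 + (1 + (1 + (1 + 3))), 7)) : A = col_mx a (col_mx b (col_mx c (col_mx d I))) ->
    forall k : I7, A k j = rows7 I a b c d k 0 j; last exact: (col _ erefl).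
move=> -> {i} i.
rewrite /rows7; case: i => -[|[|[|[|[|[|[|]]]]]]] //= i7.
- rewrite (_ : Ordinal i7 = @lshift 1 (1 + (1 + (1 + 3))) 0 :> I7); last exact: val_inj.
  by rewrite col_mxEu.
- rewrite (_ : Ordinal i7 = @rshift 1 (1+(1+(1+3))) (@lshift 1 (1 + (1 + 3)) 0) :> I7); last exact: val_inj.
  by rewrite col_mxEd col_mxEu.
- rewrite (_ : Ordinal i7 = @rshift 1 (1+(1+(1+3))) (@rshift 1 (1+(1+3)) (@lshift 1 (1 + 3) 0)) :> I7); last exact: val_inj.
  by rewrite !col_mxEd col_mxEu.
- rewrite (_ : Ordinal i7 = @rshift 1 (1+(1+(1+3))) (@rshift 1 (1+(1+3)) (@rshift 1 (1+3) (@lshift 1 3 0))) :> I7); last exact: val_inj.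
  by rewrite !col_mxEd col_mxEu.
- rewrite (_ : Ordinal i7 = @rshift 1 (1+(1+(1+3))) (@rshift 1 (1+(1+3)) (@rshift 1 (1+3) (@rshift 1 3 0))) :> I7); last exact: val_inj.
  by rewrite !col_mxEd mxE.
- rewrite (_ : Ordinal i7 = @rshift 1 (1+(1+(1+3))) (@rshift 1 (1+(1+3)) (@rshift 1 (1+3) (@rshift 1 3 1))) :> I7); last exact: val_inj.
  by rewrite !col_mxEd mxE.
- rewrite (_ : Ordinal i7 = @rshift 1 (1+(1+(1+3))) (@rshift 1 (1+(1+3)) (@rshift 1 (1+3) (@rshift 1 3 2%:R))) :> I7); last exact: val_inj.
  by rewrite !col_mxEd mxE.
Qed.

Lemma det4_eqrow I a b c d (i j : 'I_7) : i != j ->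
  rows7 I a b c d i = rows7 I a b c d j -> det4 I a b c d = 0.
Proof.
by move=> ij E; rewrite det4E (determinant_alternate ij) // => k; rewrite !mxE E.
Qed.

Lemma det4_slot (i : 'I_7) v v1 v2 (x y : R) :
  (forall k, k != i -> v k = v1 k /\ v k = v2 k) ->
  v i = x *: v1 i + y *: v2 i :> 'rV[R]_7 ->
  \det (\matrix_k v k) = x * \det (\matrix_k v1 k) + y * \det (\matrix_k v2 k).
Proof.
move=> H E; apply: (determinant_multilinear (i0 := i)).
- by rewrite !rowK.
- by apply/matrixP => k l; rewrite !mxE; have [|->] := H (lift i k); first by rewrite eq_sym neq_lift.
- by apply/matrixP => k l; rewrite !mxE; have [|_ ->] := H (lift i k); first by rewrite eq_sym neq_lift.
Qed.

Let i0 : 'I_7 := @Ordinal 7 0 isT.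
Let i1 : 'I_7 := @Ordinal 7 1 isT.
Let i2 : 'I_7 := @Ordinal 7 2 isT.
Let i3 : 'I_7 := @Ordinal 7 3 isT.

Lemma det4_lin1 I x y a a' b c d :
  det4 I (x *: a + y *: a') b c d = x * det4 I a b c d + y * det4 I a' b c d.
Proof.
by rewrite !det4E; apply: (@det4_slot i0) => // -[[|[|[|[|[|[|[|]]]]]]]].
Qed.

Lemma det4_lin2 I x y a b b' c d :
  det4 I a (x *: b + y *: b') c d = x * det4 I a b c d + y * det4 I a b' c d.
Proof.
by rewrite !det4E; apply: (@det4_slot i1) => // -[[|[|[|[|[|[|[|]]]]]]]].
Qed.

Lemma det4_lin3 I x y a b c c' d :
  det4 I a b (x *: c + y *: c') d = x * det4 I a b c d + y * det4 I a b c' d.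
Proof.
by rewrite !det4E; apply: (@det4_slot i2) => // -[[|[|[|[|[|[|[|]]]]]]]].
Qed.

Lemma det4_lin4 I x y a b c d d' :
  det4 I a b c (x *: d + y *: d') = x * det4 I a b c d + y * det4 I a b c d'.
Proof.
by rewrite !det4E; apply: (@det4_slot i3) => // -[[|[|[|[|[|[|[|]]]]]]]].
Qed.

Lemma det4_12 I a c d : det4 I a a c d = 0.
Proof. by apply: (@det4_eqrow I _ _ _ _ i0 i1). Qed.
Lemma det4_13 I a b d : det4 I a b a d = 0.
Proof. by apply: (@det4_eqrow I _ _ _ _ i0 i2). Qed.
Lemma det4_14 I a b c : det4 I a b c a = 0.
Proof. by apply: (@det4_eqrow I _ _ _ _ i0 i3). Qed.
Lemma det4_23 I a b d : det4 I a b b d = 0.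
Proof. by apply: (@det4_eqrow I _ _ _ _ i1 i2). Qed.
Lemma det4_24 I a b c : det4 I a b c b = 0.
Proof. by apply: (@det4_eqrow I _ _ _ _ i1 i3). Qed.
Lemma det4_34 I a b c : det4 I a b c c = 0.
Proof. by apply: (@det4_eqrow I _ _ _ _ i2 i3). Qed.

Let rowI (k : 'I_3) : exists2 j : 'I_7, (4 <= j)%N &
  forall I a b c d, rows7 I a b c d j = row k I.
Proof.
case: k => -[|[|[|]]] //= k3.
- exists (@Ordinal 7 4 isT) => // *; rewrite /rows7 /=; congr row; exact: val_inj.
- exists (@Ordinal 7 5 isT) => // *; rewrite /rows7 /=; congr row; exact: val_inj.
- exists (@Ordinal 7 6 isT) => // *; rewrite /rows7 /=; congr row; exact: val_inj.
Qed.

Lemma det4_I2 I k a c d : det4 I a (row k I) c d = 0.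
Proof.
have [j j4 Hj] := rowI k; apply: (@det4_eqrow I _ _ _ _ i1 j); last by rewrite Hj.
by rewrite -val_eqE /=; case: (val j) j4 => [|[]].
Qed.
Lemma det4_I4 I k a b c : det4 I a b c (row k I) = 0.
Proof.
have [j j4 Hj] := rowI k; apply: (@det4_eqrow I _ _ _ _ i3 j); last by rewrite Hj.
by rewrite -val_eqE /=; case: (val j) j4 => [|[|[|[]]]].
Qed.

Section Bilinear.
Variables (n : nat) (f : 'rV[R]_n -> 'rV[R]_n -> R).
Hypothesis f1 : forall x y a a' b, f (x *: a + y *: a') b = x * f a b + y * f a' b.
Hypothesis f2 : forall x y a b b', f a (x *: b + y *: b') = x * f a b + y * f a b'.
Hypothesis falt : forall a, f a a = 0.

Lemma alternating_sym a b : f b a = - f a b.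
Proof.
have := falt (1 *: a + 1 *: b); rewrite f1 !f2 !falt !mul1r add0r addr0.
by move=> /eqP; rewrite addr_eq0 => /eqP ->; rewrite opprK.
Qed.

Let f0l b : f 0 b = 0.
Proof. by have := f1 0 0 0 0 b; rewrite !scale0r !mul0r !addr0. Qed.
Let f0r a : f a 0 = 0.
Proof. by have := f2 0 0 a 0 0; rewrite !scale0r !mul0r !addr0. Qed.

(** The terms (i, j) and (j, i) of the full bilinear expansion combine into one entry of [wedge].
    Read backwards, this collapses the double sums over i < j in the pairing. *)
Lemma alternating_expand a b : f a b =
  \sum_(i < n) \sum_(j < n | (i < j)%N) wedge a b i j * f (delta_mx 0 i) (delta_mx 0 j).
Proof.
have suml (I : finType) (c : I -> R) (v : I -> 'rV[R]_n) b' :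
    f (\sum_i c i *: v i) b' = \sum_i c i * f (v i) b'.
  elim/big_rec2: _ => [|i s t _ <-]; first exact: f0l.
  by rewrite -[t]scale1r f1 mul1r scale1r.
have sumr (I : finType) (c : I -> R) (v : I -> 'rV[R]_n) a' :
    f a' (\sum_i c i *: v i) = \sum_i c i * f a' (v i).
  elim/big_rec2: _ => [|i s t _ <-]; first exact: f0r.
  by rewrite -[t]scale1r f2 mul1r scale1r.
rewrite {1}(row_sum_delta a) suml {1}(row_sum_delta b).
pose g i j := f (delta_mx 0 i) (delta_mx 0 j).
transitivity (\sum_(i < n) \sum_(j < n) a 0 i * b 0 j * g i j).
  by apply: eq_bigr => i _; rewrite sumr mulr_sumr; apply: eq_bigr => j _; rewrite mulrA.
transitivity (\sum_(i < n) \sum_(j < n | (i < j)%N) a 0 i * b 0 j * g i j +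
              \sum_(i < n) \sum_(j < n | (j < i)%N) a 0 i * b 0 j * g i j).
  rewrite -big_split /=; apply: eq_bigr => i _.
  rewrite (bigID (fun j : 'I_n => (i < j)%N)) /=; congr (_ + _).
  rewrite (bigID (fun j : 'I_n => (j < i)%N)) /= [X in _ + X]big1 ?addr0; last first.
    move=> j; rewrite -!leqNgt => /andP[ji ij].
    have -> : j = i by apply: val_inj; apply/eqP; rewrite eqn_leq ji ij.
    by rewrite /g falt mulr0.
  by apply: eq_bigl => j; case: ltngtP.
rewrite [X in _ + X](exchange_big_dep xpredT) //= -big_split /=.
apply: eq_bigr => i _; rewrite -big_split /=; apply: eq_bigr => j _.
by rewrite wedgeE /g (alternating_sym (delta_mx 0 i)); ring.
Qed.

End Bilinear.

(** [pairing7] as a bilinear form on arbitrary 2-forms, so that exterior derivatives can be split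
    into terms of which most contribute 0. *)
Definition pair2 (I : 'M[R]_(3, 7)) (V W : 'M[R]_7) : R :=
  let e (i : 'I_7) : 'rV[R]_7 := delta_mx 0 i in
  \sum_(i < 7) \sum_(j < 7 | (i < j)%N) \sum_(k < 7) \sum_(l < 7 | (k < l)%N)
    V i j * W k l * det4 I (e i) (e j) (e k) (e l).

Lemma pairing7E I phi psi u :
  pairing7 I phi psi u = pair2 (I u) (ext_deriv phi u) (ext_deriv psi u).
Proof. by []. Qed.

Lemma pair2_lin1 I x y V V' W :
  pair2 I (x *: V + y *: V') W = x * pair2 I V W + y * pair2 I V' W.
Proof.
rewrite /pair2 !mulr_sumr -big_split; apply: eq_bigr => i _ /=.
rewrite !mulr_sumr -big_split; apply: eq_bigr => j _ /=.
rewrite !mulr_sumr -big_split; apply: eq_bigr => k _ /=.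
rewrite !mulr_sumr -big_split; apply: eq_bigr => l _ /=.
by rewrite !mxE; ring.
Qed.

Lemma pair2_lin2 I x y V W W' :
  pair2 I V (x *: W + y *: W') = x * pair2 I V W + y * pair2 I V W'.
Proof.
rewrite /pair2 !mulr_sumr -big_split; apply: eq_bigr => i _ /=.
rewrite !mulr_sumr -big_split; apply: eq_bigr => j _ /=.
rewrite !mulr_sumr -big_split; apply: eq_bigr => k _ /=.
rewrite !mulr_sumr -big_split; apply: eq_bigr => l _ /=.
by rewrite !mxE; ring.
Qed.

Lemma pair2_wedge1 I a b W : pair2 I (wedge a b) W =
  \sum_(k < 7) \sum_(l < 7 | (k < l)%N)
    W k l * det4 I a b (delta_mx 0 k) (delta_mx 0 l).
Proof.
rewrite /pair2.
pose g c d := \sum_(k < 7) \sum_(l < 7 | (k < l)%N)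
    W k l * det4 I c d (delta_mx 0 k) (delta_mx 0 l).
transitivity (g a b) => //.
rewrite (alternating_expand (f := g)).
- apply: eq_bigr => i _; apply: eq_bigr => j _; rewrite /g mulr_sumr.
  apply: eq_bigr => k _; rewrite mulr_sumr; apply: eq_bigr => l _.
  by rewrite mulrA.
- move=> x y c c' d; rewrite /g !mulr_sumr -big_split; apply: eq_bigr => k _ /=.
  rewrite !mulr_sumr -big_split; apply: eq_bigr => l _ /=.
  by rewrite det4_lin1; ring.
- move=> x y c d d'; rewrite /g !mulr_sumr -big_split; apply: eq_bigr => k _ /=.
  rewrite !mulr_sumr -big_split; apply: eq_bigr => l _ /=.
  by rewrite det4_lin2; ring.
- by move=> c; rewrite /g big1 // => k _; rewrite big1 // => l _; rewrite det4_12 mulr0.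
Qed.

Lemma pair2_wedge I a b c d : pair2 I (wedge a b) (wedge c d) = det4 I a b c d.
Proof.
rewrite pair2_wedge1 (alternating_expand (f := fun c d => det4 I a b c d)) //.
- by move=> *; exact: det4_lin3.
- by move=> *; exact: det4_lin4.
- by move=> *; exact: det4_34.
Qed.

Lemma pair2_wedge2 I c d V : pair2 I V (wedge c d) =
  \sum_(i < 7) \sum_(j < 7 | (i < j)%N)
    V i j * det4 I (delta_mx 0 i) (delta_mx 0 j) c d.
Proof.
rewrite /pair2; apply: eq_bigr => i _; apply: eq_bigr => j _.
rewrite [in RHS](alternating_expand (f := det4 I (delta_mx 0 i) (delta_mx 0 j))).
- rewrite mulr_sumr; apply: eq_bigr => k _; rewrite mulr_sumr.
  by apply: eq_bigr => l _; rewrite mulrA.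
- by move=> *; exact: det4_lin3.
- by move=> *; exact: det4_lin4.
- by move=> *; exact: det4_34.
Qed.

(** The wedge with w1 /\ w2 /\ w3 kills every 2-form that has a contact form as a factor. *)
Lemma pair2_I1 I a k W : pair2 I (wedge a (row k I)) W = 0.
Proof.
rewrite pair2_wedge1 big1 // => i _; rewrite big1 // => j _.
by rewrite det4_I2 mulr0.
Qed.

Lemma pair2_I2 I a k W : pair2 I W (wedge a (row k I)) = 0.
Proof.
rewrite pair2_wedge2 big1 // => i _; rewrite big1 // => j _.
by rewrite det4_I4 mulr0.
Qed.

End Pairing.

(** * Linear algebra at a point *)

Lemma row_col_mx3 (R : realType) n (a b c : 'rV[R]_n) (k : 'I_(1 + (1 + 1))) :
  row k (col_mx a (col_mx b c)) = nth 0 [:: a; b; c] k.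
Proof.
apply/rowP => j; rewrite mxE; case: k => -[|[|[|]]] //= k3.
- rewrite (_ : Ordinal k3 = @lshift 1 (1 + 1) 0); last exact: val_inj.
  by rewrite col_mxEu.
- rewrite (_ : Ordinal k3 = @rshift 1 (1 + 1) (@lshift 1 1 0)); last exact: val_inj.
  by rewrite col_mxEd col_mxEu.
- rewrite (_ : Ordinal k3 = @rshift 1 (1 + 1) (@rshift 1 1 0)); last exact: val_inj.
  by rewrite !col_mxEd.
Qed.

(** The symmetric matrix with rows (x, y) and (y, z) annihilates (a, b), hence is a multiple of the
    square of the covector (b, - a). *)
Lemma ruling_direction (R : realType) (a b x y z : R) : (a != 0) || (b != 0) ->
  a * x + b * y = 0 -> a * y + b * z = 0 ->
  exists nu, [/\ x = nu * b ^+ 2, y = nu * - (a * b) & z = nu * a ^+ 2].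
Proof.
move=> ab E1 E2; case/orP: ab => n0.
- have Ey : y = - (b * z) / a.
    by apply: (mulfI n0); transitivity (- (b * z)); [lra|field].
  have Ex : x = - (b * y) / a.
    by apply: (mulfI n0); transitivity (- (b * y)); [lra|field].
  by exists (z / a ^+ 2); split; rewrite ?Ex ?Ey; field.
- have Ey : y = - (a * x) / b.
    by apply: (mulfI n0); transitivity (- (a * x)); [lra|field].
  have Ez : z = - (a * y) / b.
    by apply: (mulfI n0); transitivity (- (a * y)); [lra|field].
  by exists (x / b ^+ 2); split; rewrite ?Ez ?Ey; field.
Qed.

Section Pointwise.
Variables (R : realType) (J : 'M[R]_(7, 8)) (m dF : 'rV[R]_8).
Hypothesis rankJ : \rank J = 7.
Hypothesis JdF : J *m dF^T = 0.
Let A := dF 0 cr.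
Let B := dF 0 cs.
Let C := dF 0 ct.
Hypothesis hyp : A * C - 4^-1 * B ^+ 2 < 0.

Let hyp' : 4 * (A * C) < B ^+ 2.
Proof. by move: hyp; lra. Qed.

(** The pullback of a coordinate differential of J^2: dx, dy, ..., dt on the parametrized
    equation. *)
Definition covec (c : 'I_8) : 'rV[R]_7 := row c J^T.
Local Notation e := covec.
Local Notation I := (contact_forms m *m J^T).
Let p := m 0 cp. Let q := m 0 cq. Let r := m 0 cr. Let s := m 0 cs. Let t := m 0 ct.

Lemma sum8 (V : nmodType) (F : 'I_8 -> V) :
  \sum_c F c = F cx + F cy + F cz + F cp + F cq + F cr + F cs + F ct.
Proof.
rewrite !big_ord_recl big_ord0 addr0 !addrA.
by do 7!(congr (_ + _); last by congr F; exact: val_inj); congr F; exact: val_inj.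
Qed.

Lemma ord8P (P : 'I_8 -> Prop) : P cx -> P cy -> P cz -> P cp -> P cq -> P cr ->
  P cs -> P ct -> forall c, P c.
Proof.
move=> Px Py Pz Pp Pq Pr Ps Pt c.
have H (c' : 'I_8) : val c = val c' -> P c' -> P c by move=> /val_inj ->.
case: c H => -[|[|[|[|[|[|[|[|]]]]]]]] //= k8 H;
  [exact: (H cx)|exact: (H cy)|exact: (H cz)|exact: (H cp)|exact: (H cq)|
   exact: (H cr)|exact: (H cs)|exact: (H ct)].
Qed.

Lemma pullback_covec (v : 'rV[R]_8) : v *m J^T = \sum_c v 0 c *: e c.
Proof. exact: mulmx_sum_row. Qed.

Definition seq8 (l : seq R) : 'rV[R]_8 := \row_c nth 0 l c.

Lemma kernelJ (v : 'rV[R]_8) : v *m J^T = 0 -> exists k, v = k *: dF.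
Proof.
move=> vJ.
have rk : \rank (kermx J^T) = 1 by rewrite mxrank_ker mxrank_tr rankJ.
have dF0 : dF != 0.
  apply/eqP => dF0; move: hyp; rewrite /A /B /C dF0 !mxE; lra.
have k1 : (dF <= kermx J^T)%MS.
  by apply/sub_kermxP; rewrite -[LHS]trmxK trmx_mul trmxK JdF trmx0.
have k2 : (v <= kermx J^T)%MS by apply/sub_kermxP.
have : (dF == kermx J^T)%MS.
  by rewrite -(geq_leqif (mxrank_leqif_eq k1)) rk rank_rV dF0.
by move=> /eqmxP eqk; move: k2; rewrite -eqk => /sub_rVP.
Qed.

(** The eight pulled back differentials span a space of dimension 7, and their only relation is dF =
    0. This replaces comparison of coefficients in all later computations. *)
Lemma covec_relation x1 x2 x3 x4 x5 x6 x7 x8 :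
  x1 *: e cx + x2 *: e cy + x3 *: e cz + x4 *: e cp + x5 *: e cq
  + x6 *: e cr + x7 *: e cs + x8 *: e ct = 0 ->
  exists k, [/\ x1 = k * dF 0 cx, x2 = k * dF 0 cy, x3 = k * dF 0 cz,
     x4 = k * dF 0 cp & x5 = k * dF 0 cq] /\
   [/\ x6 = k * A, x7 = k * B & x8 = k * C].
Proof.
move=> H; have [|k E] := @kernelJ (seq8 [:: x1; x2; x3; x4; x5; x6; x7; x8]).
  by rewrite pullback_covec sum8 !mxE.
have Ec c := congr1 (fun w : 'rV[R]_8 => w 0 c) E.
exists k; split; split.
- by have := Ec cx; rewrite !mxE.
- by have := Ec cy; rewrite !mxE.
- by have := Ec cz; rewrite !mxE.
- by have := Ec cp; rewrite !mxE.
- by have := Ec cq; rewrite !mxE.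
- by have := Ec cr; rewrite !mxE.
- by have := Ec cs; rewrite !mxE.
- by have := Ec ct; rewrite !mxE.
Qed.

Lemma covec_dF : dF 0 cx *: e cx + dF 0 cy *: e cy + dF 0 cz *: e cz
  + dF 0 cp *: e cp + dF 0 cq *: e cq + A *: e cr + B *: e cs + C *: e ct = 0.
Proof.
have : dF *m J^T = 0 by rewrite -[LHS]trmxK trmx_mul trmxK JdF trmx0.
by rewrite pullback_covec sum8.
Qed.

Let w1 := e cz - p *: e cx - q *: e cy.
Let w2 := e cp - r *: e cx - s *: e cy.
Let w3 := e cq - s *: e cx - t *: e cy.

Let i2 : 'I_3 := @Ordinal 3 2 isT.

Lemma contact_rowE : [/\ row 0 I = w1, row 1 I = w2 & row i2 I = w3].
Proof.
have E k : delta_mx 0 k *m J^T = e k :> 'rV[R]_7 by rewrite -rowE.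
split; rewrite row_mul.
- rewrite (_ : row 0 _ = delta_mx 0 cz - p *: delta_mx 0 cx - q *: delta_mx 0 cy).
    by rewrite !mulmxBl -!scalemxAl !E.
  exact: row_col_mx3.
- rewrite (_ : row 1 _ = delta_mx 0 cp - r *: delta_mx 0 cx - s *: delta_mx 0 cy).
    by rewrite !mulmxBl -!scalemxAl !E.
  exact: row_col_mx3.
- rewrite (_ : row i2 _ = delta_mx 0 cq - s *: delta_mx 0 cx - t *: delta_mx 0 cy).
    by rewrite !mulmxBl -!scalemxAl !E.
  exact: row_col_mx3.
Qed.

Lemma contact_row_free : row_free I.
Proof.
have [R1 R2 R3] := contact_rowE.
rewrite -kermx_eq0; apply/rowV0P => y /sub_kermxP.
rewrite mulmx_sum_row !big_ord_recl big_ord0 addr0.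
rewrite (_ : lift ord0 ord0 = 1); last exact: val_inj.
rewrite (_ : lift ord0 (lift ord0 ord0) = i2); last exact: val_inj.
rewrite R1 R2 R3 => yI.
have [|k [[_ _ Ez Ep Eq] [Er Es Et]]] := @covec_relation
  (- (y 0 0 * p) - y 0 1 * r - y 0 i2 * s) (- (y 0 0 * q) - y 0 1 * s - y 0 i2 * t)
  (y 0 0) (y 0 1) (y 0 i2) 0 0 0.
  by rewrite -[RHS]yI; apply/rowP => j; rewrite /w1 /w2 /w3 !mxE; ring.
(* The relation contains no dr, ds, dt, so k kills F_r and F_s, which by hyperbolicity do not both
   vanish. *)
have k0 : k = 0.
  have [A0|A0] := eqVneq A 0; last by move/esym/eqP: Er; rewrite mulf_eq0 (negPf A0) orbF => /eqP.
  have B0 : B != 0 by apply/eqP => B0; move: hyp'; rewrite A0 B0; lra.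
  by move/esym/eqP: Es; rewrite mulf_eq0 (negPf B0) orbF => /eqP.
rewrite k0 !mul0r in Ez Ep Eq.
apply/rowP => i; rewrite mxE; case: i => -[|[|[|]]] // i3.
- by rewrite (_ : Ordinal i3 = 0) //; exact: val_inj.
- by rewrite (_ : Ordinal i3 = 1) //; exact: val_inj.
- by rewrite (_ : Ordinal i3 = i2) //; exact: val_inj.
Qed.

(** [W1], [W2], [W3] are the values at a point of dw1, dw2, dw3; for instance d(dz - p dx - q dy) =
    dx /\ dp + dy /\ dq. *)
Definition W1 := wedge (e cx) (e cp) + wedge (e cy) (e cq).
Definition W2 := wedge (e cx) (e cr) + wedge (e cy) (e cs).
Definition W3 := wedge (e cx) (e cs) + wedge (e cy) (e ct).

(** The two dx /\ dy terms cancel because w2 and w3 share the coefficient s. Hence dw1 lies in the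
    ideal of w2 and w3, and w1 is in the radical of the pairing. *)
Lemma W1E : W1 = wedge (e cx) w2 + wedge (e cy) w3.
Proof.
apply/matrixP => i j; rewrite /W1 /w2 /w3.
by rewrite [LHS]mxE [RHS]mxE !wedgeE !mxE; ring.
Qed.

Local Notation E := (det4 I (e cx) (e cy)).

Lemma det4_sw13 a b c d : det4 I c b a d = - det4 I a b c d.
Proof.
apply: (alternating_sym (f := fun a c => det4 I a b c d)).
- by move=> *; exact: det4_lin1.
- by move=> *; exact: det4_lin3.
- by move=> *; exact: det4_13.
Qed.
Lemma det4_sw23 a b c d : det4 I a c b d = - det4 I a b c d.
Proof.
apply: (alternating_sym (f := fun b c => det4 I a b c d)).
- by move=> *; exact: det4_lin2.
- by move=> *; exact: det4_lin3.
- by move=> *; exact: det4_23.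
Qed.
Lemma det4_sw34 a b c d : det4 I a b d c = - det4 I a b c d.
Proof.
apply: (alternating_sym (f := det4 I a b)).
- by move=> *; exact: det4_lin3.
- by move=> *; exact: det4_lin4.
- by move=> *; exact: det4_34.
Qed.

(** Modulo the contact forms, dz, dp and dq are combinations of dx and dy, which are already
    factors. *)
Let E_base (a b : 'rV[R]_7) x1 x2 x3 x4 x5 :
  b = x1 *: e cx + x2 *: e cy + x3 *: e cz + x4 *: e cp + x5 *: e cq -> E a b = 0.
Proof.
have [R1 R2 R3] := contact_rowE.
have lin x y u v : E a (x *: u + y *: v) = x * E a u + y * E a v by exact: det4_lin4.
have E1 : E a w1 = 0 by rewrite -R1 det4_I4.
have E2 : E a w2 = 0 by rewrite -R2 det4_I4.
have E3 : E a w3 = 0 by rewrite -R3 det4_I4.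
move=> ->.
rewrite (_ : _ + _ = 1 *: (1 *: (1 *: ((x1 + x3 * p + x4 * r + x5 * s) *: e cx +
   (x2 + x3 * q + x4 * s + x5 * t) *: e cy) + x3 *: w1) + x4 *: w2) + x5 *: w3).
  by rewrite !lin E1 E2 E3 det4_14 det4_24; ring.
by apply/rowP => j; rewrite /w1 /w2 /w3 !mxE; ring.
Qed.

Lemma E_relation a : A * E a (e cr) + B * E a (e cs) + C * E a (e ct) = 0.
Proof.
have lin x y u v : E a (x *: u + y *: v) = x * E a u + y * E a v by exact: det4_lin4.
transitivity (E a (1 *: (A *: e cr + B *: e cs) + C *: e ct)).
  by rewrite !lin mul1r.
apply: (@E_base _ _ (- dF 0 cx) (- dF 0 cy) (- dF 0 cz) (- dF 0 cp) (- dF 0 cq)).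
apply/eqP; rewrite -subr_eq0; apply/eqP; rewrite -covec_dF.
by apply/rowP => j; rewrite !mxE; ring.
Qed.

Let E_nz a b :
  (forall c, (e c <= col_mx (e cx) (col_mx (e cy) (col_mx a (col_mx b I))))%MS) ->
  E a b != 0.
Proof.
rewrite /det4.
move: (col_mx _ _) => M H.
have : (J^T <= M)%MS by apply/row_subP.
move=> /mxrankS; rewrite mxrank_tr rankJ => rk.
by rewrite -unitfE -unitmxE -row_full_unit /row_full eqn_leq rank_leq_col.
Qed.

Let col4_sub n (a b c d v : 'rV[R]_7) (M : 'M[R]_(n, 7)) (x1 x2 x3 x4 : R) z :
  v = x1 *: a + x2 *: b + x3 *: c + x4 *: d + z -> (z <= M)%MS ->
  (v <= col_mx a (col_mx b (col_mx c (col_mx d M))))%MS.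
Proof.
move=> -> zM.
have up n1 n2 (x : 'M[R]_(n1, 7)) (y : 'M[R]_(n2, 7)) : (x <= col_mx x y)%MS.
  by rewrite -addsmxE addsmxSl.
have dn n1 n2 n3 (x : 'M[R]_(n1, 7)) (y : 'M[R]_(n2, 7)) (w : 'M[R]_(n3, 7)) :
    (w <= y)%MS -> (w <= col_mx x y)%MS.
  by move=> wy; rewrite -addsmxE; exact: submx_trans wy (addsmxSr _ _).
rewrite !addmx_sub ?scalemx_sub //.
- by apply: (dn); exact: up.
- by do 2!apply: (dn); exact: up.
- by do 3!apply: (dn); exact: up.
- by do 4!apply: (dn).
Qed.

Let base_sub (v a b : 'rV[R]_7) (x1 x2 x3 x4 x5 y1 y2 : R) :
  v = x1 *: e cx + x2 *: e cy + x3 *: e cz + x4 *: e cp + x5 *: e cq + y1 *: a + y2 *: b ->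
  (v <= col_mx (e cx) (col_mx (e cy) (col_mx a (col_mx b I))))%MS.
Proof.
have [R1 R2 R3] := contact_rowE.
move=> ->.
apply: (@col4_sub _ _ _ _ _ _ _ (x1 + x3 * p + x4 * r + x5 * s)
  (x2 + x3 * q + x4 * s + x5 * t) y1 y2 (x3 *: w1 + x4 *: w2 + x5 *: w3)).
  by apply/rowP => j; rewrite /w1 /w2 /w3 !mxE; ring.
by rewrite -R1 -R2 -R3 !addmx_sub ?scalemx_sub ?row_sub.
Qed.

(** If dr, ds, dt are combinations of [a], [b] and the five base differentials, then dx, dy, a, b
    and the contact forms span everything. Each of [fr], [fs], [ft] lists the coefficients on [a],
    on [b], and on dx, dy, dz, dp, dq. *)
Let basis_nz a b (fr fs ft : R * R * (R * R * R * R * R)) :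
  (forall c f, (c, f) \in [:: (cr, fr); (cs, fs); (ct, ft)] ->
    e c = f.2.1.1.1.1 *: e cx + f.2.1.1.1.2 *: e cy + f.2.1.1.2 *: e cz +
      f.2.1.2 *: e cp + f.2.2 *: e cq + f.1.1 *: a + f.1.2 *: b) ->
  E a b != 0.
Proof.
move=> H; apply: E_nz; apply: ord8P.
- by apply: (@base_sub _ _ _ 1 0 0 0 0 0 0); rewrite !scale0r !addr0 scale1r.
- by apply: (@base_sub _ _ _ 0 1 0 0 0 0 0); rewrite !scale0r !addr0 scale1r add0r.
- by apply: (@base_sub _ _ _ 0 0 1 0 0 0 0); rewrite !scale0r !addr0 scale1r !add0r.
- by apply: (@base_sub _ _ _ 0 0 0 1 0 0 0); rewrite !scale0r !addr0 scale1r !add0r.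
- by apply: (@base_sub _ _ _ 0 0 0 0 1 0 0); rewrite !scale0r !addr0 scale1r !add0r.
- by apply: base_sub; apply: (H cr fr); rewrite !inE eqxx.
- by apply: base_sub; apply: (H cs fs); rewrite !inE eqxx orbT.
- by apply: base_sub; apply: (H ct ft); rewrite !inE eqxx !orbT.
Qed.

(** Pairing the relation dF = 0 with dr, ds and dt gives three linear equations, whose solution is
    proportional to (C, A, - B). The factor is nonzero: if A is nonzero, dr is expressed through ds
    and dt; otherwise B is nonzero and ds is eliminated. *)
Lemma E_values : exists2 k, k != 0 &
  [/\ E (e cr) (e cs) = k * C, E (e cs) (e ct) = k * A & E (e cr) (e ct) = - (k * B)].
Proof.
have Rr := E_relation (e cr); have Rs := E_relation (e cs); have Rt := E_relation (e ct).
have sw a b : E b a = - E a b by exact: det4_sw34.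
rewrite det4_34 mulr0 add0r in Rr.
rewrite det4_34 mulr0 addr0 (sw (e cr)) in Rs.
rewrite det4_34 mulr0 addr0 (sw (e cr)) (sw (e cs)) in Rt.
have [A0|A0] := eqVneq A 0; last first.
  exists (E (e cs) (e ct) / A).
    rewrite mulf_neq0 ?invr_eq0 //.
    apply: (@basis_nz _ _
     (- B / A, - C / A, (- dF 0 cx / A, - dF 0 cy / A, - dF 0 cz / A, - dF 0 cp / A, - dF 0 cq / A))
     (1, 0, (0, 0, 0, 0, 0)) (0, 1, (0, 0, 0, 0, 0))) => c f.
    rewrite !inE => /or3P[] /eqP[-> ->] /=.
    - apply: (scalerI A0); apply/eqP; rewrite -subr_eq0; apply/eqP; rewrite -[RHS]covec_dF.
      by apply/rowP => j; rewrite !mxE; field.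
    - by rewrite !scale0r !addr0 scale1r !add0r.
    - by rewrite !scale0r !addr0 scale1r !add0r.
  move: Rr Rs Rt; move: (E (e cr) (e cs)) (E (e cr) (e ct)) (E (e cs) (e ct)).
  move=> X Y Z _ Rs Rt; split; apply: (mulfI A0).
  - by transitivity (C * Z); [lra|field].
  - by field.
  - by transitivity (- (B * Z)); [lra|field].
have B0 : B != 0 by apply/eqP => B0; move: hyp'; rewrite A0 B0; lra.
rewrite A0 mul0r add0r in Rt; rewrite A0 mul0r add0r in Rs.
exists (- E (e cr) (e ct) / B).
  rewrite mulf_neq0 ?invr_eq0 // oppr_eq0.
  apply: (@basis_nz _ _ (1, 0, (0, 0, 0, 0, 0))
     (- A / B, - C / B, (- dF 0 cx / B, - dF 0 cy / B, - dF 0 cz / B, - dF 0 cp / B, - dF 0 cq / B))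
     (0, 1, (0, 0, 0, 0, 0))) => c f.
  rewrite !inE => /or3P[] /eqP[-> ->] /=.
  - by rewrite !scale0r !addr0 scale1r !add0r.
  - apply: (scalerI B0); apply/eqP; rewrite -subr_eq0; apply/eqP; rewrite -[RHS]covec_dF.
    by apply/rowP => j; rewrite !mxE; field.
  - by rewrite !scale0r !addr0 scale1r !add0r.
move: Rr Rs Rt; move: (E (e cr) (e cs)) (E (e cr) (e ct)) (E (e cs) (e ct)).
move=> X Y Z Rr _ Rt; rewrite A0; split; apply: (mulfI B0).
- by transitivity (- (C * Y)); [lra|field].
- by transitivity (0 : R); [lra|ring].
- by field.
Qed.

(** The polarization of 2 (F_t a^2 - F_s a b + F_r b^2); the factor 2 avoids halves. *)
Definition null_form (a b a' b' : R) :=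
  2 * C * (a * a') - B * (a * b' + a' * b) + 2 * A * (b * b').

(* The value at a point of the exterior derivative of a combination of the contact forms, in
   terms of the values [x] of its coefficients and of their differentials [dx]. *)
Definition dcomb (x : 'I_3 -> R) (dx : 'I_3 -> 'rV[R]_7) : 'M[R]_7 :=
  (\sum_i wedge (dx i) (row i I)) + (x 0 *: W1 + x 1 *: W2 + x i2 *: W3).

(** Terms with a contact factor drop out, among them all those with differentials of coefficients,
    and [W1] drops out by [W1E]. Only the four pairings of [W2] and [W3] survive, whose common sign
    is the reason for the witness - k. *)
Lemma pairing_value : exists2 k, k != 0 & forall x dx y dy,
  pair2 I (dcomb x dx) (dcomb y dy) = k * null_form (x 1) (x i2) (y 1) (y i2).
Proof.
have [k k0 [Ers Est Ert]] := E_values.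
have [R1 R2 R3] := contact_rowE.
exists (- k); first by rewrite oppr_eq0.
move=> x dx y dy.
have D1 V V' W : pair2 I (V + V') W = pair2 I V W + pair2 I V' W.
  by rewrite -[V]scale1r -[V']scale1r pair2_lin1 !mul1r !scale1r.
have D2 V W W' : pair2 I V (W + W') = pair2 I V W + pair2 I V W'.
  by rewrite -[W]scale1r -[W']scale1r pair2_lin2 !mul1r !scale1r.
have Z1 V W c : pair2 I (c *: V) W = c * pair2 I V W.
  by rewrite -[c *: V]addr0 -[X in _ + X](scale0r 0) pair2_lin1 mul0r addr0.
have Z2 V W c : pair2 I V (c *: W) = c * pair2 I V W.
  by rewrite -[c *: W]addr0 -[X in _ + X](scale0r 0) pair2_lin2 mul0r addr0.
have S1 W : pair2 I (\sum_i wedge (dx i) (row i I)) W = 0.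
  elim/big_ind: _ => [|V V' HV HV'|i _].
  - by rewrite -(scale0r 0) Z1 mul0r.
  - by rewrite D1 HV HV' addr0.
  - exact: pair2_I1.
have S2 V : pair2 I V (\sum_i wedge (dy i) (row i I)) = 0.
  elim/big_ind: _ => [|W W' HW HW'|i _].
  - by rewrite -(scale0r 0) Z2 mul0r.
  - by rewrite D2 HW HW' addr0.
  - exact: pair2_I2.
have P1 W : pair2 I W1 W = 0 by rewrite W1E -R2 -R3 D1 !pair2_I1 addr0.
have P2 V : pair2 I V W1 = 0 by rewrite W1E -R2 -R3 D2 !pair2_I2 addr0.
have T1 W : pair2 I (dcomb x dx) W = x 1 * pair2 I W2 W + x i2 * pair2 I W3 W.
  by rewrite /dcomb D1 S1 add0r D1 D1 !Z1 P1 mulr0 add0r.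
have T2 V : pair2 I V (dcomb y dy) = y 1 * pair2 I V W2 + y i2 * pair2 I V W3.
  by rewrite /dcomb D2 S2 add0r D2 D2 !Z2 P2 mulr0 add0r.
have DD a b c d f g h i : pair2 I (wedge a b + wedge c d) (wedge f g + wedge h i) =
    det4 I a b f g + det4 I a b h i + (det4 I c d f g + det4 I c d h i).
  by rewrite (D1 (wedge a b)) !(D2 _ (wedge f g)) !pair2_wedge.
have V22 : pair2 I W2 W2 = - (2 * k * C).
  rewrite /W2 /W3 DD !det4_13.
  rewrite (det4_sw13 (e cx)) !(det4_sw23 (e cx) (e cy)) (det4_sw34 _ _ (e cr) (e cs)) Ers.
  by ring.
have V23 : pair2 I W2 W3 = k * B.
  rewrite /W2 /W3 DD !det4_13.
  by rewrite (det4_sw23 (e cx) (e cy)) det4_24 Ert; ring.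
have V32 : pair2 I W3 W2 = k * B.
  rewrite /W2 /W3 DD !det4_13.
  rewrite det4_24 (det4_sw13 (e cx)) (det4_sw23 (e cx) (e cy)) (det4_sw34 _ _ (e cr) (e ct)) Ert.
  by ring.
have V33 : pair2 I W3 W3 = - (2 * k * A).
  rewrite /W2 /W3 DD !det4_13.
  rewrite (det4_sw13 (e cx)) !(det4_sw23 (e cx) (e cy)) (det4_sw34 _ _ (e cs) (e ct)) Est.
  by ring.
by rewrite T1 !T2 V22 V23 V32 V33 /null_form; ring.
Qed.

Lemma rdot_covec X c : rdot X (e c) = (X *m J) 0 c.
Proof. by rewrite /rdot mxE; apply: eq_bigr => k _; rewrite /covec !mxE. Qed.

Lemma rdotD X (v w : 'rV[R]_7) : rdot X (v + w) = rdot X v + rdot X w.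
Proof. by rewrite /rdot -big_split; apply: eq_bigr => k _; rewrite mxE mulrDr. Qed.

Lemma rdotZ X (v : 'rV[R]_7) x : rdot X (x *: v) = x * rdot X v.
Proof. by rewrite /rdot mulr_sumr; apply: eq_bigr => k _; rewrite mxE mulrCA. Qed.

Lemma rdotB X (v w : 'rV[R]_7) : rdot X (v - w) = rdot X v - rdot X w.
Proof. by rewrite rdotD -scaleN1r rdotZ mulN1r. Qed.

(** By rank, the image of [J] is the whole kernel of dF. *)
Lemma tangent_lift (v : 'rV[R]_8) : v *m dF^T = 0 -> exists X, X *m J = v.
Proof.
move=> vF.
have dF0 : dF != 0.
  apply/eqP => dF0; move: hyp; rewrite /A /B /C dF0 !mxE; lra.
have rk : \rank (kermx dF^T) = 7 by rewrite mxrank_ker mxrank_tr rank_rV dF0.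
have k1 : (J <= kermx dF^T)%MS by apply/sub_kermxP.
have : (J == kermx dF^T)%MS.
  by rewrite -(geq_leqif (mxrank_leqif_eq k1)) rk rankJ.
move=> /eqmxP eqk.
have : (v <= kermx dF^T)%MS by apply/sub_kermxP.
by rewrite -eqk => /submxP [X ->]; exists X.
Qed.

(** * Cauchy vectors of a null system at a point *)

Section Cauchy.
Variables (a b : R) (da db X0 : 'rV[R]_7).
Hypothesis null : C * a ^+ 2 - B * (a * b) + A * b ^+ 2 = 0.
Hypothesis ab0 : (a != 0) || (b != 0).
Hypothesis X0J : X0 *m J = seq8 [:: 0; 0; 0; 0; 0; b ^+ 2; - (a * b); a ^+ 2].

Definition null_covector := a *: w2 + b *: w3.
Definition d_null_covector := wedge da w2 + wedge db w3 + a *: W2 + b *: W3.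

Let mul_W1 X : X *m W1 = (X *m J) 0 cx *: e cp - (X *m J) 0 cp *: e cx
   + ((X *m J) 0 cy *: e cq - (X *m J) 0 cq *: e cy).
Proof. by rewrite mulmxDr !mul_wedge !rdot_covec. Qed.

Let mul_W2 X : X *m W2 = (X *m J) 0 cx *: e cr - (X *m J) 0 cr *: e cx
   + ((X *m J) 0 cy *: e cs - (X *m J) 0 cs *: e cy).
Proof. by rewrite mulmxDr !mul_wedge !rdot_covec. Qed.

Let mul_W3 X : X *m W3 = (X *m J) 0 cx *: e cs - (X *m J) 0 cs *: e cx
   + ((X *m J) 0 cy *: e ct - (X *m J) 0 ct *: e cy).
Proof. by rewrite mulmxDr !mul_wedge !rdot_covec. Qed.

Let mul_d_null X : X *m d_null_covector = rdot X da *: w2 - rdot X w2 *: da +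
  (rdot X db *: w3 - rdot X w3 *: db) + a *: (X *m W2) + b *: (X *m W3).
Proof.
rewrite /d_null_covector (mulmxDr X _ (b *: W3)) (mulmxDr X _ (a *: W2)).
by rewrite (mulmxDr X (wedge da w2)) -!scalemxAr !mul_wedge.
Qed.

(** The condition on [W1] determines the dx, dy, dp, dq components of X up to one factor [b2]; the
    dr, ds, dt terms of the other condition force [b2] = 0, so X is vertical. The dx, dy terms then
    make X a multiple of [X0], and the dp, dq terms say that X differentiates [a] and [b] with the
    same factor. *)
Lemma cauchy_vector X :
  (rdot X w1 = 0 /\ rdot X null_covector = 0) /\
  (exists b1 b2, X *m W1 = b1 *: w1 + b2 *: null_covector) /\
  (exists b1 b2, X *m d_null_covector = b1 *: w1 + b2 *: null_covector) <->
  exists nu, X = nu *: X0 /\ nu * (rdot X0 da * b - rdot X0 db * a) = 0.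
Proof.
split.
- case=> [[Xw1 Xeta] [[b1 [b2 E1]] [g1 [g2 E2]]]].
  pose v := X *m J.
  have vE c : (X *m J) 0 c = v 0 c by [].
  rewrite mul_W1 !vE /null_covector /w1 /w2 /w3 in E1.
  have [|k [[Ex Ey Ez Ep Eq] [Er Es Et]]] :=
    @covec_relation (- v 0 cp + b1 * p + b2 * (a * r + b * s))
      (- v 0 cq + b1 * q + b2 * (a * s + b * t)) (- b1)
      (v 0 cx - b2 * a) (v 0 cy - b2 * b) 0 0 0.
    apply/eqP; rewrite -[X in _ == X](subrr (X *m W1)) mul_W1 !vE {2}E1.
    by apply/eqP/rowP => j; rewrite !mxE; ring.
  have k0 : k = 0.
    have [A0|A0] := eqVneq A 0; last by move/esym/eqP: Er; rewrite mulf_eq0 (negPf A0) orbF => /eqP.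
    have B0 : B != 0 by apply/eqP => B0; move: hyp'; rewrite A0 B0; lra.
    by move/esym/eqP: Es; rewrite mulf_eq0 (negPf B0) orbF => /eqP.
  rewrite k0 !mul0r in Ex Ey Ez Ep Eq.
  have b10 : b1 = 0 by lra.
  have vx : v 0 cx = b2 * a by lra.
  have vy : v 0 cy = b2 * b by lra.
  rewrite b10 mul0r addr0 in Ex; rewrite b10 mul0r addr0 in Ey.
  have vp : v 0 cp = b2 * (a * r + b * s) by lra.
  have vq : v 0 cq = b2 * (a * s + b * t) by lra.
  have Xw2 : rdot X w2 = 0.
    by rewrite /w2 !rdotB !rdotZ !rdot_covec !vE vp vx vy; ring.
  have Xw3 : rdot X w3 = 0.
    by rewrite /w3 !rdotB !rdotZ !rdot_covec !vE vq vx vy; ring.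
  rewrite mul_d_null Xw2 Xw3 mul_W2 mul_W3 !vE in E2.
  rewrite !scale0r !subr0 /null_covector in E2.
  have [|k' [[Fx Fy Fz Fp Fq] [Fr Fs Ft]]] :=
    @covec_relation
      (- (a * v 0 cr + b * v 0 cs) - rdot X da * r - rdot X db * s + g1 * p + g2 * (a * r + b * s))
      (- (a * v 0 cs + b * v 0 ct) - rdot X da * s - rdot X db * t + g1 * q + g2 * (a * s + b * t))
      (- g1) (rdot X da - g2 * a) (rdot X db - g2 * b)
      (a * v 0 cx) (a * v 0 cy + b * v 0 cx) (b * v 0 cy).
    move/eqP: E2; rewrite -subr_eq0 => /eqP <-.
    by apply/rowP => j; rewrite /w1 /w2 /w3 !mxE; ring.
  rewrite vx vy in Fr Fs Ft.
  (* The triple k' (A, B, C) equals b2 (a^2, 2 a b, b^2), whose discriminant is zero, while that of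
     (A, B, C) is not. *)
  have k'0 : k' = 0.
    have : k' ^+ 2 * (B ^+ 2 - 4 * (A * C)) = 0.
      transitivity ((k' * B) ^+ 2 - 4 * (k' * A) * (k' * C)); first by ring.
      by rewrite -Fr -Fs -Ft; ring.
    move=> /eqP; rewrite mulf_eq0 expf_eq0 /= => /orP[/eqP //|/eqP H].
    by move: hyp'; lra.
  rewrite k'0 !mul0r in Fx Fy Fz Fp Fq Fr Fs Ft.
  have b20 : b2 = 0.
    case/orP: ab0 => [a0|b0].
      by move/eqP: Fr; rewrite mulf_eq0 (negPf a0) /= mulf_eq0 (negPf a0) orbF => /eqP.
    by move/eqP: Ft; rewrite mulf_eq0 (negPf b0) /= mulf_eq0 (negPf b0) orbF => /eqP.
  rewrite b20 !mul0r in vx vy vp vq.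
  have vz : v 0 cz = 0.
    by move: Xw1; rewrite /w1 !rdotB !rdotZ !rdot_covec !vE vx vy !mulr0 !subr0.
  have g10 : g1 = 0 by lra.
  have dae : rdot X da = g2 * a by lra.
  have dbe : rdot X db = g2 * b by lra.
  have G1 : a * v 0 cr + b * v 0 cs = 0.
    by rewrite -[LHS]opprK -[RHS]oppr0 -Fx g10 dae dbe; ring.
  have G2 : a * v 0 cs + b * v 0 ct = 0.
    by rewrite -[LHS]opprK -[RHS]oppr0 -Fy g10 dae dbe; ring.
  have [nu [nr ns nt]] : exists nu, [/\ v 0 cr = nu * b ^+ 2, v 0 cs = nu * - (a * b)
      & v 0 ct = nu * a ^+ 2].
    exact: ruling_direction ab0 G1 G2.
  have XE : X = nu *: X0.
    have fJ : row_free J by rewrite /row_free rankJ.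
    apply: (row_free_inj fJ); rewrite -scalemxAl X0J -/v.
    by apply/rowP; apply: ord8P; rewrite [RHS]mxE [seq8 _ _ _]mxE /= ?mulr0.
  exists nu; split=> //.
  have rZ w : nu * rdot X0 w = rdot X w.
    rewrite XE /rdot mulr_sumr; apply: eq_bigr => k'' _; by rewrite mxE mulrA.
  by rewrite mulrBr !mulrA !rZ dae dbe; ring.
- case=> nu [XE Hnu].
  have vE c : (X *m J) 0 c = nu * (seq8 [:: 0; 0; 0; 0; 0; b ^+ 2; - (a * b); a ^+ 2]) 0 c.
    by rewrite XE -scalemxAl mxE X0J.
  have vx : (X *m J) 0 cx = 0 by rewrite vE mxE mulr0.
  have vy : (X *m J) 0 cy = 0 by rewrite vE mxE mulr0.
  have vz : (X *m J) 0 cz = 0 by rewrite vE mxE mulr0.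
  have vp : (X *m J) 0 cp = 0 by rewrite vE mxE mulr0.
  have vq : (X *m J) 0 cq = 0 by rewrite vE mxE mulr0.
  have vr : (X *m J) 0 cr = nu * b ^+ 2 by rewrite vE mxE.
  have vs : (X *m J) 0 cs = nu * - (a * b) by rewrite vE mxE.
  have vt : (X *m J) 0 ct = nu * a ^+ 2 by rewrite vE mxE.
  have Xw2 : rdot X w2 = 0.
    by rewrite /w2 !rdotB !rdotZ !rdot_covec vp vx vy; ring.
  have Xw3 : rdot X w3 = 0.
    by rewrite /w3 !rdotB !rdotZ !rdot_covec vq vx vy; ring.
  have rZ w : nu * rdot X0 w = rdot X w.
    rewrite XE /rdot mulr_sumr; apply: eq_bigr => k'' _; by rewrite mxE mulrA.
  split; [split|split].
  + by rewrite /w1 !rdotB !rdotZ !rdot_covec vz vx vy; ring.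
  + by rewrite /null_covector rdotD !rdotZ Xw2 Xw3; ring.
  + exists 0, 0; rewrite mul_W1 vx vy vp vq.
    by apply/rowP => j; rewrite !mxE; ring.
  + rewrite mulrBr !mulrA !rZ in Hnu.
    (* The second coefficient is the common factor by which X differentiates (a, b), read on a
       nonzero component. *)
    exists 0, (if a != 0 then rdot X da / a else rdot X db / b).
    rewrite mul_d_null Xw2 Xw3 mul_W2 mul_W3.
    rewrite vx vy vr vs vt !scale0r !subr0 /null_covector.
    have [a0|a0] := eqVneq a 0 => /=.
      have b0 : b != 0 by move: ab0; rewrite a0 eqxx.
      have E : rdot X da = 0.
        move: Hnu; rewrite a0 mulr0 subr0 => /eqP.
        by rewrite mulf_eq0 (negPf b0) orbF => /eqP.
      by apply/rowP => j; rewrite !mxE a0 E; field.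
    have E : rdot X db = rdot X da * b / a.
      by apply: (mulIf a0); rewrite divfK //; lra.
    by apply/rowP => j; rewrite !mxE E; field.
Qed.

End Cauchy.

End Pointwise.

(** * Exterior derivatives and classes *)

Section Forms.
Variables (R : realType).

Lemma differentiable_fsum n (I : Type) (s : seq I) (f : I -> 'rV[R]_n -> R) u :
  (forall i, differentiable (f i) u) ->
  differentiable (fun v => \sum_(i <- s) f i v) u.
Proof.
move=> df; elim: s => [|i s IH].
  by under eq_fun do rewrite big_nil; exact: differentiable_cst.
by under eq_fun do rewrite big_cons; apply: differentiableD.
Qed.

Lemma differentiable_fprod n (I : Type) (s : seq I) (f : I -> 'rV[R]_n -> R) u :
  (forall i, differentiable (f i) u) ->
  differentiable (fun v => \prod_(i <- s) f i v) u.
Proof.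
move=> df; elim: s => [|i s IH].
  by under eq_fun do rewrite big_nil; exact: differentiable_cst.
by under eq_fun do rewrite big_cons; apply: differentiableM.
Qed.

Lemma partial_sum n (I : Type) (s : seq I) (f : I -> 'rV[R]_n -> R) k u :
  (forall i, differentiable (f i) u) ->
  partial k (fun v => \sum_(i <- s) f i v) u = \sum_(i <- s) partial k (f i) u.
Proof.
move=> df; elim: s => [|i s IH].
  by under eq_fun do rewrite big_nil; rewrite big_nil partial_cst.
under eq_fun do rewrite big_cons.
by rewrite big_cons partialD // ?IH //; exact: differentiable_fsum.
Qed.

Definition diff_mx n k l (M : 'rV[R]_n -> 'M[R]_(k, l)) u :=
  forall i j, differentiable (fun v => M v i j) u.

Lemma diff_mx_cst n k l (A : 'M[R]_(k, l)) (u : 'rV[R]_n) : diff_mx (fun=> A) u.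
Proof. by move=> i j; exact: differentiable_cst. Qed.

Lemma diff_mxM n k l h (M : 'rV[R]_n -> 'M[R]_(k, l)) (N : 'rV[R]_n -> 'M[R]_(l, h)) u :
  diff_mx M u -> diff_mx N u -> diff_mx (fun v => M v *m N v) u.
Proof.
move=> dM dN i j; under eq_fun do rewrite mxE.
by apply: differentiable_fsum => c; apply: differentiableM.
Qed.

Lemma diff_mx_det n k (M : 'rV[R]_n -> 'M[R]_k) u :
  diff_mx M u -> differentiable (fun v => \det (M v)) u.
Proof.
move=> dM; rewrite /determinant; apply: differentiable_fsum => s.
by apply: differentiableM => //; apply: differentiable_fprod => i; exact: dM.
Qed.

Lemma diff_mx_adj n k (M : 'rV[R]_n -> 'M[R]_k) u :
  diff_mx M u -> diff_mx (fun v => \adj (M v)) u.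
Proof.
move=> dM i j; under eq_fun do rewrite mxE.
rewrite /cofactor; apply: differentiableM => //.
by apply: diff_mx_det => a b; under eq_fun do rewrite !mxE; exact: dM.
Qed.

Lemma diff_mx_row n k l (M : 'rV[R]_n -> 'M[R]_(k, l)) u i :
  diff_mx M u -> diff_mx (fun v => row i (M v)) u.
Proof. by move=> dM a b; under eq_fun do rewrite mxE; exact: dM. Qed.

Lemma near_neq0 n (f : 'rV[R]_n -> R) u : differentiable f u -> f u != 0 ->
  \forall v \near u, f v != 0.
Proof.
move=> df fu0; have cf := differentiable_continuous df.
have [lt|gt|E] := ltgtP (f u) 0; last by rewrite E eqxx in fu0.
  have : \forall v \near u, f v < 0 by exact: cvgr_lt cf _ lt.
  by apply: filterS => v fv; rewrite lt_eqF.
have : \forall v \near u, 0 < f v by exact: cvgr_gt cf _ gt.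
by apply: filterS => v fv; rewrite gt_eqF.
Qed.

(* Cramer's rule gives the coefficients, after multiplying by a fixed right inverse of [N u]. *)
Lemma differentiable_coefficients n k l h (M : 'rV[R]_n -> 'M[R]_(k, h))
    (N : 'rV[R]_n -> 'M[R]_(l, h)) u :
  diff_mx M u -> diff_mx N u -> row_free (N u) ->
  (\forall v \near u, (M v <= N v)%MS) ->
  exists2 T : 'rV[R]_n -> 'M[R]_(k, l), diff_mx T u &
    \forall v \near u, M v = T v *m N v.
Proof.
move=> dM dN fN sMN.
pose P := pinvmx (N u); pose Q v := N v *m P.
have dQ : diff_mx Q u by apply: diff_mxM => //; exact: diff_mx_cst.
have Qu : \det (Q u) != 0 by rewrite /Q mulmxVp // det1 oner_neq0.
have ddet := diff_mx_det dQ.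
exists (fun v => (\det (Q v))^-1 *: (M v *m P *m \adj (Q v))).
  move=> i j; under eq_fun do rewrite mxE.
  apply: differentiableM; first exact: differentiableV.
  apply: diff_mxM; last exact: diff_mx_adj.
  by apply: diff_mxM => //; exact: diff_mx_cst.
apply: filterS2 sMN (near_neq0 ddet Qu) => v /submxP [X ->] Qv.
rewrite -(mulmxA X) -/(Q v) -(mulmxA X) mul_mx_adj mul_mx_scalar scalerA mulVf //.
by rewrite scale1r.
Qed.

Lemma ext_deriv_near_eq n (w w' : 'rV[R]_n -> 'rV[R]_n) u :
  (\forall v \near u, w v = w' v) -> ext_deriv w u = ext_deriv w' u.
Proof.
move=> E; apply/matrixP => j k; rewrite !mxE; congr (_ - _);
  by apply: partial_near_eq; apply: filterS E => v ->.
Qed.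

Lemma ext_deriv_comb n k (f : 'I_k -> 'rV[R]_n -> R) (w : 'I_k -> 'rV[R]_n -> 'rV[R]_n) u :
  (forall c, differentiable (f c) u) -> (forall c, diff_mx (w c) u) ->
  ext_deriv (fun v => \sum_c f c v *: w c v) u =
  \sum_c (wedge (grad (f c) u) (w c u) + f c u *: ext_deriv (w c) u).
Proof.
move=> df dw; apply/matrixP => i j; rewrite mxE summxE.
have E l v : (\sum_c f c v *: w c v) 0 l = \sum_c f c v * w c v 0 l.
  by rewrite summxE; apply: eq_bigr => c _; rewrite mxE.
under [in X in X - _ = _]eq_fun do rewrite E.
under [in X in _ - X = _]eq_fun do rewrite E.
have dfw c l : differentiable (fun v => f c v * w c v 0 l) u.
  by apply: differentiableM => //; exact: dw.
rewrite !partial_sum // -sumrB; apply: eq_bigr => c _.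
rewrite !partialM //; try exact: dw.
by rewrite [RHS]mxE wedgeE !mxE; ring.
Qed.

Lemma ext_deriv_grad n (U : set 'rV[R]_n) g u : open U -> smooth_on U g -> U u ->
  ext_deriv (grad g) u = 0.
Proof.
move=> oU sg Uu; apply/matrixP => i j; rewrite !mxE.
under [in X in X - _ = _]eq_fun do rewrite mxE.
under [in X in _ - X = _]eq_fun do rewrite mxE.
by rewrite (schwarz _ _ oU sg Uu) subrr.
Qed.

Lemma sub_cauchy_space n k (M : 'rV[R]_n -> 'M[R]_(k, n)) u (X : 'rV[R]_n) :
  (X <= cauchy_space M u)%MS <->
  X *m (M u)^T = 0 /\ forall a, (X *m ext_deriv (generator M a) u <= M u)%MS.
Proof.
rewrite /cauchy_space sub_capmx; split.
- move=> /andP[/sub_kermxP XM /sub_bigcapmxP XW]; split=> // a.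
  by have /sub_kermxP := XW a isT; rewrite mulmxA submxE => ->.
- move=> [XM XW]; apply/andP; split; first exact/sub_kermxP.
  apply/sub_bigcapmxP => a _; apply/sub_kermxP.
  by have := XW a; rewrite submxE => /eqP <-; rewrite mulmxA.
Qed.

(** With M = T N, each dM is a combination of terms dT /\ N and T dN. A vector that annihilates N
    turns the first kind into elements of N. The argument differentiates T, hence the need for
    [differentiable_coefficients]. *)
Lemma cauchy_space_sub n k l (M : 'rV[R]_n -> 'M[R]_(k, n)) (N : 'rV[R]_n -> 'M[R]_(l, n)) u :
  diff_mx M u -> diff_mx N u -> row_free (N u) ->
  (\forall v \near u, (M v <= N v)%MS) -> (N u <= M u)%MS ->
  (cauchy_space N u <= cauchy_space M u)%MS.
Proof.
move=> dM dN fN MN NM; apply/row_subP => i.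
set X := row i _; have : (X <= cauchy_space N u)%MS by exact: row_sub.
move: X => X /sub_cauchy_space [XN XW]; apply/sub_cauchy_space.
have [T dT MT] := differentiable_coefficients dM dN fN MN.
have MTu := nbhs_singleton MT.
split; first by rewrite MTu trmx_mul mulmxA XN mul0mx.
move=> a; apply: submx_trans NM.
have -> : ext_deriv (generator M a) u =
    ext_deriv (fun v => \sum_c T v a c *: generator N c v) u.
  apply: ext_deriv_near_eq; apply: filterS MT => v Mv.
  by rewrite /generator Mv row_mul mulmx_sum_row; apply: eq_bigr => c _; rewrite mxE.
rewrite ext_deriv_comb; last 2 first.
- by move=> c; exact: dT.
- by move=> c; exact: diff_mx_row.
rewrite mulmx_sumr; apply: summx_sub => c _.
rewrite mulmxDr mul_wedge -scalemxAr.
rewrite (_ : rdot X (generator N c u) = 0) ?scale0r ?subr0.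
  by rewrite addmx_sub // scalemx_sub // row_sub.
by rewrite -mulmx_tr_rdot XN mxE.
Qed.

Lemma class_atE n k (M : 'rV[R]_n -> 'M[R]_(k, n)) u :
  class_at M u = (n - \rank (cauchy_space M u))%N.
Proof. by rewrite /class_at mxrank_ker mxrank_tr. Qed.

Lemma class_at_eqmx n k l (M : 'rV[R]_n -> 'M[R]_(k, n)) (N : 'rV[R]_n -> 'M[R]_(l, n)) u :
  diff_mx M u -> diff_mx N u -> row_free (M u) -> row_free (N u) ->
  (\forall v \near u, (M v == N v)%MS) -> class_at M u = class_at N u.
Proof.
move=> dM dN fM fN MN; rewrite !class_atE.
have /andP[MNu NMu] := nbhs_singleton MN.
congr (_ - _)%N; apply/eqP; rewrite eqn_leq; apply/andP; split; apply: mxrankS;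
  apply: cauchy_space_sub => //; apply: filterS MN => v /andP[] //.
Qed.

End Forms.

(** * Null systems of a hyperbolic equation *)

(** Primes are derivatives along X, and (P, Q) is the gradient in (a, b) of the null quadratic form.
    The first equation says that H = - (a' P + b' Q), and Euler's relation a P + b Q = 0 gives a H =
    Q r and b H = - P r. Since the discriminant is nonzero, (P, Q) is nonzero, so H and r vanish
    together. *)
Lemma rotation_of_null_equation (R : realType) (A B C a b A' B' C' a' b' H : R) :
  C' * (a * a) + C * (a' * a + a * a') - (B' * (a * b) + B * (a' * b + a * b'))
    + (A' * (b * b) + A * (b' * b + b * b')) = 0 ->
  H = b ^+ 2 * A' - a * b * B' + a ^+ 2 * C' ->
  2 * C * (a * a) - B * (a * b + a * b) + 2 * A * (b * b) = 0 ->
  4 * (A * C) < B ^+ 2 -> (a != 0) || (b != 0) ->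
  H = 0 <-> a' * b - b' * a = 0.
Proof.
move=> E1 HE nu disc ab; set r := a' * b - b' * a.
pose P := 2 * C * a - B * b; pose Q := 2 * A * b - B * a.
have H1 : H = - (a' * P + b' * Q).
  by rewrite HE -[LHS]subr0 -E1 /P /Q; ring.
have PQ : a * P + b * Q = 0 by rewrite -nu /P /Q; ring.
have aH : a * H = Q * r.
  by rewrite H1 /r -[LHS]addr0 -[X in _ + X](mulr0 a') -PQ; ring.
have bH : b * H = - (P * r).
  by rewrite H1 /r -[LHS]addr0 -[X in _ + X](mulr0 b') -PQ; ring.
have D0 : B ^+ 2 - 4 * (A * C) != 0 by rewrite subr_eq0 gt_eqF.
split=> [H0|r0].
- rewrite H0 mulr0 in aH; rewrite H0 mulr0 in bH.
  apply/eqP; apply/negP => /negP r0.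
  have Q0 : Q = 0 by move/esym/eqP: aH; rewrite mulf_eq0 (negPf r0) orbF => /eqP.
  have P0 : P = 0 by move/esym/eqP: bH; rewrite oppr_eq0 mulf_eq0 (negPf r0) orbF => /eqP.
  have a0 : (B ^+ 2 - 4 * (A * C)) * a = 0.
    by transitivity (- (2 * A * P + B * Q)); [rewrite /P /Q; ring|rewrite P0 Q0; ring].
  have b0 : (B ^+ 2 - 4 * (A * C)) * b = 0.
    by transitivity (- (2 * C * Q + B * P)); [rewrite /P /Q; ring|rewrite P0 Q0; ring].
  move/eqP: a0; move/eqP: b0; rewrite !mulf_eq0 (negPf D0) /= => b0 a0.
  by move: ab; rewrite a0 b0.
- rewrite r0 mulr0 in aH; rewrite r0 mulr0 oppr0 in bH.
  case/orP: ab => n0.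
    by move/eqP: aH; rewrite mulf_eq0 (negPf n0) => /eqP.
  by move/eqP: bH; rewrite mulf_eq0 (negPf n0) => /eqP.
Qed.

Lemma null_form_eq0 (R : realType) (d : 'rV[R]_8) a b : null_form d a b a b = 0 <->
  d 0 ct * (a * a) - d 0 cs * (a * b) + d 0 cr * (b * b) = 0.
Proof.
have -> : null_form d a b a b =
    2 * (d 0 ct * (a * a) - d 0 cs * (a * b) + d 0 cr * (b * b)).
  by rewrite /null_form; ring.
split=> [/eqP|->]; last by rewrite mulr0.
by rewrite mulf_eq0 pnatr_eq0 /= => /eqP.
Qed.

Lemma gradE (R : realType) n (f : 'rV[R]_n -> R) u k : grad f u 0 k = partial k f u.
Proof. exact: mxE. Qed.

Lemma rdot_grad_null (R : realType) n (X u : 'rV[R]_n) (A B C a b : 'rV[R]_n -> R) :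
  differentiable A u -> differentiable B u -> differentiable C u ->
  differentiable a u -> differentiable b u ->
  (\forall v \near u, C v * (a v * a v) - B v * (a v * b v) + A v * (b v * b v) = 0) ->
  let d f := rdot X (grad f u) in
  d C * (a u * a u) + C u * (d a * a u + a u * d a)
  - (d B * (a u * b u) + B u * (d a * b u + a u * d b))
  + (d A * (b u * b u) + A u * (d b * b u + b u * d b)) = 0.
Proof.
move=> dA dB dC da db n0 d.
pose Phi v := C v * (a v * a v) - B v * (a v * b v) + A v * (b v * b v).
have dPhi : d Phi = 0.
  rewrite /d (_ : grad Phi u = 0).
    by rewrite /rdot big1 // => k _; rewrite mxE mulr0.
  apply/rowP => k; rewrite !mxE -(@partial_cst R _ 0 k u).
  by apply: partial_near_eq; apply: filterS n0 => v.
have gD (f g : 'rV[R]_n -> R) : differentiable f u -> differentiable g u ->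
    d (fun v => f v + g v) = d f + d g.
  move=> df dg; rewrite /d /rdot -big_split; apply: eq_bigr => k _ /=.
  by rewrite !mxE partialD // mulrDr.
have gB (f g : 'rV[R]_n -> R) : differentiable f u -> differentiable g u ->
    d (fun v => f v - g v) = d f - d g.
  move=> df dg; rewrite /d /rdot -sumrB; apply: eq_bigr => k _ /=.
  by rewrite !mxE partialB // mulrBr.
have gM (f g : 'rV[R]_n -> R) : differentiable f u -> differentiable g u ->
    d (fun v => f v * g v) = d f * g u + f u * d g.
  move=> df dg; rewrite /d /rdot mulr_suml mulr_sumr -big_split; apply: eq_bigr => k _ /=.
  by rewrite !mxE partialM //; ring.
have daa : differentiable (fun v => a v * a v) u by exact: differentiableM.
have dab : differentiable (fun v => a v * b v) u by exact: differentiableM.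
have dbb : differentiable (fun v => b v * b v) u by exact: differentiableM.
have d1 : differentiable (fun v => C v * (a v * a v)) u by exact: differentiableM.
have d2 : differentiable (fun v => B v * (a v * b v)) u by exact: differentiableM.
have d3 : differentiable (fun v => A v * (b v * b v)) u by exact: differentiableM.
have d12 : differentiable (fun v => C v * (a v * a v) - B v * (a v * b v)) u.
  exact: differentiableB.
rewrite -dPhi /Phi (gD _ _ d12 d3) (gB _ _ d1 d2).
rewrite (gM _ _ dC daa) (gM _ _ dB dab) (gM _ _ dA dbb).
by rewrite (gM _ _ da da) (gM _ _ da db) (gM _ _ db db).
Qed.

Section Parametrization.
Variables (R : realType) (D : set 'rV[R]_8) (F : 'rV[R]_8 -> R).
Variables (S : set 'rV[R]_7) (iF : 'rV[R]_7 -> 'rV[R]_8).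
Hypotheses (oD : open D) (sF : smooth_on D F) (oS : open S).
Hypothesis siF : forall c, smooth_on S (fun u => iF u 0 c).
Hypothesis rank_iF : forall u, S u -> \rank (jacobian iF u) = 7.
Hypothesis iFD : forall u, S u -> D (iF u) /\ F (iF u) = 0.
Hypothesis hypF : hyperbolic F S iF.

Local Notation I := (contact_system iF).
Local Notation J u := (jacobian iF u).
Local Notation dF u := (grad F (iF u)).
Local Notation i2 := (@Ordinal 3 2 isT).

Let nS u : S u -> \forall v \near u, S v.
Proof. by move=> Su; exact: open_nbhs_nbhs. Qed.

Let diF u c : S u -> differentiable (fun v => iF v 0 c) u.
Proof. by move=> Su; exact: smooth_on_differentiable (siF c) Su. Qed.

Let dFd u : S u -> differentiable F (iF u).
Proof. by move=> /iFD [Du _]; exact: smooth_on_differentiable sF Du. Qed.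

Lemma jacobian_dF u : S u -> J u *m (dF u)^T = 0.
Proof.
move=> Su; apply/colP => i; rewrite mxE [RHS]mxE.
transitivity (partial i (fun v => F (iF v)) u).
  rewrite partial_comp; last 2 first.
  - by move=> j; exact: diF.
  - exact: dFd.
  by apply: eq_bigr => c _; rewrite jacobianE ?mxE // => j; exact: diF.
rewrite -[RHS](@partial_cst R _ 0 i u); apply: partial_near_eq.
by apply: filterS (nS Su) => v /iFD [].
Qed.

Lemma hyperbolic_grad u : S u ->
  dF u 0 cr * dF u 0 ct - 4^-1 * dF u 0 cs ^+ 2 < 0.
Proof. by move=> Su; rewrite !mxE; exact: hypF. Qed.

Lemma hyperbolic_disc u : S u -> 4 * (dF u 0 cr * dF u 0 ct) < dF u 0 cs ^+ 2.
Proof. by move=> /hyperbolic_grad; lra. Qed.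

Lemma covec_grad u c : S u -> covec (J u) c = grad (fun v => iF v 0 c) u.
Proof.
move=> Su; apply/rowP => k; rewrite [RHS]mxE [LHS]mxE [LHS]mxE jacobianE // => j.
exact: diF.
Qed.

Lemma contact_smooth a b : smooth_on S (fun u => I u a b).
Proof.
have sm c : smooth_on S (fun u => covec (J u) c 0 b).
  apply: (@smooth_on_eq _ _ _ (partial b (fun v => iF v 0 c))) => //.
    by move=> u Su; rewrite covec_grad // mxE.
  exact: smooth_on_partial.
have sw c1 c2 c3 k1 k2 : smooth_on S (fun u => covec (J u) c1 0 b
   - iF u 0 k1 * covec (J u) c2 0 b - iF u 0 k2 * covec (J u) c3 0 b).
  by apply: smooth_onB => //; [apply: smooth_onB => //|]; exact: smooth_onM.
have E u k : I u k b = row k (I u) 0 b by rewrite [RHS]mxE.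
case: a => -[|[|[|]]] //= a3.
- apply: (@smooth_on_eq _ _ _ _ _ oS _ (sw cz cx cy cp cq)) => u Su.
  rewrite E (_ : Ordinal a3 = 0); last exact: val_inj.
  by have [-> _ _] := contact_rowE (J u) (iF u); rewrite !mxE.
- apply: (@smooth_on_eq _ _ _ _ _ oS _ (sw cp cx cy cr cs)) => u Su.
  rewrite E (_ : Ordinal a3 = 1); last exact: val_inj.
  by have [_ -> _] := contact_rowE (J u) (iF u); rewrite !mxE.
- apply: (@smooth_on_eq _ _ _ _ _ oS _ (sw cq cx cy cs ct)) => u Su.
  rewrite E (_ : Ordinal a3 = i2); last exact: val_inj.
  by have [_ _ ->] := contact_rowE (J u) (iF u); rewrite !mxE.
Qed.

Lemma contact_diff u : S u -> diff_mx I u.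
Proof. by move=> Su a b; exact: smooth_on_differentiable (contact_smooth a b) Su. Qed.

Lemma contact_free u : S u -> row_free (I u).
Proof.
by move=> Su; exact: contact_row_free (rank_iF Su) (jacobian_dF Su) (hyperbolic_grad Su).
Qed.

Let sum3 (V : nmodType) (f : 'I_3 -> V) : \sum_i f i = f 0 + f 1 + f i2.
Proof.
rewrite !big_ord_recl big_ord0 addr0 addrA.
by do 2!(congr (_ + _); last by congr f; exact: val_inj).
Qed.

Let ext_deriv3 g0 g1 g2 f1 f2 u : S u ->
  smooth_on S g0 -> smooth_on S g1 -> smooth_on S g2 ->
  smooth_on S f1 -> smooth_on S f2 ->
  ext_deriv (fun v => grad g0 v - f1 v *: grad g1 v - f2 v *: grad g2 v) u =
  wedge (grad g1 u) (grad f1 u) + wedge (grad g2 u) (grad f2 u).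
Proof.
move=> Su s0 s1 s2 t1 t2.
pose f (c : 'I_3) := nth (fun=> 0) [:: fun=> 1; fun v => - f1 v; fun v => - f2 v] c.
pose g (c : 'I_3) := nth (fun=> 0) [:: g0; g1; g2] c.
have sg c : smooth_on S (g c) by case: c => -[|[|[|]]].
have sf c : smooth_on S (f c).
  case: c => -[|[|[|]]] //= ?; rewrite /f /=; first exact: smooth_on_cst.
    exact: smooth_onN.
  exact: smooth_onN.
transitivity (ext_deriv (fun v => \sum_c f c v *: grad (g c) v) u).
  congr (ext_deriv _ u); apply/funext => v.
  by rewrite sum3 /f /g /= scale1r !scaleNr.
rewrite ext_deriv_comb; last 2 first.
- by move=> c; exact: smooth_on_differentiable Su.
- move=> c i j; under eq_fun do rewrite mxE.
  by apply: smooth_on_differentiable Su; exact: smooth_on_partial.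
rewrite (eq_bigr (fun c => wedge (grad (f c) u) (grad (g c) u))); last first.
  by move=> c _; rewrite (ext_deriv_grad oS (sg c) Su) scaler0 addr0.
rewrite sum3 /f /g /=.
have gN h : smooth_on S h -> grad (fun v => - h v) u = - grad h u.
  move=> sh; apply/rowP => k; rewrite !mxE; apply: deriveN; apply: diff_derivable.
  exact: smooth_on_differentiable Su.
have gc : grad (fun=> 1) u = 0 by apply/rowP => k; rewrite !mxE partial_cst.
rewrite !gN // gc.
move: (grad g0 u) (grad g1 u) (grad g2 u) (grad f1 u) (grad f2 u) => h0 h1 h2 k1 k2.
apply/matrixP => i j; rewrite [LHS]mxE [X in X + _]mxE [RHS]mxE !wedgeE !mxE; ring.
Qed.

Definition d_contact (u : 'rV[R]_7) (i : 'I_3) : 'M[R]_7 :=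
  nth 0 [:: W1 (J u); W2 (J u); W3 (J u)] i.

Lemma ext_deriv_contact u i : S u -> ext_deriv (generator I i) u = d_contact u i.
Proof.
move=> Su.
have E c0 c1 c2 k1 k2 : (forall v, row i (I v) =
     covec (J v) c0 - iF v 0 k1 *: covec (J v) c1 - iF v 0 k2 *: covec (J v) c2) ->
   ext_deriv (generator I i) u =
   wedge (covec (J u) c1) (covec (J u) k1) + wedge (covec (J u) c2) (covec (J u) k2).
  move=> H; rewrite !covec_grad //.
  transitivity (ext_deriv (fun v => grad (fun v => iF v 0 c0) v -
     iF v 0 k1 *: grad (fun v => iF v 0 c1) v - iF v 0 k2 *: grad (fun v => iF v 0 c2) v) u).
    apply: ext_deriv_near_eq; apply: filterS (nS Su) => v Sv.
    by rewrite /generator H !covec_grad.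
  exact: ext_deriv3.
rewrite /d_contact; case: i E => -[|[|[|]]] //= i3 E.
- apply: (E cz cx cy cp cq) => v; rewrite (_ : Ordinal i3 = 0); last exact: val_inj.
  by have [-> _ _] := contact_rowE (J v) (iF v).
- apply: (E cp cx cy cr cs) => v; rewrite (_ : Ordinal i3 = 1); last exact: val_inj.
  by have [_ -> _] := contact_rowE (J v) (iF v).
- apply: (E cq cx cy cs ct) => v; rewrite (_ : Ordinal i3 = i2); last exact: val_inj.
  by have [_ _ ->] := contact_rowE (J v) (iF v).
Qed.

Lemma ext_deriv_coef (x : 'I_3 -> 'rV[R]_7 -> R) u : S u ->
  (forall i, differentiable (x i) u) ->
  ext_deriv (fun v => \sum_i x i v *: generator I i v) u =
  dcomb (J u) (iF u) (fun i => x i u) (fun i => grad (x i) u).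
Proof.
move=> Su dx; rewrite ext_deriv_comb //; last first.
  by move=> c; apply: diff_mx_row; exact: contact_diff.
rewrite /dcomb big_split /=; congr (_ + _).
by rewrite sum3 !ext_deriv_contact.
Qed.

(** The pairing ignores the differentials of the coefficients, so on any subsystem of the contact
    system it is read off from the values of the coefficients on w2 and w3. *)
Lemma pairing_coef k (M : 'rV[R]_7 -> 'M[R]_(k, 7)) u : S u -> diff_mx M u ->
  (\forall v \near u, (M v <= I v)%MS) ->
  exists T : 'M[R]_(k, 3), M u = T *m I u /\ exists2 c, c != 0 & forall a b,
    pairing7 I (generator M a) (generator M b) u =
    c * null_form (dF u) (T a 1) (T a i2) (T b 1) (T b i2).
Proof.
move=> Su dM MI.
have [T dT MT] := differentiable_coefficients dM (contact_diff Su) (contact_free Su) MI.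
exists (T u); split; first exact: nbhs_singleton MT.
have [c c0 Hc] := pairing_value (iF u) (rank_iF Su) (jacobian_dF Su) (hyperbolic_grad Su).
exists c => // a b; rewrite pairing7E.
have E a' : ext_deriv (generator M a') u =
    dcomb (J u) (iF u) (fun i => T u a' i) (fun i => grad (fun v => T v a' i) u).
  rewrite -ext_deriv_coef //.
  apply: ext_deriv_near_eq; apply: filterS MT => v Mv.
  by rewrite /generator Mv row_mul mulmx_sum_row; apply: eq_bigr => i _; rewrite mxE.
by rewrite !E; exact: Hc.
Qed.

(** Gram determinant of a binary quadratic form. As the discriminant is nonzero, two null pairs that
    are orthogonal to each other must be proportional. *)
Lemma null_form_gram (d : 'rV[R]_8) a b a' b' :
  null_form d a b a b * null_form d a' b' a' b' - null_form d a b a' b' ^+ 2 =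
  (4 * (d 0 cr * d 0 ct) - d 0 cs ^+ 2) * (a * b' - a' * b) ^+ 2.
Proof. by rewrite /null_form; ring. Qed.

(** The coefficients are functions, since the class differentiates them; constant ones serve to
    compare spans at one point. *)
Definition null_system (a b : 'rV[R]_7 -> R) (u : 'rV[R]_7) : 'M[R]_(2, 7) :=
  \matrix_(i < 2) (if i == 0 then row 0 (I u) else a u *: row 1 (I u) + b u *: row i2 (I u)).

Let ord2 (i : 'I_2) : i = 0 \/ i = 1.
Proof. by case: i => -[|[|]] // i2'; [left|right]; exact: val_inj. Qed.

Lemma null_systemE a b v i j :
  null_system a b v i j = if i == 0 then I v 0 j else a v * I v 1 j + b v * I v i2 j.
Proof. by rewrite mxE; case: eqP => _; rewrite !mxE. Qed.

Lemma null_system0 a b u : row 0 (null_system a b u) = row 0 (I u).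
Proof. by rewrite rowK. Qed.

Lemma null_system1 a b u :
  row 1 (null_system a b u) = a u *: row 1 (I u) + b u *: row i2 (I u).
Proof. by rewrite rowK. Qed.

Lemma sub_null_system a b u (Y : 'rV[R]_7) : (Y <= null_system a b u)%MS <->
  exists b1 b2, Y = b1 *: row 0 (I u) + b2 *: (a u *: row 1 (I u) + b u *: row i2 (I u)).
Proof.
split.
- move=> /submxP [X ->]; exists (X 0 0), (X 0 1).
  rewrite mulmx_sum_row !big_ord_recl big_ord0 addr0 null_system0.
  by rewrite (_ : lift ord0 ord0 = 1) ?null_system1 //; exact: val_inj.
- move=> [b1 [b2 ->]]; rewrite -(null_system0 a b) -null_system1.
  by rewrite addmx_sub // scalemx_sub // row_sub.
Qed.

Lemma null_system_sub a b u : (null_system a b u <= I u)%MS.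
Proof.
apply/row_subP => i; case: (ord2 i) => ->.
  by rewrite null_system0 row_sub.
by rewrite null_system1 addmx_sub // scalemx_sub // row_sub.
Qed.

Lemma null_system_free a b u : S u -> (a u != 0) || (b u != 0) ->
  row_free (null_system a b u).
Proof.
move=> Su ab; rewrite -kermx_eq0; apply/rowV0P => y /sub_kermxP.
rewrite mulmx_sum_row !big_ord_recl big_ord0 addr0 null_system0.
rewrite (_ : lift ord0 ord0 = 1); last exact: val_inj.
rewrite null_system1 => E.
pose w : 'rV[R]_3 := \row_i nth 0 [:: y 0 0; y 0 1 * a u; y 0 1 * b u] i.
have w0 : w = 0.
  apply: (row_free_inj (contact_free Su)); rewrite mul0mx mulmx_sum_row sum3 !mxE /=.
  by rewrite -[RHS]E scalerDr !scalerA addrA.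
have y0 : y 0 0 = 0 by have := congr1 (fun w : 'rV_3 => w 0 0) w0; rewrite !mxE.
have ya : y 0 1 * a u = 0 by have := congr1 (fun w : 'rV_3 => w 0 1) w0; rewrite !mxE.
have yb : y 0 1 * b u = 0 by have := congr1 (fun w : 'rV_3 => w 0 i2) w0; rewrite !mxE.
apply/rowP => i; rewrite mxE; case: (ord2 i) => -> //.
case/orP: ab => n0.
  by move/eqP: ya; rewrite mulf_eq0 (negPf n0) orbF => /eqP.
by move/eqP: yb; rewrite mulf_eq0 (negPf n0) orbF => /eqP.
Qed.

Lemma null_system_diff a b u : S u -> differentiable a u -> differentiable b u ->
  diff_mx (null_system a b) u.
Proof.
move=> Su da db i j; have dI := contact_diff Su.
under eq_fun do rewrite null_systemE.
by case: eqP => _ //; apply: differentiableD; exact: differentiableM.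
Qed.

Definition hess (G : 'rV[R]_8 -> R) m (V : 'rV[R]_8) : R :=
  \sum_c \sum_d V 0 c * V 0 d * partial c (partial d G) m.

Definition null_vector (a b : R) : 'rV[R]_8 :=
  seq8 [:: 0; 0; 0; 0; 0; b ^+ 2; - (a * b); a ^+ 2].

Definition null_at u (a b : R) := null_form (dF u) a b a b = 0 /\ (a != 0) || (b != 0).

(** Scaling (a, b) by k scales the Hessian by k^4, so the value depends only on the direction. *)
Definition class_value u (a b : R) : nat :=
  if hess F (iF u) (null_vector a b) == 0 then 6 else 7.

Lemma null_vector_lift u a b : S u -> null_at u a b ->
  exists X, X *m J u = null_vector a b.
Proof.
move=> Su [n0 _].
apply: (tangent_lift (rank_iF Su) (jacobian_dF Su) (hyperbolic_grad Su)).
apply/rowP => k; rewrite (ord1 k) mxE sum8.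
transitivity (2^-1 * null_form (dF u) a b a b); last by rewrite n0 mulr0 mxE.
rewrite /null_form ![(null_vector _ _) _ _]mxE /= ![_^T _ _]mxE.
by field.
Qed.

(* Differentiating the null equation along [X] expresses the second fibre derivative of [F]
   through the rotation of the null direction. *)
Lemma hess_null_vector a b u X : S u -> differentiable a u -> differentiable b u ->
  (\forall v \near u, null_form (dF v) (a v) (b v) (a v) (b v) = 0) ->
  (a u != 0) || (b u != 0) ->
  X *m J u = null_vector (a u) (b u) ->
  hess F (iF u) (null_vector (a u) (b u)) = 0 <->
  rdot X (grad a u) * b u - rdot X (grad b u) * a u = 0.
Proof.
move=> Su da db n0 ab XJ.
have [Du _] := iFD Su.
have dfF c : differentiable (fun v => partial c F (iF v)) u.
  apply: differentiable_comp; first by apply: differentiable_rV => j; exact: diF.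
  by apply: smooth_on_differentiable Du; exact: smooth_on_partial.
have gF c : rdot X (grad (fun v => partial c F (iF v)) u) =
    \sum_d (null_vector (a u) (b u)) 0 d * partial d (partial c F) (iF u).
  rewrite -XJ /rdot.
  transitivity (\sum_k \sum_d X 0 k * (J u k d * partial d (partial c F) (iF u))).
    apply: eq_bigr => k _; rewrite mxE partial_comp; last 2 first.
    - by move=> j; exact: diF.
    - by apply: smooth_on_differentiable Du; exact: smooth_on_partial.
    rewrite mulr_sumr; apply: eq_bigr => d _; rewrite jacobianE // => j; exact: diF.
  rewrite exchange_big /=; apply: eq_bigr => d _; rewrite mxE mulr_suml.
  by apply: eq_bigr => k _; rewrite mulrA.
set V := null_vector _ _ in gF *.
have V0 c : V 0 c = nth 0 [:: 0; 0; 0; 0; 0; b u ^+ 2; - (a u * b u); a u ^+ 2] c.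
  by rewrite mxE.
have [G GE] : exists G : 'I_8 -> R, forall c,
    rdot X (grad (fun v => partial c F (iF v)) u) = G c by eexists.
have HE : hess F (iF u) V = b u ^+ 2 * G cr - a u * b u * G cs + a u ^+ 2 * G ct.
  transitivity (\sum_c V 0 c * G c).
    rewrite /hess exchange_big /=; apply: eq_bigr => c _; rewrite -GE gF mulr_sumr.
    by apply: eq_bigr => d _; rewrite mulrA [V 0 d * _]mulrC.
  rewrite sum8 !V0 /= !mul0r !add0r; by rewrite mulNr.
have n0' : \forall v \near u, partial ct F (iF v) * (a v * a v)
    - partial cs F (iF v) * (a v * b v) + partial cr F (iF v) * (b v * b v) = 0.
  by apply: filterS n0 => v /null_form_eq0; rewrite !gradE.
have K0 : G ct * (a u * a u)
    + partial ct F (iF u) * (rdot X (grad a u) * a u + a u * rdot X (grad a u))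
    - (G cs * (a u * b u)
       + partial cs F (iF u) * (rdot X (grad a u) * b u + a u * rdot X (grad b u)))
    + (G cr * (b u * b u)
       + partial cr F (iF u) * (rdot X (grad b u) * b u + b u * rdot X (grad b u))) = 0.
  by rewrite -!GE; exact: (rdot_grad_null X (dfF cr) (dfF cs) (dfF ct) da db n0').
have nu := nbhs_singleton n0; rewrite /null_form !gradE in nu.
have disc := hyperbolic_disc Su; rewrite !gradE in disc.
exact: rotation_of_null_equation K0 HE nu disc ab.
Qed.


Let row_contact u : [/\ row 0 (I u) = covec (J u) cz - iF u 0 cp *: covec (J u) cx - iF u 0 cq *: covec (J u) cy,
  row 1 (I u) = covec (J u) cp - iF u 0 cr *: covec (J u) cx - iF u 0 cs *: covec (J u) cy
  & row i2 (I u) = covec (J u) cq - iF u 0 cs *: covec (J u) cx - iF u 0 ct *: covec (J u) cy].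
Proof. exact: contact_rowE. Qed.

Let null_covectorE u a b :
  null_covector (J u) (iF u) a b = a *: row 1 (I u) + b *: row i2 (I u).
Proof. by have [_ -> ->] := row_contact u. Qed.

Lemma ext_deriv_null0 a b u : S u ->
  ext_deriv (generator (null_system a b) 0) u = W1 (J u).
Proof.
move=> Su; rewrite -[RHS]/(d_contact u 0) -ext_deriv_contact //.
by congr (ext_deriv _ u); apply/funext => v; exact: null_system0.
Qed.

Lemma ext_deriv_null1 a b u : S u -> differentiable a u -> differentiable b u ->
  ext_deriv (generator (null_system a b) 1) u =
  d_null_covector (J u) (iF u) (a u) (b u) (grad a u) (grad b u).
Proof.
move=> Su da db.
pose x (i : 'I_3) := nth (fun=> 0) [:: fun=> 0; a; b] i.
have dx i : differentiable (x i) u.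
  by case: i => -[|[|[|]]] //= ?; exact: differentiable_cst.
transitivity (ext_deriv (fun v => \sum_i x i v *: generator I i v) u).
  congr (ext_deriv _ u); apply/funext => v.
  rewrite sum3 /x /= scale0r add0r; exact: null_system1.
rewrite ext_deriv_coef // /dcomb /d_null_covector sum3 /x /=.
have [_ -> ->] := row_contact u.
have -> : grad (fun=> 0) u = 0 by apply/rowP => k; rewrite gradE partial_cst mxE.
have w0 v : wedge 0 v = 0 :> 'M[R]_7.
  by rewrite /wedge trmx0 mul0mx mulmx0 subrr.
by rewrite w0 add0r scale0r add0r addrA.
Qed.

(** The Cauchy space is the line of a lift [X0] of the vertical null vector if the direction does
    not rotate along [X0], and zero otherwise; the class is 7 minus its dimension. *)
Lemma class_null_system a b u : S u -> differentiable a u -> differentiable b u ->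
  (\forall v \near u, null_form (dF v) (a v) (b v) (a v) (b v) = 0) ->
  (a u != 0) || (b u != 0) ->
  class_at (null_system a b) u = class_value u (a u) (b u).
Proof.
move=> Su da db n0 ab.
have [X0 X0J] := @null_vector_lift u (a u) (b u) Su (conj (nbhs_singleton n0) ab).
have hessP := hess_null_vector Su da db n0 ab X0J.
have cauchyP X : (X <= cauchy_space (null_system a b) u)%MS <->
    exists nu, X = nu *: X0 /\ nu * (rdot X0 (grad a u) * b u - rdot X0 (grad b u) * a u) = 0.
  rewrite -(cauchy_vector (iF u) (rank_iF Su) (jacobian_dF Su) (hyperbolic_grad Su)
    (grad a u) (grad b u) ab X0J X).
  have [<- _ _] := row_contact u; rewrite null_covectorE.
  rewrite sub_cauchy_space; split.
  - move=> [XN XW]; split; [split|split].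
    + by rewrite -(null_system0 a b) -mulmx_tr_rdot XN mxE.
    + by rewrite -null_system1 -mulmx_tr_rdot XN mxE.
    + by have := XW 0; rewrite ext_deriv_null0 // => /sub_null_system.
    + by have := XW 1; rewrite ext_deriv_null1 // => /sub_null_system.
  - move=> [[X1 X2] [X3 X4]]; split.
    + apply/rowP => i; rewrite mulmx_tr_rdot mxE; case: (ord2 i) => ->.
        by rewrite null_system0.
      by rewrite null_system1.
    + move=> i; case: (ord2 i) => ->.
        by rewrite ext_deriv_null0 //; apply/sub_null_system.
      by rewrite ext_deriv_null1 //; apply/sub_null_system.
rewrite class_atE /class_value; case: eqP => [H0|H0].
- have X00 : X0 != 0.
    apply/eqP => X00; move: X0J; rewrite X00 mul0mx => E.
    have Ea : a u ^+ 2 = 0 by have := congr1 (fun w : 'rV_8 => w 0 ct) E; rewrite !mxE.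
    have Eb : b u ^+ 2 = 0 by have := congr1 (fun w : 'rV_8 => w 0 cr) E; rewrite !mxE.
    move/eqP: Ea; move/eqP: Eb; rewrite !expf_eq0 /= => b0 a0.
    by move: ab; rewrite a0 b0.
  suff -> : \rank (cauchy_space (null_system a b) u) = 1 by [].
  have <- : \rank X0 = 1 by rewrite rank_rV X00.
  apply/eqP; rewrite eqn_leq; apply/andP; split; apply: mxrankS.
    apply/row_subP => i; have : (row i (cauchy_space (null_system a b) u) <= cauchy_space (null_system a b) u)%MS by exact: row_sub.
    by move=> /cauchyP [nu [-> _]]; exact: scalemx_sub.
  by apply/cauchyP; exists 1; rewrite scale1r mul1r; split=> //; apply/hessP.
- suff -> : cauchy_space (null_system a b) u = 0 by rewrite mxrank0.
  apply/eqP; rewrite -submx0; apply/row_subP => i.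
  have : (row i (cauchy_space (null_system a b) u) <= cauchy_space (null_system a b) u)%MS by exact: row_sub.
  move=> /cauchyP [nu [-> /eqP]]; rewrite mulf_eq0 => /orP[/eqP ->|/eqP /hessP //].
  by rewrite scale0r sub0mx.
Qed.

(* The null form is nondegenerate, so both rows of an isotropic rank two system have the same
   null direction modulo the first contact form. *)
Lemma isotropic_class (M : 'rV[R]_7 -> 'M[R]_(2, 7)) U u : open U -> U u -> U `<=` S ->
  isotropic_subsystem I U M ->
  exists a b, [/\ null_at u a b,
    (M u == null_system (fun=> a) (fun=> b) u)%MS & class_at M u = class_value u a b].
Proof.
move=> oU Uu US [[sM fM] MI iso]; have Su := US u Uu.
have nU : \forall v \near u, U v by exact: open_nbhs_nbhs.
have dM v : U v -> diff_mx M v.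
  by move=> Uv i j; exact: smooth_on_differentiable (sM i j) Uv.
have nMI v : U v -> \forall w \near v, (M w <= I w)%MS.
  by move=> Uv; apply: filterS (open_nbhs_nbhs (conj oU Uv)) => w /MI.
have [T dT MT] := differentiable_coefficients (dM u Uu) (contact_diff Su) (contact_free Su) (nMI u Uu).
have iso_coef v : U v -> M v = T v *m I v -> forall i j,
    null_form (dF v) (T v i 1) (T v i i2) (T v j 1) (T v j i2) = 0.
  move=> Uv Mv i j; have Sv := US v Uv.
  have [T' [MT' [c c0 Hc]]] := pairing_coef Sv (dM v Uv) (nMI v Uv).
  have TT' : T v = T' by apply: (row_free_inj (contact_free Sv)); rewrite -Mv.
  have := iso v Uv i j; rewrite Hc -TT' => /eqP.
  by rewrite mulf_eq0 (negPf c0) => /eqP.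
have prop v : U v -> M v = T v *m I v -> forall i j,
    T v i 1 * T v j i2 = T v j 1 * T v i i2.
  move=> Uv Mv i j; have H := iso_coef v Uv Mv.
  have := null_form_gram (dF v) (T v i 1) (T v i i2) (T v j 1) (T v j i2).
  rewrite !H mul0r expr0n /= subr0 => /esym/eqP.
  rewrite mulf_eq0 subr_eq0 lt_eqF ?hyperbolic_disc //=; last exact: US.
  by rewrite expf_eq0 /= subr_eq0 => /eqP.
have MTu := nbhs_singleton MT.
(* Otherwise [M u] would lie in the line of the first contact form, against its rank 2. *)
have [i Ti] : exists i, (T u i 1 != 0) || (T u i i2 != 0).
  apply: contrapT => H.
  have T0 i : T u i 1 = 0 /\ T u i i2 = 0.
    by have /negP := fun H' => H (ex_intro _ i H'); rewrite negb_or !negbK => /andP[/eqP -> /eqP ->].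
  have : (M u <= row 0 (I u))%MS.
    apply/row_subP => i; rewrite MTu row_mul mulmx_sum_row sum3 !mxE.
    by have [-> ->] := T0 i; rewrite !scale0r !addr0 scalemx_sub.
  move=> /mxrankS; have := fM u Uu; rewrite /row_free => /eqP ->.
  by move=> /leq_trans /(_ (rank_leq_row _)).
pose a v := T v i 1; pose b v := T v i i2.
have da : differentiable a u by exact: dT.
have db : differentiable b u by exact: dT.
have nUMT : \forall v \near u, U v /\ M v = T v *m I v by exact: filterI nU MT.
have n0 : \forall v \near u, null_form (dF v) (a v) (b v) (a v) (b v) = 0.
  by apply: filterS nUMT => v [Uv Mv]; exact: iso_coef.
have nab : \forall v \near u, (a v != 0) || (b v != 0).
  case/orP: Ti => Ti; [have := near_neq0 da Ti|have := near_neq0 db Ti];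
    by apply: filterS => v ->; rewrite ?orbT.
have eqMN : \forall v \near u, (M v == null_system a b v)%MS.
  apply: filterS2 nUMT nab => v [Uv Mv] abv; have Sv := US v Uv.
  have sub : (M v <= null_system a b v)%MS.
    apply/row_subP => j; apply/sub_null_system; rewrite Mv row_mul mulmx_sum_row sum3 !mxE.
    exists (T v j 0); have P := prop v Uv Mv j i.
    case: (boolP (a v == 0)) abv => [/eqP a0|a0] /=.
      move=> b0; exists (T v j i2 / b v).
      have T1 : T v j 1 = 0.
        by apply: (mulIf b0); rewrite mul0r P -/(a v) a0 mul0r.
      by rewrite T1 a0 !scale0r add0r addr0 scalerA divfK.
    move=> _; exists (T v j 1 / a v).
    rewrite scalerDr !scalerA divfK // addrA; congr (_ + _ *: _).
    by apply: (mulfI a0); rewrite -P -/(b v); field.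
  rewrite -(geq_leqif (mxrank_leqif_eq sub)).
  have /eqP -> : row_free (M v) by exact: fM.
  exact: rank_leq_row.
exists (a u), (b u); split.
- by split=> //; exact: nbhs_singleton n0.
- by have := nbhs_singleton eqMN; rewrite /null_system.
- rewrite -(class_null_system Su da db n0 Ti).
  apply: class_at_eqmx => //; [exact: dM|exact: null_system_diff|exact: fM|exact: null_system_free].
Qed.

Lemma null_system_eqmx u a b a' b' : S u -> (a != 0) || (b != 0) ->
  (a' != 0) || (b' != 0) -> a * b' = a' * b ->
  (null_system (fun=> a) (fun=> b) u <= null_system (fun=> a') (fun=> b') u)%MS.
Proof.
move=> Su ab ab' E; apply/row_subP => i; case: (ord2 i) => ->; apply/sub_null_system.
  by rewrite null_system0; exists 1, 0; rewrite scale1r scale0r addr0.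
rewrite null_system1; exists 0.
case: (boolP (a' == 0)) ab' => [/eqP a0|a0] /=.
  move=> b0; exists (b / b'); rewrite a0.
  have -> : a = 0 by apply: (mulIf b0); rewrite E a0 mul0r mul0r.
  by rewrite !scale0r !add0r scalerA divfK.
move=> _; exists (a / a'); rewrite scale0r add0r scalerDr !scalerA divfK //.
congr (_ + _ *: _); apply: (mulfI a0); rewrite -E; by field.
Qed.

(** Proportional null directions span the same system, so systems that differ at [u] have
    independent directions. This reduces a type to algebra at one point. *)
Lemma has_type_null c1 c2 u : has_type S iF c1 c2 -> S u ->
  exists a1 b1 a2 b2, [/\ null_at u a1 b1, null_at u a2 b2, a1 * b2 != a2 * b1,
    c1 = class_value u a1 b1 & c2 = class_value u a2 b2].
Proof.
move=> H Su; have [U [oU Uu US [M1 [M2 [[iso1 _] [iso2 _] neq cls]]]]] := H u Su.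
have [a1 [b1 [n1 e1 k1]]] := isotropic_class oU Uu US iso1.
have [a2 [b2 [n2 e2 k2]]] := isotropic_class oU Uu US iso2.
have [<- <-] := cls u Uu.
exists a1, b1, a2, b2; split=> //.
apply: contra (neq u Uu) => /eqP E.
have [_ ab1] := n1; have [_ ab2] := n2.
have s12 := null_system_eqmx Su ab1 ab2 E.
have s21 := null_system_eqmx Su ab2 ab1 (esym E).
move: e1 e2 => /andP[e1 e1'] /andP[e2 e2'].
by apply/andP; split; [exact: submx_trans e1 (submx_trans s12 e2')|exact: submx_trans e2 (submx_trans s21 e1')].
Qed.

Let null_system_coef a b v : null_system a b v =
  (\matrix_(i, j) (if i == 0 then (j == 0)%:R else nth 0 [:: 0; a v; b v] j)) *m I v.
Proof.
apply/row_matrixP => i; rewrite row_mul mulmx_sum_row sum3 !mxE.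
case: (ord2 i) => -> /=.
  by rewrite null_system0 /= scale1r !scale0r !addr0.
by rewrite null_system1 /= scale0r add0r.
Qed.

Let coef_eq (T T' : 'rV[R]_3) v : S v -> T *m I v = T' *m I v ->
  T 0 1 = T' 0 1 /\ T 0 i2 = T' 0 i2.
Proof. by move=> Sv /(row_free_inj (contact_free Sv)) ->. Qed.

(** For a nondegenerate binary form the orthogonal of a null direction is that direction itself, so
    a larger isotropic system has no room. *)
Lemma null_system_maximal U a b : open U -> U `<=` S ->
  smooth_on U a -> smooth_on U b -> (forall v, U v -> null_at v (a v) (b v)) ->
  maximally_isotropic I U (null_system a b).
Proof.
move=> oU US sa sb nab.
have sI i j : smooth_on U (fun v => I v i j) by apply: smooth_on_sub US _; exact: contact_smooth.
have sN i j : smooth_on U (fun v => null_system a b v i j).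
  have E v : (if i == 0 then I v 0 j else a v * I v 1 j + b v * I v i2 j) = null_system a b v i j.
    by rewrite null_systemE.
  apply: (smooth_on_eq oU (fun v _ => E v)).
  by case: eqP => _ //; apply: smooth_onD => //; exact: smooth_onM.
have dN v : U v -> diff_mx (null_system a b) v.
  by move=> Uv i j; exact: smooth_on_differentiable Uv.
split.
  split; [split| |] => //.
  - by move=> v Uv; apply: null_system_free; [exact: US|exact: (nab v Uv).2].
  - by move=> v _; exact: null_system_sub.
  - move=> v Uv i j; have Sv := US v Uv.
    have nNI : \forall w \near v, (null_system a b w <= I w)%MS.
      by apply: filterS (open_nbhs_nbhs (conj oU Uv)) => w _; exact: null_system_sub.
    have [T [NT [c c0 ->]]] := pairing_coef Sv (dN v Uv) nNI.
    have -> : T = \matrix_(i, j) (if i == 0 then (j == 0)%:R else nth 0 [:: 0; a v; b v] j).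
      by apply: (row_free_inj (contact_free Sv)); rewrite -NT null_system_coef.
    rewrite !mxE; have [n0 _] := nab v Uv.
    case: (ord2 i) => ->; case: (ord2 j) => -> /=; rewrite ?n0 ?mulr0 //;
      by rewrite /null_form; ring.
move=> k' M' [[sM' fM'] M'I iso'] NM' v Uv; have Sv := US v Uv.
have dM' : diff_mx M' v by move=> i j; exact: smooth_on_differentiable (sM' i j) Uv.
have nMI : \forall w \near v, (M' w <= I w)%MS.
  by apply: filterS (open_nbhs_nbhs (conj oU Uv)) => w /M'I.
have [T [MT [c c0 Hc]]] := pairing_coef Sv dM' nMI.
have nT i j : null_form (dF v) (T i 1) (T i i2) (T j 1) (T j i2) = 0.
  by have := iso' v Uv i j; rewrite Hc => /eqP; rewrite mulf_eq0 (negPf c0) => /eqP.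
have [n0 ab] := nab v Uv.
have [y yE] : exists y : 'rV[R]_k', row 1 (null_system a b v) = y *m M' v.
  by apply/submxP; apply: submx_trans (row_sub _ _) (NM' v Uv).
have [ya yb] : a v = \sum_i y 0 i * T i 1 /\ b v = \sum_i y 0 i * T i i2.
  have := @coef_eq (row 1 (\matrix_(i < 2, j < 3) (if i == 0 then (j == 0)%:R else nth 0 [:: 0; a v; b v] j)))
     (y *m T) v Sv.
  rewrite -row_mul -null_system_coef yE MT mulmxA => /(_ erefl).
  by rewrite !mxE.
(* The pair (a, b) is a combination of the coefficient pairs of the rows of [M'], which are mutually
   orthogonal. *)
have nab0 j : null_form (dF v) (T j 1) (T j i2) (a v) (b v) = 0.
  have lin : null_form (dF v) (T j 1) (T j i2) (a v) (b v) =
      \sum_i y 0 i * null_form (dF v) (T j 1) (T j i2) (T i 1) (T i i2).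
    transitivity ((2 * dF v 0 ct * T j 1 - dF v 0 cs * T j i2) * a v +
      (2 * dF v 0 cr * T j i2 - dF v 0 cs * T j 1) * b v).
      by rewrite /null_form; ring.
    rewrite {1}ya {1}yb !mulr_sumr -big_split /=.
    by apply: eq_bigr => i _; rewrite /null_form; ring.
  by rewrite lin big1 // => i _; rewrite nT mulr0.
apply/row_subP => j; apply/sub_null_system; rewrite MT row_mul mulmx_sum_row sum3 !mxE.
have P : T j 1 * b v = a v * T j i2.
  have := null_form_gram (dF v) (T j 1) (T j i2) (a v) (b v).
  rewrite nab0 n0 mulr0 expr0n /= subr0 => /esym/eqP.
  rewrite mulf_eq0 subr_eq0 lt_eqF ?hyperbolic_disc //=.
  by rewrite expf_eq0 /= subr_eq0 => /eqP.
exists (T j 0).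
case: (boolP (a v == 0)) ab => [/eqP a0|a0] /=.
  move=> b0; exists (T j i2 / b v).
  have T1 : T j 1 = 0 by apply: (mulIf b0); rewrite mul0r P a0 mul0r.
  by rewrite T1 a0 !scale0r add0r addr0 scalerA divfK.
move=> _; exists (T j 1 / a v).
rewrite scalerDr !scalerA divfK // addrA; congr (_ + _ *: _).
by apply: (mulfI a0); rewrite -P; field.
Qed.

Lemma smooth_partial_comp c : smooth_on S (fun u => partial c F (iF u)).
Proof.
apply: (@smooth_on_comp _ _ _ _ D) => //; last exact: smooth_on_partial.
by move=> u /iFD [].
Qed.

(** The first equation makes (q, 2 C) and (2 A, q) null; the second gives their determinant, which
    shows that they are independent when q and d are nonzero. *)
Lemma disc_root (A B C q e d : R) : e ^+ 2 = 1 -> d ^+ 2 = B ^+ 2 - 4 * (A * C) ->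
  q = B + e * d ->
  q ^+ 2 - 2 * q * B + 4 * (A * C) = 0 /\ q * q - 2 * C * (2 * A) = 2 * q * (e * d).
Proof.
move=> e2 d2 ->.
have E : (e * d) ^+ 2 = B ^+ 2 - 4 * (A * C) by rewrite exprMn e2 mul1r.
split.
- transitivity ((e * d) ^+ 2 - (B ^+ 2 - 4 * (A * C))); first by ring.
  by rewrite E subrr.
- transitivity (2 * (B + e * d) * (e * d) - ((e * d) ^+ 2 - (B ^+ 2 - 4 * (A * C)))); first by ring.
  by rewrite E subrr subr0.
Qed.

(* The two roots of the null form are [q : 2 F_t] and [2 F_r : q] with
   [q = F_s +- sqrt (F_s^2 - 4 F_r F_t)]; the sign is chosen so that [q] does not vanish. *)
Lemma has_type_of_value c :
  (forall u, S u -> forall a b, null_at u a b -> class_value u a b = c) ->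
  has_type S iF c c.
Proof.
move=> H u Su.
pose A v := partial cr F (iF v); pose B v := partial cs F (iF v).
pose C v := partial ct F (iF v).
have sA : smooth_on S A by exact: smooth_partial_comp.
have sB : smooth_on S B by exact: smooth_partial_comp.
have sC : smooth_on S C by exact: smooth_partial_comp.
pose Delta v := B v ^+ 2 - 4 * (A v * C v).
have sc k : smooth_on S (fun=> k) by exact: smooth_on_cst.
have sDelta : smooth_on S Delta.
  apply: smooth_onB => //; first exact: smooth_onM.
  by apply: smooth_onM => //; exact: smooth_onM.
have Dpos v : S v -> 0 < Delta v.
  by move=> Sv; have := hyperbolic_disc Sv; rewrite !gradE /Delta subr_gt0.
pose d v := Num.sqrt (Delta v).
have sd : smooth_on S d by exact: smooth_on_sqrt.
have dpos v : S v -> 0 < d v by move=> /Dpos; rewrite sqrtr_gt0.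
pose e : R := if 0 <= B u then 1 else -1.
have e2 : e ^+ 2 = 1 by rewrite /e; case: ifP => _; rewrite ?sqrrN expr1n.
have e0 : e != 0 by apply: contra_eq_neq e2 => ->; rewrite expr0n /= eq_sym oner_neq0.
pose q v := B v + e * d v.
have sq : smooth_on S q by apply: smooth_onD => //; exact: smooth_onM.
have qu : q u != 0.
  have du := dpos u Su; rewrite /q /e; case: (leP 0 (B u)) => Bu.
    by rewrite gt_eqF //; lra.
  by rewrite lt_eqF //; lra.
have nq := near_neq0 (smooth_on_differentiable sq Su) qu.
have [U [oU Uu] Uq] : exists2 U, open_nbhs u U & U `<=` [set v | S v /\ q v != 0].
  exists ([set v | S v /\ q v != 0]^°); last exact: interior_subset.
  by split; [exact: open_interior|exact: filterI (nS Su) nq].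
have US : U `<=` S by move=> v /Uq [].
exists U; split=> //.
have root v : U v -> q v ^+ 2 - 2 * q v * B v + 4 * (A v * C v) = 0 /\
    q v * q v - 2 * C v * (2 * A v) = 2 * q v * (e * d v).
  move=> Uv; apply: (@disc_root _ _ _ _ e (d v)) => //.
  by rewrite sqr_sqrtr //; apply/ltW/Dpos/US.
pose a1 := q; pose b1 v := 2 * C v; pose a2 v := 2 * A v; pose b2 := q.
have n1 v : U v -> null_at v (a1 v) (b1 v).
  move=> Uv; have [_ qv] := Uq v Uv; split; last by rewrite qv.
  have [E _] := root v Uv.
  apply/null_form_eq0; rewrite !gradE -/(A v) -/(B v) -/(C v) -[RHS](mulr0 (C v)) -E /a1 /b1.
  by ring.
have n2 v : U v -> null_at v (a2 v) (b2 v).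
  move=> Uv; have [_ qv] := Uq v Uv; split; last by rewrite qv orbT.
  have [E _] := root v Uv.
  apply/null_form_eq0; rewrite !gradE -/(A v) -/(B v) -/(C v) -[RHS](mulr0 (A v)) -E /a2 /b2.
  by ring.
have s1 : smooth_on U a1 by apply: smooth_on_sub US _.
have s2 : smooth_on U b2 by apply: smooth_on_sub US _.
have s3 : smooth_on U b1 by apply: smooth_on_sub US _; exact: smooth_onM.
have s4 : smooth_on U a2 by apply: smooth_on_sub US _; exact: smooth_onM.
exists (null_system a1 b1), (null_system a2 b2); split.
- exact: null_system_maximal.
- exact: null_system_maximal.
- move=> v Uv; have Sv := US v Uv; have [_ qv] := Uq v Uv.
  apply/negP => /andP[sub _].
  have : (row 1 (null_system a1 b1 v) <= null_system a2 b2 v)%MS.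
    by apply: submx_trans sub; exact: row_sub.
  move=> /sub_null_system [x1 [x2]]; rewrite null_system1 => E.
  have [] := @coef_eq (\row_j nth 0 [:: 0; a1 v; b1 v] j)
    (\row_j nth 0 [:: x1; x2 * a2 v; x2 * b2 v] j) v Sv.
    rewrite !mulmx_sum_row !sum3 !mxE /= scale0r add0r E.
    by rewrite scalerDr !scalerA addrA.
  rewrite !mxE /= => E1 E2.
  (* Equal systems would have proportional directions, while their determinant is 2 q e d. *)
  have [_] := root v Uv.
  rewrite -/(b1 v) -/(a2 v) -{1}/(a1 v) E1 E2 -/(b2 v).
  have -> : x2 * a2 v * b2 v - x2 * b2 v * a2 v = 0 by ring.
  move/esym/eqP; rewrite !mulf_eq0 pnatr_eq0 /= (negPf qv) (negPf e0) /=.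
  by rewrite gt_eqF // dpos.
- move=> v Uv; have Sv := US v Uv.
  have nU (a b : 'rV[R]_7 -> R) : (forall w, U w -> null_at w (a w) (b w)) ->
      \forall w \near v, null_form (dF w) (a w) (b w) (a w) (b w) = 0.
    by move=> n; apply: filterS (open_nbhs_nbhs (conj oU Uv)) => w /n [].
  split.
  + rewrite (class_null_system Sv _ _ (nU _ _ n1) (n1 v Uv).2).
    * by apply: H => //; exact: n1.
    * exact: smooth_on_differentiable Uv.
    * exact: smooth_on_differentiable Uv.
  + rewrite (class_null_system Sv _ _ (nU _ _ n2) (n2 v Uv).2).
    * by apply: H => //; exact: n2.
    * exact: smooth_on_differentiable Uv.
    * exact: smooth_on_differentiable Uv.
Qed.

End Parametrization.

(** * Classification *)

Section Classification.
Variable (R : realType).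

Lemma hess_null_vectorE (G : 'rV[R]_8 -> R) m a b (H : 'I_8 -> 'I_8 -> R) :
  (forall c d, partial c (partial d G) m = H c d) ->
  hess G m (null_vector a b) =
    b ^+ 4 * H cr cr - a * b ^+ 3 * (H cr cs + H cs cr)
    + a ^+ 2 * b ^+ 2 * (H cr ct + H ct cr + H cs cs)
    - a ^+ 3 * b * (H cs ct + H ct cs) + a ^+ 4 * H ct ct.
Proof.
move=> HE; rewrite /hess; under eq_bigr do under eq_bigr do rewrite HE.
have V c : null_vector a b 0 c = nth 0 [:: 0; 0; 0; 0; 0; b ^+ 2; - (a * b); a ^+ 2] c.
  by rewrite mxE.
by rewrite !sum8 !V /=; ring.
Qed.

Lemma partial2_values (G : 'rV[R]_8 -> R) m : exists H : 'I_8 -> 'I_8 -> R,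
  forall c d, partial c (partial d G) m = H c d.
Proof. by eexists. Qed.

Lemma curvatureE (G : 'rV[R]_8 -> R) m c1 c2 (H : 'I_8 -> 'I_8 -> R) :
  (forall c d, partial c (partial d G) m = H c d) ->
  fibre_curvature c1 c2 G m = partial c1 G m ^+ 2 * H c2 c2
  - partial c1 G m * partial c2 G m * (H c2 c1 + H c1 c2) + partial c2 G m ^+ 2 * H c1 c1.
Proof. by move=> HE; rewrite /fibre_curvature !HE. Qed.

Lemma curvature_transfer (k l x y : R) : l != 0 -> k * x = l * y -> k != 0 ->
  (x == 0) = (y == 0).
Proof.
move=> l0 E k0; apply/eqP/eqP => H.
  by move/esym/eqP: E; rewrite H mulr0 mulf_eq0 (negPf l0) => /eqP.
by move/eqP: E; rewrite H mulr0 mulf_eq0 (negPf k0) => /eqP.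
Qed.

Section Equation.
Variables (D : set 'rV[R]_8) (F : 'rV[R]_8 -> R).
Variables (S : set 'rV[R]_7) (iF : 'rV[R]_7 -> 'rV[R]_8).
Hypotheses (oD : open D) (sF : smooth_on D F).
Hypothesis param : nondegenerate_parametrization D F S iF.

Lemma param_locus u : S u -> D (iF u) /\ F (iF u) = 0.
Proof.
move=> Su; have [_ _ _ E _] := param.
by have : (iF @` S) (iF u) by [exists u]; rewrite E.
Qed.

Lemma locus_param m : D m -> F m = 0 -> exists2 u, S u & iF u = m.
Proof.
move=> Dm Fm; have [_ _ _ E _] := param.
have : [set m | D m /\ F m = 0] m by [].
by rewrite -E => -[u Su <-]; exists u.
Qed.

Lemma type_null c1 c2 u : hyperbolic F S iF -> has_type S iF c1 c2 -> S u ->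
  exists a1 b1 a2 b2, [/\ null_at F iF u a1 b1, null_at F iF u a2 b2, a1 * b2 != a2 * b1,
    c1 = class_value F iF u a1 b1 & c2 = class_value F iF u a2 b2].
Proof.
have [oS si rk _ _] := param.
by move=> hyp; apply: (@has_type_null R D F S iF) => //; exact: param_locus.
Qed.

Lemma type_of_value c : hyperbolic F S iF ->
  (forall u, S u -> forall a b, null_at F iF u a b -> class_value F iF u a b = c) ->
  has_type S iF c c.
Proof.
have [oS si rk _ _] := param.
by move=> hyp; apply: (@has_type_of_value R D F S iF) => //; exact: param_locus.
Qed.

Lemma null_atE u a b : null_at F iF u a b ->
  partial ct F (iF u) * (a * a) - partial cs F (iF u) * (a * b)
    + partial cr F (iF u) * (b * b) = 0.
Proof. by case=> /null_form_eq0; rewrite !gradE. Qed.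

Lemma independent_partial C c m : independent_of C D F -> c \in C -> D m ->
  partial c F m = 0.
Proof. by move=> iF0; exact: partial_independent. Qed.

Lemma independent_partial2 c k m : (forall m, D m -> partial c F m = 0) -> D m ->
  partial k (partial c F) m = 0 /\ partial c (partial k F) m = 0.
Proof.
move=> H Dm; have E : partial k (partial c F) m = 0 by exact: (partial_partial0 _ oD).
exact: (conj E (etrans (schwarz c k oD sF Dm) E)).
Qed.

End Equation.

Lemma has_type_sym S (iF : 'rV[R]_7 -> 'rV[R]_8) c1 c2 :
  has_type S iF c1 c2 -> has_type S iF c2 c1.
Proof.
move=> H u Su; have [U [oU Uu US [M1 [M2 [i1 i2 neq cls]]]]] := H u Su.
exists U; split=> //; exists M2, M1; split=> // v Uv; last by have [] := cls v Uv.
by rewrite andbC; exact: neq.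
Qed.

Lemma fibre_cover (c1 c2 c3 : 'I_8) : uniq [:: c1; c2; c3] ->
  (5 <= c1)%N -> (5 <= c2)%N -> (5 <= c3)%N ->
  forall c : 'I_8, (5 <= c)%N -> c != c1 -> c != c2 -> c = c3.
Proof.
rewrite /= !inE negb_or andbT => /andP[/andP[n12 n13] n23] h1 h2 h3 c h nc1 nc2.
apply: val_inj => /=.
move: n12 n13 n23 nc1 nc2; rewrite -!val_eqE /=.
have := ltn_ord c1; have := ltn_ord c2; have := ltn_ord c3; have := ltn_ord c.
by move: h1 h2 h3 h; clear; lia.
Qed.

(** Both null directions have the same [class_value], decided by the curvature at the point, so the
    classes always agree. *)
Theorem classification_independent_s D (F : 'rV[R]_8 -> R) S iF :
  open D -> smooth_on D F -> independent_of [set cs]%SET D F ->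
  nondegenerate_parametrization D F S iF ->
  (hyperbolic F S iF <->
    forall u, S u -> partial cr F (iF u) * partial ct F (iF u) < 0) /\
  (hyperbolic F S iF ->
   (has_type S iF 6 6 <-> locus_affine_in cr ct D F) /\
   (constant_classes S iF -> ~ locus_affine_in cr ct D F -> has_type S iF 7 7)).
Proof.
move=> oD sF ind param.
have F0 m : D m -> partial cs F m = 0.
  by apply: (independent_partial oD sF ind); rewrite inE.
have locus := param_locus param.
have hypE : hyperbolic F S iF <->
    forall u, S u -> partial cr F (iF u) * partial ct F (iF u) < 0.
  by split=> H u Su; have := H u Su; rewrite F0 ?expr0n /= ?mulr0 ?subr0 //; have [] := locus u Su.
split=> // hyp; have prod := hypE.1 hyp.
have crt : ct != cr by [].
have F1 m : D m -> F m = 0 -> partial cr F m != 0.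
  move=> Dm Fm; have [u Su <-] := locus_param param Dm Fm.
  by apply: contraTneq (prod u Su) => ->; rewrite mul0r ltxx.
have affP : locus_affine_in cr ct D F <->
    forall m, D m -> F m = 0 -> fibre_curvature cr ct F m = 0.
  apply: locus_affineP => // c m c5 c1 c2 Dm.
  by rewrite (@fibre_cover cr ct cs _ _ _ _ c) // F0.
have value u a b : S u -> null_at F iF u a b ->
    class_value F iF u a b = if fibre_curvature cr ct F (iF u) == 0 then 6 else 7.
  move=> Su n0; have [Du Fu] := locus u Su.
  suff E : (hess F (iF u) (null_vector a b) == 0) = (fibre_curvature cr ct F (iF u) == 0).
    by rewrite /class_value E.
  have [H HE] := partial2_values F (iF u).
  have Z k := independent_partial2 oD sF k F0 Du.
  have H1 k : H k cs = 0 by rewrite -HE; exact: (Z k).1.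
  have H2 k : H cs k = 0 by rewrite -HE; exact: (Z k).2.
  rewrite (hess_null_vectorE _ _ HE) (curvatureE _ _ HE) !H1 !H2.
  have := null_atE n0; have := prod u Su; have [_ ab] := n0.
  rewrite (F0 _ Du) mul0r subr0.
  move: (partial cr F (iF u)) (partial ct F (iF u)) => A C AC E.
  have A0 : A != 0 by apply: contraTneq AC => ->; rewrite mul0r ltxx.
  have a0 : a != 0.
    apply: contraTneq ab => a0; move/eqP: E; rewrite a0 mulr0 mulr0 add0r.
    by rewrite !mulf_eq0 (negPf A0) /= orbb eqxx => ->.
  (* Multiplied by A^2, the Hessian depends on b only through A b^2, which the null equation
     replaces by - C a^2; what results is a^4 times the curvature. *)
  apply: (@curvature_transfer (A ^+ 2) (a ^+ 4)); rewrite ?expf_neq0 //.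
  have -> : A ^+ 2 * (b ^+ 4 * H cr cr - a * b ^+ 3 * (0 + 0)
      + a ^+ 2 * b ^+ 2 * (H cr ct + H ct cr + 0) - a ^+ 3 * b * (0 + 0) + a ^+ 4 * H ct ct)
    = (A * (b * b)) ^+ 2 * H cr cr + a ^+ 2 * A * (A * (b * b)) * (H cr ct + H ct cr)
      + A ^+ 2 * a ^+ 4 * H ct ct by ring.
  have -> : A * (b * b) = - (C * (a * a)) by move: E; lra.
  by ring.
split.
- split=> [H|aff].
    apply/affP => m Dm Fm; have [u Su <-] := locus_param param Dm Fm.
    have [a1 [b1 [_ [_ [n1 _ _ E _]]]]] := type_null sF param hyp H Su.
    by move: E; rewrite (value _ _ _ Su n1); case: eqP.
  apply: (type_of_value sF param hyp) => u Su a b n0; have [Du Fu] := locus u Su.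
  by rewrite (value _ _ _ Su n0) (affP.1 aff) // eqxx.
- move=> [c1 [c2 H]] naff u Su.
  (* [c1] is a single number for all of [S]: were it 6, the curvature would vanish on the whole
     locus. *)
  have c16 : c1 <> 6.
    move=> c16; apply: naff; apply/affP => m Dm Fm.
    have [v Sv <-] := locus_param param Dm Fm.
    have [a1 [b1 [_ [_ [n1 _ _ E _]]]]] := type_null sF param hyp H Sv.
    by move: E; rewrite c16 (value _ _ _ Sv n1); case: eqP.
  have [a1 [b1 [a2 [b2 [n1 n2 _ E1 E2]]]]] := type_null sF param hyp H Su.
  rewrite (value _ _ _ Su n1) in E1; rewrite (value _ _ _ Su n2) in E2.
  have := H u Su; move: E1 E2 c16; case: eqP => _ -> -> //.
Qed.

(** Here the null equation factors as b (G_r b - G_s a) = 0. The equation is solved for s, since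
    hyperbolicity means that G_s is nonzero while G_r may vanish. *)
Theorem classification_independent_t D (G : 'rV[R]_8 -> R) S iF :
  open D -> smooth_on D G -> independent_of [set ct]%SET D G ->
  nondegenerate_parametrization D G S iF ->
  (hyperbolic G S iF <-> forall u, S u -> partial cs G (iF u) <> 0) /\
  (hyperbolic G S iF ->
   (has_type S iF 6 6 <-> locus_affine_in cr cs D G) /\
   (constant_classes S iF -> ~ locus_affine_in cr cs D G -> has_type S iF 6 7)).
Proof.
move=> oD sG ind param.
have G0 m : D m -> partial ct G m = 0.
  by apply: (independent_partial oD sG ind); rewrite inE.
have locus := param_locus param.
have hypE : hyperbolic G S iF <-> forall u, S u -> partial cs G (iF u) <> 0.
  split=> H u Su; have := H u Su; have [Du _] := locus u Su.
    rewrite (G0 _ Du) mulr0 sub0r oppr_lt0 pmulr_rgt0 ?invr_gt0 //.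
    by move=> + E; rewrite E expr0n /= ltxx.
  move=> /eqP E; rewrite (G0 _ Du) mulr0 sub0r oppr_lt0 pmulr_rgt0 ?invr_gt0 //.
  by rewrite lt_neqAle sqr_ge0 eq_sym expf_eq0 andbT.
split=> // hyp; have nz := hypE.1 hyp.
have G1 m : D m -> G m = 0 -> partial cs G m != 0.
  move=> Dm Gm; have [u Su <-] := locus_param param Dm Gm; apply/eqP; exact: nz.
have affP : locus_affine_in cr cs D G <->
    forall m, D m -> G m = 0 -> fibre_curvature cs cr G m = 0.
  rewrite -(@locus_affineP R cs cr) //.
    by split; exact: locus_affine_inC.
  move=> c m c5 c1 c2 Dm.
  by rewrite (@fibre_cover cs cr ct _ _ _ _ c) // G0.
have null u a b : S u -> null_at G iF u a b ->
    b = 0 \/ partial cr G (iF u) * b = partial cs G (iF u) * a.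
  move=> Su n0; have [Du _] := locus u Su; have := null_atE n0; rewrite (G0 _ Du) mul0r add0r.
  have [->|b0] := eqVneq b 0; first by left.
  move: (partial cr G _) (partial cs G _) => A B E; right.
  by apply: (mulIf b0); lra.
have value u a b : S u -> null_at G iF u a b -> class_value G iF u a b =
    if b == 0 then 6 else if fibre_curvature cs cr G (iF u) == 0 then 6 else 7.
  move=> Su n0; have [Du Gu] := locus u Su.
  have B0 := G1 _ Du Gu.
  have [H HE] := partial2_values G (iF u).
  have Z k := independent_partial2 oD sG k G0 Du.
  have H1 k : H k ct = 0 by rewrite -HE; exact: (Z k).1.
  have H2 k : H ct k = 0 by rewrite -HE; exact: (Z k).2.
  rewrite /class_value (hess_null_vectorE _ _ HE) (curvatureE _ _ HE) !H1 !H2.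
  (* For b = 0 the vertical vector is a^2 d/dt, along which G does not change. *)
  have [b0|b0] := eqVneq b 0.
    by case: eqP => // nz0; case: nz0; rewrite b0; ring.
  have E : partial cr G (iF u) * b = partial cs G (iF u) * a.
    by have [/eqP|] := null u a b Su n0; rewrite ?(negPf b0).
  congr (if _ then _ else _); move: E B0.
  move: (partial cr G (iF u)) (partial cs G (iF u)) => A B E B0.
  (* After multiplication by B^2, every B a is replaced by A b, leaving b^4 times the curvature. *)
  apply: (@curvature_transfer (B ^+ 2) (b ^+ 4)); rewrite ?expf_neq0 //.
  transitivity (b ^+ 4 * B ^+ 2 * H cr cr - (B * a) * B * b ^+ 3 * (H cr cs + H cs cr)
    + (B * a) ^+ 2 * b ^+ 2 * H cs cs); first by ring.
  by rewrite -E; ring.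
split.
- split=> [H|aff].
    apply/affP => m Dm Gm; have [u Su <-] := locus_param param Dm Gm.
    have [a1 [b1 [a2 [b2 [n1 n2 neq E1 E2]]]]] := type_null sG param hyp H Su.
    rewrite (value _ _ _ Su n1) in E1; rewrite (value _ _ _ Su n2) in E2.
    move: E1 E2; case: eqP => [b10 _|_]; last by case: eqP.
    case: eqP => [b20|_]; last by case: eqP.
    by move: neq; rewrite b10 b20 !mulr0 eqxx.
  apply: (type_of_value sG param hyp) => u Su a b n0; have [Du Gu] := locus u Su.
  by rewrite (value _ _ _ Su n0) (affP.1 aff) // eqxx; case: ifP.
- move=> [c1 [c2 H]] naff.
  have sel v : S v -> exists a1 b1 a2 b2, [/\ null_at G iF v a1 b1, null_at G iF v a2 b2,
      a1 * b2 != a2 * b1, c1 = class_value G iF v a1 b1 & c2 = class_value G iF v a2 b2].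
    by move=> Sv; exact: (type_null sG param hyp H Sv).
  (* Since the two directions are independent and only two null directions exist, exactly one of
     them is b = 0. Which of [c1], [c2] belongs to it is unknown. *)
  have dich v : S v -> (c1 = 6 /\ c2 = if fibre_curvature cs cr G (iF v) == 0 then 6 else 7) \/
      (c2 = 6 /\ c1 = if fibre_curvature cs cr G (iF v) == 0 then 6 else 7).
    move=> Sv; have [a1 [b1 [a2 [b2 [n1 n2 neq -> ->]]]]] := sel v Sv.
    rewrite (value _ _ _ Sv n1) (value _ _ _ Sv n2).
    have [b10|b10] := eqVneq b1 0; have [b20|b20] := eqVneq b2 0; [|by left|by right|].
      by move: neq; rewrite b10 b20 !mulr0 eqxx.
    have [Dv Gv] := locus v Sv; have B0 := G1 _ Dv Gv.
    case: (null v a1 b1 Sv n1) => [/eqP|E1]; first by rewrite (negPf b10).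
    case: (null v a2 b2 Sv n2) => [/eqP|E2]; first by rewrite (negPf b20).
    move: neq B0 E1 E2; move: (partial cr G _) (partial cs G _) => A B neq B0 E1 E2.
    case/negP: neq; apply/eqP; apply: (mulfI B0).
    by rewrite mulrA -E1 mulrA -E2; ring.
  have n66 : ~ (c1 = 6 /\ c2 = 6).
    move=> [E1 E2]; apply: naff; apply/affP => m Dm Gm.
    have [v Sv <-] := locus_param param Dm Gm.
    by case: (dich v Sv) => -[_]; rewrite ?E1 ?E2; case: eqP.
  move=> u Su.
  (* A zero of the curvature at this one point would make both constant classes 6. *)
  have [[E1]|[E2]] := dich u Su; case: eqP => _ E.
  + by case: n66.
  + by have := H u Su; rewrite E1 E.
  + by case: n66.
  + by have := has_type_sym H Su; rewrite E2 E.
Qed.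

(** At each point both null directions have the same class, decided by f_ss, so the values of f_ss
    on the locus yield the type 6-6 or 7-7 directly. *)
Theorem classification_rt D (f : 'rV[R]_8 -> R) S iF :
  let F := fun m : 'rV[R]_8 => m 0 cr * m 0 ct - f m in
  open D -> smooth_on D f -> independent_of [set cr; ct]%SET D f ->
  nondegenerate_parametrization D F S iF ->
  (hyperbolic F S iF <->
    forall u, S u -> 4 * f (iF u) < (partial cs f (iF u)) ^+ 2) /\
  (hyperbolic F S iF -> (forall u, S u -> iF u 0 cr * iF u 0 ct <> 0) ->
   (has_type S iF 6 6 <-> forall u, S u -> partial cs (partial cs f) (iF u) = 2) /\
   (has_type S iF 7 7 <-> forall u, S u -> partial cs (partial cs f) (iF u) <> 2)).
Proof.
move=> F oD sf ind param.
have sF : smooth_on D F.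
  by apply: smooth_onB => //; apply: smooth_onM => //; exact: smooth_on_coord.
have locus := param_locus param.
have fr m : D m -> partial cr f m = 0.
  by apply: (independent_partial oD sf ind); rewrite !inE.
have ft m : D m -> partial ct f m = 0.
  by apply: (independent_partial oD sf ind); rewrite !inE.
have pF c m : D m -> partial c F m =
    (cr == c)%:R * m 0 ct + m 0 cr * (ct == c)%:R - partial c f m.
  move=> Dm; rewrite partialB; last 2 first.
  - by apply: differentiableM; exact: differentiable_coord.
  - exact: smooth_on_differentiable Dm.
  rewrite partialM; try exact: differentiable_coord.
  by rewrite !partial_coord.
have Fr m : D m -> partial cr F m = m 0 ct.
  by move=> Dm; rewrite pF // fr // eqxx mul1r mulr0 addr0 subr0.
have Ft m : D m -> partial ct F m = m 0 cr.
  by move=> Dm; rewrite pF // ft // eqxx mul0r mulr1 add0r subr0.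
have Fs m : D m -> partial cs F m = - partial cs f m.
  by move=> Dm; rewrite pF // mul0r mulr0 !add0r.
have hypE : hyperbolic F S iF <->
    forall u, S u -> 4 * f (iF u) < (partial cs f (iF u)) ^+ 2.
  split=> H u Su; have := H u Su; have [Du] := locus u Su;
    rewrite (Fr _ Du) (Ft _ Du) (Fs _ Du) sqrrN /F => E; lra.
split=> // hyp rt0.
have null u a b : S u -> null_at F iF u a b -> a != 0 /\ b != 0.
  move=> Su n0; have [Du _] := locus u Su; have := null_atE n0; have [_ ab] := n0.
  rewrite (Fr _ Du) (Ft _ Du); have /eqP := rt0 u Su; rewrite mulf_eq0 negb_or => /andP[r0 t0].
  move=> E; split; apply/eqP => z0; move: E ab; rewrite z0 !mul0r !mulr0 ?mul0r ?mulr0.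
    rewrite subrr add0r => /eqP; rewrite mulf_eq0 (negPf t0) /= mulf_eq0 orbb => /eqP ->.
    by rewrite eqxx.
  rewrite subr0 addr0 => /eqP; rewrite mulf_eq0 (negPf r0) /= mulf_eq0 orbb => /eqP ->.
  by rewrite eqxx.
have value u a b : S u -> null_at F iF u a b -> class_value F iF u a b =
    if partial cs (partial cs f) (iF u) == 2 then 6 else 7.
  move=> Su n0; have [Du _] := locus u Su; have [a0 b0] := null u a b Su n0.
  (* The formulas for the first derivatives of [F] hold only on [D]; openness of [D] allows them to
     be differentiated. *)
  have near2 (g h : 'rV[R]_8 -> R) c : (forall m, D m -> g m = h m) ->
      partial c g (iF u) = partial c h (iF u).
    by move=> E; apply: partial_near_eq; apply: filterS (open_nbhs_nbhs (conj oD Du)).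
  have [H HE] := partial2_values F (iF u).
  have Hr c : H c cr = (ct == c)%:R by rewrite -HE (near2 _ _ c Fr) partial_coord.
  have Ht c : H c ct = (cr == c)%:R by rewrite -HE (near2 _ _ c Ft) partial_coord.
  have Hs c : H c cs = - partial c (partial cs f) (iF u).
    rewrite -HE (near2 _ _ c Fs); apply: deriveN; apply: diff_derivable.
    by apply: smooth_on_differentiable Du; exact: smooth_on_partial.
  have fsr : partial cr (partial cs f) (iF u) = 0.
    by rewrite (schwarz cr cs oD sf Du); exact: (partial_partial0 _ oD).
  have fst : partial ct (partial cs f) (iF u) = 0.
    by rewrite (schwarz ct cs oD sf Du); exact: (partial_partial0 _ oD).
  rewrite /class_value (hess_null_vectorE _ _ HE) !Hr !Ht !Hs fsr fst /=.
  congr (if _ then _ else _).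
  move: (partial cs (partial cs f) (iF u)) => x.
  rewrite -[x == 2]subr_eq0.
  (* The mixed r, t derivatives of r t contribute 2, so the Hessian is a^2 b^2 (2 - f_ss). *)
  apply: (@curvature_transfer 1 (- (a ^+ 2 * b ^+ 2))); rewrite ?oner_neq0 //.
    by rewrite oppr_eq0 mulf_neq0 ?expf_neq0.
  by ring.
split; split=> H.
- move=> u Su; have [a1 [b1 [_ [_ [n1 _ _ E _]]]]] := type_null sF param hyp H Su.
  by move: E; rewrite (value _ _ _ Su n1); case: eqP.
- apply: (type_of_value sF param hyp) => u Su a b n0.
  by rewrite (value _ _ _ Su n0) H // eqxx.
- move=> u Su; have [a1 [b1 [_ [_ [n1 _ _ E _]]]]] := type_null sF param hyp H Su.
  by move: E; rewrite (value _ _ _ Su n1); case: eqP.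
- apply: (type_of_value sF param hyp) => u Su a b n0.
  by rewrite (value _ _ _ Su n0); case: eqP => // E; case: (H u Su).
Qed.

End Classification.

Theorem corollary3p2 (R : realType) :
  (* F(x, y, z, p, q, r, t) = 0 *)
  (forall (D : set 'rV[R]_8) (F : 'rV[R]_8 -> R)
          (S : set 'rV[R]_7) (iF : 'rV[R]_7 -> 'rV[R]_8),
     open D -> smooth_on D F -> independent_of [set cs]%SET D F ->
     nondegenerate_parametrization D F S iF ->
     (hyperbolic F S iF <->
      forall u, S u -> partial cr F (iF u) * partial ct F (iF u) < 0) /\
     (hyperbolic F S iF ->
      (has_type S iF 6 6 <-> locus_affine_in cr ct D F) /\
      (constant_classes S iF -> ~ locus_affine_in cr ct D F ->
       has_type S iF 7 7))) /\
  (* G(x, y, z, p, q, r, s) = 0 *)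
  (forall (D : set 'rV[R]_8) (G : 'rV[R]_8 -> R)
          (S : set 'rV[R]_7) (iG : 'rV[R]_7 -> 'rV[R]_8),
     open D -> smooth_on D G -> independent_of [set ct]%SET D G ->
     nondegenerate_parametrization D G S iG ->
     (hyperbolic G S iG <->
      forall u, S u -> partial cs G (iG u) <> 0) /\
     (hyperbolic G S iG ->
      (has_type S iG 6 6 <-> locus_affine_in cr cs D G) /\
      (constant_classes S iG -> ~ locus_affine_in cr cs D G ->
       has_type S iG 6 7))) /\
  (* r t = f(x, y, z, p, q, s) *)
  (forall (D : set 'rV[R]_8) (f : 'rV[R]_8 -> R)
          (S : set 'rV[R]_7) (iF : 'rV[R]_7 -> 'rV[R]_8),
     let F := fun m : 'rV[R]_8 => m 0 cr * m 0 ct - f m in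
     open D -> smooth_on D f -> independent_of [set cr; ct]%SET D f ->
     nondegenerate_parametrization D F S iF ->
     (hyperbolic F S iF <->
      forall u, S u -> 4 * f (iF u) < (partial cs f (iF u)) ^+ 2) /\
     (hyperbolic F S iF ->
      (forall u, S u -> iF u 0 cr * iF u 0 ct <> 0) ->
      (has_type S iF 6 6 <->
       forall u, S u -> partial cs (partial cs f) (iF u) = 2) /\
      (has_type S iF 7 7 <->
       forall u, S u -> partial cs (partial cs f) (iF u) <> 2))).
Proof.
split; first exact: classification_independent_s.
split; first exact: classification_independent_t.
exact: classification_rt.
Qed.
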